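(* Let $\mathcal S=\{\phi_i,1\le i\le m\}$ be a system of conformal injective contractions. Assume that there are integers $1\le k_1<k_2<\ldots<k_p=m$ such that $$\phi_1=\ldots=\phi_{k_1},\quad \phi_{k_1+1}=\ldots=\phi_{k_2},\quad\ldots,\quad \phi_{k_{p-1}+1}=\ldots=\phi_{k_p}=\phi_m,$$ and that there are no overlaps between the different blocks, i.e. the system $\{\phi_{k_i},1\le i\le p\}$ satisfies the Open Set Condition. Then the topological overlap number of $\mathcal S$ is $$o(\mathcal S)=o(\mathcal S,\mu_{max})=\exp\Big(\frac{k_1\log k_1+(k_2-k_1)\log(k_2-k_1)+\ldots+(k_p-k_{p-1})\log(k_p-k_{p-1})}{m}\Big).$$
   Context: Setting. $\mathcal S=\{\phi_i,i\in I\}$ with $I=\{1,\ldots,m\}$, where the contractions $\phi_i$ are conformal and injective on an open set $U\subset\mathbb R^d$; $\phi_{i_1\ldots i_q}=\phi_{i_1}\circ\cdots\circ\phi_{i_q}$; $\Lambda\subset U$ is the limit set (the nonempty compact set with $\Lambda=\bigcup_i\phi_i(\Lambda)$). Let $\Sigma_I^+=\{\omega=(\omega_1,\omega_2,\ldots):\omega_i\in I\}$ with the shift $\sigma$, and let $\Phi:\Sigma_I^+\times\Lambda\to\Sigma_I^+\times\Lambda$, $\Phi(\omega,x)=(\sigma\omega,\phi_{\omega_1}(x))$, be the lift of $\mathcal S$. Let $\mu_{max}$ be the measure of maximal entropy of $\Phi$ (the equilibrium measure of the zero potential). The topological overlap number $o(\mathcal S)=o(\mathcal S,\mu_{max})$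 is the overlap number of $\mu_{max}$, namely $$o(\mathcal S)=\exp\Big(\lim_{n\to\infty}\frac1n\int_{\Sigma_I^+\times\Lambda}\log \mathrm{Card}\{(\eta_1,\ldots,\eta_n)\in I^n:\ \exists y\in\Lambda,\ \phi_{\omega_n\ldots\omega_1}(x)=\phi_{\eta_n\ldots\eta_1}(y)\}\,d\mu_{max}(\omega,x)\Big).$$ It is known that the limit exists and that, equivalently, $o(\mathcal S)=\exp\big(\lim_{n\to\infty}\frac1n\int_{\Sigma_I^+}\log\beta_n(\pi\omega)\,d\mu_{max}^+(\omega)\big)$, where $\beta_n(x)=\mathrm{Card}\{(\eta_1,\ldots,\eta_n)\in I^n: x\in\phi_{\eta_1\ldots\eta_n}(\Lambda)\}$, $\pi:\Sigma_I^+\to\Lambda$, $\pi(\omega)=\phi_{\omega_1\omega_2\ldots}:=\lim_{q\to\infty}\phi_{\omega_1\ldots\omega_q}(z)$ (for any $z\in\Lambda$) is the canonical projection, and $\mu_{max}^+$ is the Bernoulli measure on $\Sigma_I^+$ with weights $(\frac1m,\ldots,\frac1m)$. *)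

(* Defs.v *)
From HB Require Import structures.
From mathcomp Require Import all_boot all_order all_algebra.
From mathcomp Require Import all_classical all_reals all_analysis.

Set Implicit Arguments.
Unset Strict Implicit.
Unset Printing Implicit Defensive.

Import Order.TTheory GRing.Theory Num.Theory.
Import numFieldNormedType.Exports.

Local Open Scope classical_set_scope.
Local Open Scope ring_scope.

(* The library norm on row vectors is the sup norm, which induces the right
   topology but not the right notions of contraction and similarity. *)
Definition enorm (R : realType) (d : nat) (v : 'rV[R]_d) : R :=
  Num.sqrt (\sum_(i < d) v ord0 i ^+ 2).

Definition contraction_on (R : realType) (d : nat) (U : set 'rV[R]_d)
    (f : 'rV[R]_d -> 'rV[R]_d) : Prop :=
  exists2 c : R, c < 1 &
    forall x y, U x -> U y -> enorm (f x - f y) <= c * enorm (x - y).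

(* Derivatives are nonzero multiples of linear isometries and depend locally
   Hoelder-continuously on the point.  The Hoelder condition is automatic for
   d >= 2, where C^1 conformal maps are smooth; for d = 1 it is part of the usual
   definition of a conformal iterated function system. *)
Definition conformal_on (R : realType) (d : nat) (U : set 'rV[R]_d)
    (f : 'rV[R]_d -> 'rV[R]_d) : Prop :=
  [/\ forall x, U x -> differentiable f x,
      forall x, U x ->
        exists2 r : R, 0 < r & forall v, enorm ('d f x v) = r * enorm v
    & forall x, U x -> exists C a : R, 0 < a /\
        exists2 W, nbhs x W & forall y z v, W y -> W z ->
          enorm ('d f y v - 'd f z v) <= C * enorm (y - z) `^ a * enorm v].

Definition is_limit_set (R : realType) (d : nat) (I : Type)
    (phi : I -> 'rV[R]_d -> 'rV[R]_d) (L : set 'rV[R]_d) : Prop :=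
  [/\ L !=set0, compact L & L = \bigcup_i (phi i @` L)].

(* For the subsystem indexed by J. *)
Definition open_set_condition (R : realType) (d : nat) (I : Type)
    (U : set 'rV[R]_d) (phi : I -> 'rV[R]_d -> 'rV[R]_d) (J : set I) : Prop :=
  exists V : set 'rV[R]_d,
    [/\ open V, V !=set0, V `<=` U,
        forall i, J i -> phi i @` V `<=` V
      & forall i j, J i -> J j -> i <> j -> phi i @` V `&` phi j @` V = set0].

(* Kolmogorov-Sinai entropy of a self-map F of a space D, realised as a subset
   of full measure of an ambient measurable space.  A finite measurable
   partition is given by its labelling function. *)
Section entropy.
Context (R : realType) (dT : measure_display) (T : measurableType dT).
Variables (mu : probability T R) (D : set T) (F : T -> T).

Definition partition_entropy (J : finType) (f : T -> J) : R :=
  - \sum_(j : J) (let q := fine (mu (D `&` f @^-1` [set j])) in q * ln q).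

Definition itinerary (N : nat) (P : T -> 'I_N) (n : nat) (x : T) :
    {ffun 'I_n -> 'I_N} :=
  [ffun k : 'I_n => P (iter k F x)].

Definition entropy_wrt (N : nat) (P : T -> 'I_N) : R :=
  limn (fun n => n%:R^-1 * partition_entropy (itinerary P n)).

Definition ks_entropy : \bar R :=
  ereal_sup [set e | exists N (P : T -> 'I_N),
    (forall i, measurable (P @^-1` [set i])) /\ e = (entropy_wrt P)%:E].

End entropy.

HB.instance Definition _ (m : nat) := isPointed.Build 'I_m.+1 ord0.

(* The symbols are 'I_m.+1 = {0, ..., m} and words start at position 0. *)
Definition cylinders (m : nat) : set (set (nat -> 'I_m.+1)) :=
  [set C | exists n i, C = [set w | w n = i]].

Definition symbol_space (m : nat) := g_sigma_algebraType (@cylinders m).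

Definition borel_space (R : realType) (d : nat) :=
  g_sigma_algebraType [set A : set 'rV[R]_d | open A].

Definition lift_space (R : realType) (m d : nat) :=
  (symbol_space m * borel_space R d)%type.

Section lift.
Context (R : realType) (m d : nat).
Variables (phi : 'I_m.+1 -> 'rV[R]_d -> 'rV[R]_d) (L : set 'rV[R]_d).

Definition lift_domain : set (lift_space R m d) := setT `*` L.

(* Only the restriction of this map to lift_domain is meaningful. *)
Definition lift_map (z : lift_space R m d) : lift_space R m d :=
  ((fun n => z.1 n.+1), phi (z.1 0%N) z.2).

Definition lift_invariant (mu : probability (lift_space R m d) R) : Prop :=
  mu lift_domain = 1%E /\
  forall A, measurable A -> mu (lift_domain `&` lift_map @^-1` A) = mu A.

Definition lift_entropy (mu : probability (lift_space R m d) R) : \bar R :=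
  ks_entropy mu lift_domain lift_map.

Definition max_entropy_measure (mu : probability (lift_space R m d) R) : Prop :=
  lift_invariant mu /\
  forall nu : probability (lift_space R m d) R,
    lift_invariant nu -> (lift_entropy nu <= lift_entropy mu)%E.

(* phi_(s_n ... s_1) for s = [:: s_1; ...; s_n]: the first letter acts first. *)
Definition comp_rev (s : seq 'I_m.+1) (x : 'rV[R]_d) : 'rV[R]_d :=
  foldl (fun y i => phi i y) x s.

Definition overlap_count (n : nat) (z : lift_space R m d) : nat :=
  #|[pred eta : n.-tuple 'I_m.+1 |
      `[< exists2 y, L y & comp_rev (mkseq z.1 n) z.2 = comp_rev eta y >]]|.

Definition overlap_rate (mu : probability (lift_space R m d) R) (n : nat) : R :=
  n%:R^-1 * Rintegral mu lift_domain (fun z => ln (overlap_count n z)%:R).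

Definition overlap_number (mu : probability (lift_space R m d) R) : R :=
  expR (limn (overlap_rate mu)).

End lift.

(* Main.v *)
(* Let M be the number of maps and call block of a letter the set of letters
   with the same map.

   Counting codings.  By bounded distortion, the OSC subsystem has uniformly
   bounded multiplicity: at most N words b of length n over the block
   representatives satisfy x \in phi_b(L), for all n and x.  Along an orbit of
   the lift the number of codings of the second coordinate cannot decrease, as
   the applied letter can be appended to every coding.  For an invariant
   measure it is almost surely constant along orbits, so almost surely every
   coding of phi_i(x) uses a letter of the block of i.  Hence the overlap count
   of (w, x) is almost surely the product of the sizes of the blocks of
   w_1, ..., w_n, and the overlap rate is E[ln (size of the block of w_1)], for
   every n >= 1 and every invariant measure.

   Maximal entropy.  The coordinate x is determined up to small error by the
   letters applied in the past, so the letters generate: with q_i the law of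
   w_1, Gibbs' inequality gives h <= - sum_i q_i ln Q_i for every positive
   probability vector Q.  The lift of the two-sided Bernoulli shift is invariant
   with entropy at least ln M.  Taking for Q the average of q and the uniform
   law, a measure of maximal entropy must have q uniform. *)

Require Import Defs.
From HB Require Import structures.
From mathcomp Require Import all_boot all_order all_algebra.
From mathcomp Require Import all_classical all_reals all_analysis.
From mathcomp Require Import measurable_realfun.
From mathcomp Require Import zify ring lra.

Set Implicit Arguments.
Unset Strict Implicit.
Unset Printing Implicit Defensive.

Import Order.TTheory GRing.Theory Num.Theory.
Import numFieldNormedType.Exports.

Local Open Scope classical_set_scope.
Local Open Scope ring_scope.

(** * The Euclidean norm *)

(** The obstacle is that [L] may meet the boundary of [V]: the images of [V] are disjoint, yet a
    point of [L] can have several codings over the representatives. Bounded multiplicity controls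
    this. It leaves finitely many thresholds [t] for the number of codings; for each of them the
    points with at least [t] codings at some length are mapped into themselves, so by invariance
    entering this set from outside has probability zero. A finite union of such null events is
    discarded.

    For the entropy, Gibbs' inequality compares the law of itineraries with a model that draws
    letters from [Q] and guesses each label from a window of letters; wrong guesses are rare, so the
    labels add nothing to the rate. The weights [Q] must be positive while [q] may vanish on some
    letter, which is why [q] is averaged with the uniform law. The lift applies a future letter to
    [x], so [x] records the past; the competing measure therefore comes from the two-sided shift,
    whose past component codes [x]. Maximality is used only to find the law of a single letter, on
    which alone the overlap rate depends. *)

Section enorm.
Context (R : realType) (d : nat).
Implicit Types u v w x y : 'rV[R]_d.

Lemma enorm_ge0 v : 0 <= enorm v.
Proof. exact: sqrtr_ge0. Qed.

Lemma sqr_enorm v : enorm v ^+ 2 = \sum_(i < d) v ord0 i ^+ 2.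
Proof. by rewrite sqr_sqrtr// sumr_ge0// => i _; exact: sqr_ge0. Qed.

Lemma enorm0 : enorm (0 : 'rV[R]_d) = 0.
Proof.
by rewrite /enorm big1 ?sqrtr0// => i _; rewrite mxE expr0n.
Qed.

Lemma enorm_coord v i : `|v ord0 i| <= enorm v.
Proof.
rewrite -(@ler_pXn2r _ 2)// ?nnegrE ?enorm_ge0// sqr_enorm real_normK ?num_real//.
by rewrite (bigD1 i)//= lerDl sumr_ge0// => j _; exact: sqr_ge0.
Qed.

Lemma enorm_eq0 v : enorm v = 0 -> v = 0.
Proof.
move=> v0; apply/rowP => i; rewrite mxE; apply/eqP.
by rewrite -normr_le0 -v0 enorm_coord.
Qed.

Lemma enormN v : enorm (- v) = enorm v.
Proof. by rewrite /enorm; congr Num.sqrt; apply: eq_bigr => i _; rewrite mxE sqrrN. Qed.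

Lemma enormC u v : enorm (u - v) = enorm (v - u).
Proof. by rewrite -enormN opprB. Qed.

Lemma enormZ (a : R) v : enorm (a *: v) = `|a| * enorm v.
Proof.
rewrite /enorm -sqrtr_sqr -sqrtrM ?sqr_ge0//; congr Num.sqrt.
by rewrite mulr_sumr; apply: eq_bigr => i _; rewrite mxE exprMn.
Qed.

(** Cauchy-Schwarz: expand the nonnegative sum of squares of the entries of
    [enorm u *: v - enorm v *: u] and divide by the product of the two norms. *)
Lemma dot_le_enorm u v : \sum_(i < d) u ord0 i * v ord0 i <= enorm u * enorm v.
Proof.
have [->|u0] := eqVneq u 0.
  by rewrite enorm0 mul0r big1// => i _; rewrite mxE mul0r.
have eu0 : 0 < enorm u.
  by rewrite lt_neqAle enorm_ge0 andbT eq_sym; apply: contra_neq u0; exact: enorm_eq0.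
set S := \sum_(i < d) _; pose a := enorm u; pose b := enorm v.
have : 0 <= \sum_(i < d) (a * v ord0 i - b * u ord0 i) ^+ 2.
  by apply: sumr_ge0 => i _; exact: sqr_ge0.
have -> : \sum_(i < d) (a * v ord0 i - b * u ord0 i) ^+ 2 =
    a ^+ 2 * b ^+ 2 + b ^+ 2 * a ^+ 2 - a * b * S *+ 2.
  have -> : a ^+ 2 * b ^+ 2 = \sum_(i < d) a ^+ 2 * v ord0 i ^+ 2.
    by rewrite -mulr_sumr -sqr_enorm.
  have -> : b ^+ 2 * a ^+ 2 = \sum_(i < d) b ^+ 2 * u ord0 i ^+ 2.
    by rewrite -mulr_sumr -sqr_enorm.
  rewrite -mulrnAr -sumrMnl mulr_sumr -sumrN -!big_split/=.
  by apply: eq_bigr => i _; ring.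
have [b0|b0] := eqVneq b 0.
  rewrite (_ : S = 0) ?mulr_ge0 ?enorm_ge0//.
  by rewrite /S big1// => i _; rewrite (enorm_eq0 b0) mxE mulr0.
have {}b0 : 0 < b by rewrite lt_neqAle eq_sym b0 enorm_ge0.
have ab0 : 0 < a * b by rewrite mulr_gt0.
rewrite mulr2n => H; rewrite -/a -/b -(ler_pM2l ab0).
have E : a * b * (a * b) = a ^+ 2 * b ^+ 2 by ring.
have E' : b ^+ 2 * a ^+ 2 = a ^+ 2 * b ^+ 2 by ring.
rewrite E; rewrite E' in H; lra.
Qed.

Lemma ler_enormD u v : enorm (u + v) <= enorm u + enorm v.
Proof.
rewrite -(@ler_pXn2r _ 2)// ?nnegrE ?addr_ge0 ?enorm_ge0//.
rewrite sqrrD !sqr_enorm (_ : \sum_(i < d) _ = \sum_(i < d) u ord0 i ^+ 2 +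
   (\sum_(i < d) u ord0 i * v ord0 i) *+ 2 + \sum_(i < d) v ord0 i ^+ 2).
  by rewrite lerD2r lerD2l lerMn2r/= dot_le_enorm.
rewrite -sumrMnl -!big_split/=; apply: eq_bigr => i _; rewrite mxE; ring.
Qed.

Lemma ler_enorm_dist x y z : enorm (x - z) <= enorm (x - y) + enorm (y - z).
Proof. by apply: le_trans (ler_enormD _ _); rewrite addrA subrK. Qed.

Lemma ler_enormB x y : enorm x - enorm y <= enorm (x - y).
Proof. by rewrite lerBlDr; apply: le_trans (ler_enormD _ _); rewrite subrK. Qed.

Lemma enorm_le_sum v : enorm v <= \sum_(i < d) `|v ord0 i|.
Proof.
rewrite -(@ler_pXn2r _ 2)// ?nnegrE ?enorm_ge0//; last first.
  by apply: sumr_ge0 => i _; exact: normr_ge0.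
rewrite sqr_enorm expr2 mulr_suml; apply: ler_sum => i _.
rewrite -real_normK ?num_real// expr2 ler_wpM2l//.
by rewrite (bigD1 i)//= lerDl sumr_ge0.
Qed.

Lemma enorm_le_coord v (b : R) : (forall i, `|v ord0 i| <= b) -> enorm v <= d%:R * b.
Proof.
move=> vb; apply: le_trans (enorm_le_sum _) _.
by apply: le_trans (ler_sum _ (fun i _ => vb i)) _; rewrite sumr_const card_ord mulr_natl.
Qed.

Lemma coord_le_norm v i : `|v ord0 i| <= `|v|.
Proof.
rewrite [leRHS]mx_normE.
have -> : `|v ord0 i| = (`|v ord0 i|%:nng)%:num by [].
by rewrite num_le; exact: (le_bigmax _ (fun ij : 'I_1 * 'I_d => `|v ij.1 ij.2|%:nng) (ord0, i)).
Qed.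

Lemma enorm_le_norm v : enorm v <= d%:R * `|v|.
Proof. by apply: enorm_le_coord => i; exact: coord_le_norm. Qed.

Lemma norm_le_enorm v : `|v| <= enorm v.
Proof.
rewrite [leLHS]mx_normE.
have -> : enorm v = (NngNum (enorm_ge0 v))%:num by [].
rewrite num_le; apply/bigmax_leP; split => [|[i j] _] /=.
  by rewrite -num_le/= enorm_ge0.
by rewrite -num_le/= ord1 enorm_coord.
Qed.

Lemma nbhs_enorm x (W : set 'rV[R]_d) :
  nbhs x W <-> exists2 e : R, 0 < e & forall y, enorm (y - x) <= e -> W y.
Proof.
split=> [/nbhs_normP[e /= e0 eW]|[e e0 eW]].
  exists (e / 2); first by rewrite divr_gt0.
  move=> y yx; apply: eW => /=; rewrite distrC.
  by apply: le_lt_trans (norm_le_enorm _) _; apply: le_lt_trans yx _; rewrite gtr_pMr// invf_lt1// ltr1n.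
(* Dividing by [d.+1] instead of [d] keeps the radius meaningful in dimension zero. *)
apply: (proj2 (nbhs_normP x W)); exists (e / d.+1%:R) => /=; first by rewrite divr_gt0.
move=> y /= yx; apply: eW; apply: le_trans (enorm_le_norm _) _.
rewrite distrC; apply: le_trans (_ : d%:R * (e / d.+1%:R) <= _).
  by rewrite ler_wpM2l// (ltW yx).
by rewrite mulrCA ler_piMr ?(ltW e0)// ler_pdivrMr// mul1r ler_nat.
Qed.

Lemma continuous_enormB x : continuous (fun y : 'rV[R]_d => enorm (y - x)).
Proof.
move=> y; apply: (proj2 (@cvgrPdist_le _ _ _ _ (nbhs_filter y) _ _)) => e e0.
apply: (proj2 (nbhs_enorm _ _)); exists e => // z zy; rewrite ler_norml.
have := ler_enorm_dist y z x; have := ler_enorm_dist z y x.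
by rewrite (enormC y z) => *; apply/andP; split; lra.
Qed.

Lemma closed_eball x (r : R) : closed [set y | enorm (y - x) <= r].
Proof.
have c := @continuous_enormB x; move/continuous_closedP : c => /(_ _ (@closed_le R r)).
exact.
Qed.

Lemma compact_eball x (r : R) : compact [set y | enorm (y - x) <= r].
Proof.
apply: bounded_closed_compact; last exact: closed_eball.
exists (`|x| + r); split; first exact: num_real.
move=> M xM y /= yx; apply: ltW; apply: le_lt_trans xM.
rewrite -[y](subrK x) addrC; apply: le_trans (ler_normD _ _) _.
by rewrite lerD2l; apply: le_trans (norm_le_enorm _) yx.
Qed.

End enorm.

(** * Uniform approximation of conformal maps by similarities *)

Section strict_diff.
Context (R : realType) (d : nat).
Implicit Types (f : 'rV[R]_d -> 'rV[R]_d) (x y z h v : 'rV[R]_d).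

Lemma is_derive_line f z h t j : differentiable f (z + t *: h) ->
  is_derive (t : R) (1 : R) (fun u : R => f (z + u *: h) ord0 j)
    (('d f (z + t *: h) h) ord0 j).
Proof.
move=> df.
have @c : {linear 'rV[R]_d -> R}.
  by exists (fun N : 'rV[R]_d => N ord0 j); do 2![eexists]; do ?[constructor];
     rewrite ?mxE// => ? *; rewrite ?mxE//; move=> ?; rewrite !mxE.
have dl : is_diff t (fun u : R => z + u *: h) (fun u => u *: h).
  have := is_diffD (is_diff_cst z t) (is_diff_scalel t h).
  by rewrite add0r.
have dc : is_diff (f (z + t *: h)) c c.
  apply: DiffDef; first exact: differentiable_coord.
  by apply: diff_lin; exact: coord_continuous.
have dff : is_diff (z + t *: h) f ('d f (z + t *: h)) by exact: DiffDef.
have H := is_diff_comp dl dff.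
have {}H := is_diff_comp H dc.
have D : differentiable (fun u : R => f (z + u *: h) ord0 j) (t : R) by case: H.
apply: DeriveDef; first exact: diff_derivable.
rewrite deriveE//; case: H => _ E.
rewrite (_ : (fun u : R => f (z + u *: h) ord0 j) = c \o (f \o (fun u : R => z + u *: h)))//.
by rewrite E /= scale1r.
Qed.

(** The scalar mean value theorem is applied to each coordinate of [f - A] along the segment. The
    intermediate point depends on the coordinate, which costs the factor [d]. *)
Lemma mean_value_enorm f (A : {linear 'rV[R]_d -> 'rV[R]_d}) y y' (b : R) :
  (forall t : R, 0 <= t <= 1 -> differentiable f (y' + t *: (y - y'))) ->
  (forall t : R, 0 <= t <= 1 ->
     enorm ('d f (y' + t *: (y - y')) (y - y') - A (y - y')) <= b) ->
  enorm (f y - f y' - A (y - y')) <= d%:R * b.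
Proof.
move=> df db; apply: enorm_le_coord => j.
set h := y - y'.
pose g := fun u : R => f (y' + u *: h) ord0 j - u * (A h) ord0 j.
have dg (t : R) : 0 <= t <= 1 ->
    is_derive (t : R) (1 : R) g (('d f (y' + t *: h) h - A h) ord0 j).
  move=> t01; rewrite !mxE.
  have := is_deriveB (is_derive_line j (df _ t01))
     (is_deriveM (is_derive_id (t : R) (1:R)) (is_derive_cst ((A h) ord0 j) (t : R) (1:R))).
  by move=> H; apply: is_derive_eq H _; rewrite /GRing.scale/= mulr0 add0r mulr1.
have [t||c c01] := @MVT R g (fun t => ('d f (y' + t *: h) h - A h) ord0 j) 0 1 ltr01.
- by rewrite in_itv/= => /andP[/ltW t0 /ltW t1]; apply: dg; rewrite t0 t1.
- apply: derivable_within_continuous => t; rewrite in_itv/= => t01.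
  by case: (dg t t01).
have e1 : y' + h = y by rewrite /h addrC subrK.
rewrite subr0 mulr1 /g scale0r scale1r addr0 e1 mul0r subr0 mul1r => E.
move: c01; rewrite in_itv/= => /andP[/ltW c0 /ltW c1].
rewrite (_ : _ ord0 j = ('d f (y' + c *: h) h - A h) ord0 j); last first.
  by rewrite -E !mxE; ring.
by apply: le_trans (enorm_coord _ _) (db _ _); rewrite c0 c1.
Qed.

(* A single parameter bounds the radius from above and the ratio from below and
   gives the Hoelder constant [e^-1] and exponent [e]; the condition weakens as
   [e] decreases, hence holds for a common [e] on a compact set. *)
Definition unif_conformal (U : set 'rV[R]_d) f (e : R) z : Prop :=
  (forall y, enorm (y - z) <= e -> U y) /\
  exists2 l : R, e <= l &
  exists2 A : {linear 'rV[R]_d -> 'rV[R]_d}, forall v, enorm (A v) = l * enorm v &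
  forall s, s <= e -> forall y y', enorm (y - z) <= s -> enorm (y' - z) <= s ->
    enorm (f y - f y' - A (y - y')) <= e^-1 * s `^ e * l * enorm (y - y').

Lemma exists_unit_vector : (0 < d)%N -> exists2 v : 'rV[R]_d, enorm v = 1 & v != 0.
Proof.
move=> d0; pose v : 'rV[R]_d := delta_mx ord0 (Ordinal d0).
have v1 : enorm v = 1.
  rewrite /enorm (bigD1 (Ordinal d0))//= big1 ?addr0.
    by rewrite !mxE !eqxx expr1n sqrtr1.
  by move=> i ni; rewrite !mxE (negbTE ni) andbF expr0n.
exists v => //; apply/eqP => v0.
by move: v1; rewrite v0 enorm0 => /eqP; rewrite eq_sym oner_eq0.
Qed.

Lemma ler_powR_base (b c a : R) : 0 <= a -> 0 <= b -> b <= c -> b `^ a <= c `^ a.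
Proof.
move=> a0 b0 bc; apply: ge0_ler_powR; rewrite ?nnegrE//; exact: le_trans bc.
Qed.

Lemma enormB_bound (u w : 'rV[R]_d) (r l c : R) :
  enorm (u - w) <= c -> enorm u = r -> enorm w = l -> r - l <= c.
Proof. by move=> uw <- <-; exact: le_trans (ler_enormB _ _) uw. Qed.

Lemma local_conformal (U : set 'rV[R]_d) f x : (0 < d)%N -> open U ->
  conformal_on U f -> U x ->
  exists2 e0 : R, 0 < e0 & forall e z, 0 < e <= e0 -> enorm (z - x) <= e0 ->
    unif_conformal U f e z.
Proof.
move=> d0 oU [fd fc fH] Ux.
have [C [a [a0 [W Wx HW]]]] := fH x Ux.
have [r r0 Dr] := fc x Ux.
have /nbhs_enorm[e1 e10 WU] : nbhs x (W `&` U) by apply: filterI => //; exact: open_nbhs_nbhs.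
pose K := `|C| + 1; have K0 : 0 < K by rewrite ltr_wpDl.
have K1 : 1 <= K by rewrite lerDr.
pose q := r / (2 * K); have q0 : 0 < q by rewrite divr_gt0 ?mulr_gt0.
(* The bound [e1 / 2] keeps the balls about [z] in the neighbourhood of [x]; the power of [q] lets
   the ratio drop by at most [r / 2]; [1] and [a] allow exponent [a] to be replaced by [e]; [r / 2]
   gives [e <= l]; the last bound absorbs [d%:R * K] into [e^-1 * l]. *)
pose e0 := Num.min (Num.min (e1 / 2) (q `^ a^-1)) (Num.min (Num.min 1 a) (Num.min (r / 2) (r / (2 * d%:R * K)))).
have dK0 : 0 < 2 * d%:R * K by rewrite !mulr_gt0 // ltr0n.
have e00 : 0 < e0.
  by rewrite !lt_min a0 ltr01 !divr_gt0// powR_gt0.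
exists e0 => // e z /andP[ep ee0] zx.
have [[h1 h2 h3] [h4 h5 h6]] : [/\ e0 <= e1 / 2, e0 <= q `^ a^-1 & e0 <= 1] /\
    [/\ e0 <= a, e0 <= r / 2 & e0 <= r / (2 * d%:R * K)].
  by do 2 split; rewrite /e0 !ge_min lexx ?orbT.
have WUz y : enorm (y - z) <= e -> W y /\ U y.
  move=> yz; apply: WU; apply: le_trans (ler_enorm_dist _ z _) _.
  apply: le_trans (lerD yz zx) _; lra.
have [Wz Uz] : W z /\ U z by apply: WUz; rewrite subrr enorm0 ltW.
have Wxx : W x /\ U x by apply: WU; rewrite subrr enorm0 ltW.
split=> [y /WUz[]//|].
have [l l0 Dl] := fc z Uz.
have CK : C <= K by rewrite /K; apply: le_trans (ler_norm _) _; rewrite lerDl.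
have e0a : e0 `^ a <= q.
  have -> : q = (q `^ a^-1) `^ a by rewrite -powRrM mulVf ?powRr1 ?gt_eqF ?ltW.
  by apply: ler_powR_base => //; exact: ltW.
have rl : r / 2 <= l.
  have [v v1 v0] := exists_unit_vector d0.
  have H1 := enormB_bound (HW x z v Wxx.1 Wz) (Dr v) (Dl v).
  rewrite v1 !mulr1 in H1.
  have : C * enorm (x - z) `^ a <= K * q.
    apply: le_trans (_ : K * enorm (x - z) `^ a <= _).
      by rewrite ler_wpM2r// powR_ge0.
    rewrite ler_wpM2l// ?(ltW K0)//; apply: le_trans e0a.
    by apply: ler_powR_base; rewrite ?enorm_ge0 ?(ltW a0)// enormC.
  have -> : K * q = r / 2 by rewrite /q; field; rewrite ?gt_eqF// ?mulr_gt0.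
  by move=> H2; lra.
exists l; first by lra.
exists ('d f z) => // s se y y' yz y'z.
have s0 : 0 <= s by apply: le_trans yz; exact: enorm_ge0.
have seg (t : R) : 0 <= t <= 1 -> enorm (y' + t *: (y - y') - z) <= s.
  move=> /andP[t0 t1].
  have -> : y' + t *: (y - y') - z = t *: (y - z) + (1 - t) *: (y' - z).
    by apply/rowP => i; rewrite !mxE; ring.
  apply: le_trans (ler_enormD _ _) _; rewrite !enormZ !ger0_norm ?subr_ge0//.
  have := ler_wpM2l t0 yz; have : 0 <= 1 - t by lra.
  by move=> /ler_wpM2l/(_ _ _ y'z); lra.
have segWU (t : R) : 0 <= t <= 1 -> W (y' + t *: (y - y')) /\ U (y' + t *: (y - y')).
  by move=> /seg H; apply: WUz; exact: le_trans H se.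
apply: le_trans (_ : d%:R * (K * s `^ a * enorm (y - y')) <= _).
  apply: mean_value_enorm => t t01; first by apply: fd; case: (segWU t t01).
  have [Wt _] := segWU t t01.
  apply: le_trans (HW _ _ _ _ _) _ => //.
  rewrite ler_wpM2r ?enorm_ge0//.
  apply: le_trans (_ : K * enorm (y' + t *: (y - y') - z) `^ a <= _).
    by rewrite ler_wpM2r// powR_ge0.
  rewrite ler_wpM2l// ?(ltW K0)//.
  by apply: ler_powR_base; rewrite ?enorm_ge0 ?(ltW a0)// seg.
rewrite mulrA ler_wpM2r ?enorm_ge0//.
have sae : s `^ a <= s `^ e.
  move: s0; rewrite le_eqVlt => /orP[/eqP<-|s0].
    by rewrite !powR0 ?gt_eqF.
  by apply: ger_powR; lra.
apply: le_trans (_ : d%:R * K * s `^ e <= _).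
  by rewrite -mulrA ler_wpM2l// ler_wpM2l// ltW.
rewrite [leRHS]mulrAC ler_wpM2r ?powR_ge0//.
rewrite ler_pdivlMl//; apply: le_trans rl.
apply: le_trans (_ : e0 * (d%:R * K) <= _).
  by rewrite ler_wpM2r// mulr_ge0// ltW.
have : e0 * (2 * d%:R * K) <= r by rewrite -ler_pdivlMr.
lra.
Qed.

End strict_diff.

Section ball_image.
Context (R : realType) (d : nat).
Implicit Types (f : 'rV[R]_d -> 'rV[R]_d) (x y z v w : 'rV[R]_d).

(** A linear map scaling every norm by [l > 0] has trivial kernel, hence is invertible in finite
    dimension. *)
Lemma similarity_inverse (A : {linear 'rV[R]_d -> 'rV[R]_d}) (l : R) :
  0 < l -> (forall v, enorm (A v) = l * enorm v) ->
  exists B : {linear 'rV[R]_d -> 'rV[R]_d},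
    (forall v, B (A v) = v) /\ (forall v, enorm v = l * enorm (B v)).
Proof.
move=> l0 Al; pose M := lin1_mx A.
have AM v : A v = v *m M by rewrite /M mul_rV_lin1.
have Mu : M \in unitmx.
  rewrite -row_free_unit -kermx_eq0; apply/rowV0P => v /sub_kermxP.
  rewrite -AM => v0; apply: enorm_eq0; apply/eqP.
  by have := Al v; rewrite v0 enorm0 => /esym/eqP; rewrite mulf_eq0 gt_eqF.
exists (mulmxr (invmx M)); split=> v /=.
  by rewrite AM mulmxK.
by rewrite -Al AM mulmxKV.
Qed.

(* A minimiser of [enorm (f y - w)] over the ball is a solution: otherwise the
   simplified Newton step [T] would make it smaller. *)
Lemma ball_image f (A : {linear 'rV[R]_d -> 'rV[R]_d}) (l t s : R) z w :
  0 < l -> (forall v, enorm (A v) = l * enorm v) -> 0 <= t < 1 -> 0 <= s ->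
  (forall y y', enorm (y - z) <= s -> enorm (y' - z) <= s ->
    enorm (f y - f y' - A (y - y')) <= t * l * enorm (y - y')) ->
  enorm (w - f z) <= (1 - t) * l * s ->
  exists2 y, enorm (y - z) <= s & f y = w.
Proof.
move=> l0 Al /andP[t0 t1] s0 fA wz.
have [B [BA Bl]] := similarity_inverse l0 Al.
pose D := [set y : 'rV[R]_d | enorm (y - z) <= s].
have Dz : D z by rewrite /D /= subrr enorm0.
pose g y := enorm (f y - w).
have cg : {within D, continuous g}.
  apply/subspace_continuousP => x Dx.
  apply: (proj2 (@cvgrPdist_le _ _ _ _ (within_filter D (nbhs_filter x)) _ _)) => e e0.
  apply: (proj2 (nbhs_enorm _ _)); exists (e / (2 * l)).
    by rewrite divr_gt0// mulr_gt0.
  move=> y yx Dy; rewrite ler_norml.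
  have H1 := fA _ _ Dy Dx.
  have H2 : enorm (f y - f x) <= e.
    rewrite -[f y - f x](subrK (A (y - x))); apply: le_trans (ler_enormD _ _) _.
    rewrite Al; apply: le_trans (lerD H1 (lexx _)) _.
    rewrite ler_pdivlMr ?mulr_gt0// in yx.
    have : t * (l * enorm (y - x)) <= l * enorm (y - x).
      by rewrite ler_piMl ?mulr_ge0 ?enorm_ge0 ?ltW.
    lra.
  have := ler_enorm_dist (f y) (f x) w; have := ler_enorm_dist (f x) (f y) w.
  rewrite (enormC (f x) (f y)) /g /from_subspace => G1 G2.
  by apply/andP; split; lra.
have [y0 /set_mem Dy0 y0min] := compact_EVT_min (ex_intro _ z Dz) (@compact_eball R d z s) cg.
pose T y := y - B (f y - w).
have TB y y' : T y - T y' = - B (f y - f y' - A (y - y')).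
  by rewrite /T !linearB/= !BA; apply/rowP => i; rewrite !mxE; ring.
have Tlip y y' : D y -> D y' -> enorm (T y - T y') <= t * enorm (y - y').
  move=> Dy Dy'; rewrite TB enormN -(ler_pM2l l0) -Bl mulrCA mulrA.
  exact: fA.
have Tg y : l * enorm (T y - y) = g y.
  by rewrite /T addrAC subrr sub0r enormN -Bl.
have DT : D (T y0).
  rewrite /D/=; apply: le_trans (ler_enorm_dist _ (T z) _) _.
  have H1 := Tlip _ _ Dy0 Dz.
  have H2 : enorm (T z - z) <= (1 - t) * s.
    by rewrite -(ler_pM2l l0) Tg /g enormC mulrCA mulrA.
  have : t * enorm (y0 - z) <= t * s by rewrite ler_wpM2l.
  lra.
have H := y0min (T y0) (mem_set DT).
have : g y0 = 0.
  apply/eqP; rewrite eq_le {2}/g enorm_ge0 andbT.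
  have : g (T y0) <= t * g y0.
    by rewrite -!Tg mulrCA ler_pM2l// Tlip.
  move=> H1; have : (1 - t) * g y0 <= 0 by lra.
  by rewrite pmulr_rle0 ?subr_gt0.
move=> /enorm_eq0/eqP; rewrite subr_eq0 => /eqP fy0.
by exists y0.
Qed.

Lemma uniform_conformal (I : finType) (U K : set 'rV[R]_d)
    (phi : I -> 'rV[R]_d -> 'rV[R]_d) : (0 < d)%N -> open U ->
  (forall i, conformal_on U (phi i)) -> compact K -> K `<=` U ->
  exists2 e : R, 0 < e & forall i z, K z -> unif_conformal U (phi i) e z.
Proof.
move=> d0 oU cphi cK KU.
have loc i : \forall e \near (0 : R)^'+, K `<=` unif_conformal U (phi i) e.
  apply: (proj1 (compact_near_coveringP K) cK _ (0 : R)^'+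
     (fun e z => unif_conformal U (phi i) e z)) => x Kx.
  have [e0 e00 H] := local_conformal d0 oU (cphi i) (KU _ Kx).
  exists ([set z | enorm (z - x) <= e0], [set e | 0 < e <= e0]).
    split=> /=.
      by apply: (proj2 (nbhs_enorm _ _)); exists e0.
    by near=> e; apply/andP; split => //; near: e; exact: nbhs_right_le.
  by move=> [z e] /= [zx e_]; exact: H.
have /filter_ex[e [e0 He]] : \forall e \near (0 : R)^'+,
    0 < e /\ forall i, K `<=` unif_conformal U (phi i) e.
  apply: filterI; first exact: nbhs_right_gt.
  exact: (@filter_forall R I (fun i e => K `<=` unif_conformal U (phi i) e) (0 : R)^'+ _ loc).
by exists e => // i z; exact: He.
Unshelve. all: by end_near.
Qed.

End ball_image.

Lemma comp_rev_cat (R : realType) (m d : nat) (phi : 'I_m.+1 -> 'rV[R]_d -> 'rV[R]_d) a b x :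
  comp_rev phi (a ++ b) x = comp_rev phi b (comp_rev phi a x).
Proof. exact: foldl_cat. Qed.

Lemma comp_rev_rcons (R : realType) (m d : nat) (phi : 'I_m.+1 -> 'rV[R]_d -> 'rV[R]_d) b i x :
  comp_rev phi (rcons b i) x = phi i (comp_rev phi b x).
Proof. by rewrite -cats1 comp_rev_cat. Qed.

Lemma exists_expr_le (R : realType) (c e : R) : 0 <= c < 1 -> 0 < e ->
  exists q, forall n, (q <= n)%N -> c ^+ n <= e.
Proof.
move=> /andP[c0 c1] e0; have c1' : `|c| < 1 by rewrite ger0_norm.
have /cvgrPdist_le/(_ e e0)[q _ H] := cvg_expr c1'.
by exists q => n /H; rewrite /= sub0r normrN ger0_norm// exprn_ge0.
Qed.

(** * Bounded distortion and packing *)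

(* [lam i z] is the ratio of the derivative of [phi i] at [z], and [err k] the
   relative deviation of the maps from similarities at scale [s * c ^+ k].
   Since an iterate of length [k] contracts by [c ^+ k], these deviations are
   summed along an orbit; no chain rule is needed. *)
Section distortion.
Context (R : realType) (d m : nat).
Variables (phi : 'I_m.+1 -> 'rV[R]_d -> 'rV[R]_d) (K : set 'rV[R]_d).
Variables (lam : 'I_m.+1 -> 'rV[R]_d -> R) (c s l0 D : R) (err : nat -> R).
Hypothesis d_gt0 : (0 < d)%N.
Hypothesis phiK : forall i x, K x -> K (phi i x).
Hypothesis c01 : 0 < c < 1.
Hypothesis s_gt0 : 0 < s.
Hypothesis l01 : 0 < l0 <= 1.
Hypothesis lam_ge : forall i z, K z -> l0 <= lam i z.
Hypothesis phiC : forall i z y, K z -> (K y \/ enorm (y - z) <= s) ->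
  enorm (phi i y - phi i z) <= c * enorm (y - z).
Hypothesis KD : forall x y, K x -> K y -> enorm (x - y) <= D.
Hypothesis err_ge0 : forall k, 0 <= err k.
Hypothesis err_sum : forall n, \sum_(k < n) err k <= 1 / 2.
Hypothesis step : forall i z k, K z ->
  exists2 A : {linear 'rV[R]_d -> 'rV[R]_d}, forall v, enorm (A v) = lam i z * enorm v &
  forall y y', enorm (y - z) <= s * c ^+ k -> enorm (y' - z) <= s * c ^+ k ->
    enorm (phi i y - phi i y' - A (y - y')) <= err k * lam i z * enorm (y - y').

Local Notation E n := (\sum_(k < n) err k).

Let c0 : 0 < c. Proof. by case/andP: c01. Qed.
Let c1 : c < 1. Proof. by case/andP: c01. Qed.
Let l00 : 0 < l0. Proof. by case/andP: l01. Qed.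

Let err_le k : err k <= 1 / 2.
Proof.
apply: le_trans (err_sum k.+1); rewrite big_ord_recr/= lerDr.
by apply: sumr_ge0.
Qed.

Let E_ge0 n : 0 <= E n. Proof. exact: sumr_ge0. Qed.

Let lam_gt0 i z : K z -> 0 < lam i z.
Proof. by move=> Kz; apply: lt_le_trans (lam_ge i Kz). Qed.

Lemma step_bounds i z k y : K z -> enorm (y - z) <= s * c ^+ k ->
  (1 - err k) * lam i z * enorm (y - z) <= enorm (phi i y - phi i z) /\
  enorm (phi i y - phi i z) <= (1 + err k) * lam i z * enorm (y - z).
Proof.
move=> Kz yz; have [A Al HA] := step i k Kz.
have zz : enorm (z - z) <= s * c ^+ k.
  by rewrite subrr enorm0 mulr_ge0 ?exprn_ge0 ?ltW.
have H := HA _ _ yz zz; split.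
  have := ler_enormD (phi i y - phi i z) (- (phi i y - phi i z - A (y - z))).
  rewrite enormN opprB addrC subrK Al => H'; lra.
have := ler_enormD (phi i y - phi i z - A (y - z)) (A (y - z)).
rewrite subrK Al => H'; lra.
Qed.

(** Test the contraction on a displacement of length [s * c ^+ k], where the linear part is accurate
    up to [err k]. The loss [1 - err k] is absorbed by the product in [ratio_decay]. *)
Lemma lam_le i z k : K z -> (1 - err k) * lam i z <= c.
Proof.
move=> Kz; have [v v1 _] := exists_unit_vector R d_gt0.
pose r := s * c ^+ k; have r0 : 0 < r by rewrite mulr_gt0 ?exprn_gt0.
have er : enorm (z + r *: v - z) = r.
  by rewrite addrC addKr enormZ v1 mulr1 gtr0_norm.
have rs : r <= s.
  by rewrite /r ler_piMr ?(ltW s_gt0)// exprn_ile1// ltW.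
have [H _] := step_bounds i Kz (y := z + r *: v) (k := k) (eq_ind_r (fun u => u <= _) (lexx _) er).
have H2 := phiC i Kz (y := z + r *: v) (or_intror (eq_ind_r (fun u => u <= _) rs er)).
rewrite er in H H2.
by rewrite -(ler_pM2r r0); exact: le_trans H H2.
Qed.

Lemma lam_le2 i z : K z -> lam i z <= 2.
Proof.
move=> Kz; have := lam_le i 0 Kz; have := err_le 0; have := lam_gt0 i Kz; have := c1.
have : 0 <= (1 / 2 - err 0) * lam i z.
  by rewrite mulr_ge0 ?subr_ge0 ?err_le// (ltW (lam_gt0 i Kz)).
move=> *; lra.
Qed.

(** By the chain rule this is the ratio of the derivative of [comp_rev phi b] at [z]; only the
    product form is used. *)
Fixpoint orbit_ratio (b : seq 'I_m.+1) (z : 'rV[R]_d) : R :=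
  if b is i :: b' then lam i z * orbit_ratio b' (phi i z) else 1.

Lemma comp_revK b z : K z -> K (comp_rev phi b z).
Proof. by elim: b z => //= i b IH z Kz; apply: IH; exact: phiK. Qed.

Lemma ratio_rcons b i z : orbit_ratio (rcons b i) z = orbit_ratio b z * lam i (comp_rev phi b z).
Proof. by elim: b z => [|j b IH] z /=; rewrite ?mulr1 ?mul1r// IH mulrA. Qed.

Lemma ratio_ge b z : K z -> l0 ^+ size b <= orbit_ratio b z.
Proof.
elim: b z => //= i b IH z Kz; rewrite exprS.
by apply: ler_pM; rewrite ?exprn_ge0 ?lam_ge ?IH ?ltW//; exact: phiK.
Qed.

Lemma ratio_gt0 b z : K z -> 0 < orbit_ratio b z.
Proof. by move=> Kz; apply: lt_le_trans (ratio_ge b Kz); rewrite exprn_gt0. Qed.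

(** Multiply the bounds of [lam_le] along the orbit, using that (1 - E)(1 - e) is at least 1 - (E +
    e) for nonnegative [E] and [e]. *)
Lemma ratio_decay b z : K z -> (1 - E (size b)) * orbit_ratio b z <= c ^+ size b.
Proof.
move=> Kz; elim/last_ind: b => [|b i IH]; first by rewrite big_ord0 subr0 mul1r.
rewrite size_rcons ratio_rcons big_ord_recr/= exprSr.
set v := comp_rev phi b z; have Kv : K v by exact: comp_revK.
apply: le_trans (_ : ((1 - E (size b)) * orbit_ratio b z) * ((1 - err (size b)) * lam i v) <= _).
  have -> : (1 - E (size b)) * orbit_ratio b z * ((1 - err (size b)) * lam i v) =
    (1 - (E (size b) + err (size b))) * (orbit_ratio b z * lam i v) +
    E (size b) * err (size b) * (orbit_ratio b z * lam i v) by ring.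
  by rewrite lerDl !mulr_ge0 ?(ltW (ratio_gt0 _ Kz)) ?(ltW (lam_gt0 _ Kv)).
have h1 : 0 <= 1 - E (size b) by have := err_sum (size b); lra.
have h2 : 0 <= 1 - err (size b) by have := err_le (size b); lra.
apply: ler_pM => //.
- by rewrite mulr_ge0// (ltW (ratio_gt0 _ Kz)).
- by rewrite mulr_ge0// (ltW (lam_gt0 _ Kv)).
- exact: lam_le.
Qed.

Lemma ratio_le b z : K z -> orbit_ratio b z <= 2 * c ^+ size b.
Proof.
move=> Kz; have := ratio_decay b Kz; have := err_sum (size b).
have := ratio_gt0 b Kz => r0 h.
have : 0 <= (1 / 2 - E (size b)) * orbit_ratio b z by rewrite mulr_ge0 ?subr_ge0 ?(ltW r0).
lra.
Qed.

(** Iterate [ball_image], last letter first. By [ratio_decay] the ball to be covered before the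
    letter at position [n] has radius at most [s * c ^+ n], the scale at which [err n] is valid. *)
Lemma comp_rev_ball b z w : K z ->
  enorm (w - comp_rev phi b z) <= (1 - E (size b)) * orbit_ratio b z * s ->
  exists2 y, enorm (y - z) <= s & comp_rev phi b y = w.
Proof.
move=> Kz; elim/last_ind: b w => [|b i IH] w.
  by rewrite big_ord0 subr0 !mul1r => wz; exists w.
rewrite size_rcons ratio_rcons big_ord_recr/= comp_rev_rcons.
set v := comp_rev phi b z; have Kv : K v by exact: comp_revK.
set n := size b => H.
pose r := (1 - E n) * orbit_ratio b z * s.
have rn : r <= s * c ^+ n.
  by rewrite /r [leRHS]mulrC ler_wpM2r ?(ltW s_gt0)//; exact: ratio_decay.
have r0 : 0 <= r.
  have h1 : 0 <= 1 - E n by have := err_sum n; lra.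
  by rewrite !mulr_ge0 ?(ltW s_gt0) ?(ltW (ratio_gt0 _ Kz)).
have [A Al HA] := step i n Kv.
have tn : 0 <= err n < 1 by rewrite err_ge0; have := err_le n; lra.
have Hw : enorm (w - phi i v) <= (1 - err n) * lam i v * r.
  apply: le_trans H _.
  have -> : (1 - err n) * lam i v * r = (1 - (E n + err n)) * (orbit_ratio b z * lam i v) * s +
     E n * err n * (orbit_ratio b z * lam i v) * s by rewrite /r; ring.
  by rewrite lerDl !mulr_ge0 ?(ltW (ratio_gt0 _ Kz)) ?(ltW (lam_gt0 _ Kv)) ?(ltW s_gt0).
have [y1 y1v wy1] := ball_image (lam_gt0 i Kv) Al tn r0
   (fun y y' h h' => HA y y' (le_trans h rn) (le_trans h' rn)) Hw.
have [y yz by1] := IH y1 y1v.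
by exists y => //; rewrite comp_rev_rcons by1.
Qed.

Lemma comp_rev_contract b z y : K z -> K y ->
  enorm (comp_rev phi b y - comp_rev phi b z) <= c ^+ size b * enorm (y - z).
Proof.
move=> Kz Ky; elim/last_ind: b => [|b i IH]; first by rewrite mul1r.
rewrite !comp_rev_rcons size_rcons exprS -mulrA.
apply: le_trans (phiC _ _ _) _; [exact: comp_revK|left; exact: comp_revK|].
by rewrite ler_wpM2l// ltW.
Qed.

(** Two points of [K] may be further apart than [s], where no linear approximation is available. The
    first [q] letters, estimated crudely, bring them within [s]; from then on the letter at position
    [n] is used at scale [s * c ^+ (n - q)], with summable errors. *)
Lemma bounded_distortion : exists2 C : R, 1 <= C &
  forall b v v', K v -> K v' ->
    orbit_ratio b v' <= C * orbit_ratio b v /\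
    enorm (comp_rev phi b v' - comp_rev phi b v) <= C * orbit_ratio b v.
Proof.
have [D0|D0] := ltP D 0.
  by exists 1 => // b v v' Kv _; have := KD Kv Kv; rewrite subrr enorm0 => /(le_lt_trans)/(_ D0); rewrite ltxx.
have [q Dq] : exists q, c ^+ q * D <= s.
  have D1 : 0 < D + 1 by rewrite ltr_wpDl.
  have cc : 0 <= c < 1 by rewrite (ltW c0).
  have [q Hq] := exists_expr_le cc (divr_gt0 s_gt0 D1).
  exists q; apply: le_trans (_ : s / (D + 1) * (D + 1) <= _); last by rewrite divfK ?gt_eqF.
  by apply: ler_pM; rewrite ?exprn_ge0 ?(ltW c0)// ?Hq// lerDl.
(* Each of the first [q] letters costs [2 / l0], as the ratios lie between [l0] and [2]. A later one
   costs (1 + e) / (1 - e), which is at most the quotient of consecutive values of [PB], because 1 -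
   (F + e) <= (1 - F)(1 - e) and (1 - e)(1 + e) <= 1. *)
pose PB n := (2 / l0) ^+ minn n q / (1 - E (n - q)) ^+ 2.
have l2 : 2 <= 2 / l0 by rewrite ler_pdivlMr// ler_piMr//; case/andP: l01.
have l20 : 0 < 2 / l0 by lra.
have Eh n : 1 / 2 <= 1 - E n by have := err_sum n; lra.
have E0 n : 0 < 1 - E n by have := Eh n; lra.
have PBS n : (n < q)%N -> PB n.+1 = 2 / l0 * PB n.
  move=> nq; rewrite /PB (minn_idPl nq) (minn_idPl (ltnW nq)) exprS mulrA.
  by rewrite (eqP (ltnW nq : n - q == 0)%N) (eqP (nq : n.+1 - q == 0)%N).
have PBq n : (q <= n)%N -> (1 + err (n - q)) / (1 - err (n - q)) * PB n <= PB n.+1.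
  move=> qn; rewrite /PB (minn_idPr qn) (minn_idPr (leqW qn)) subSn//.
  rewrite mulrCA ler_wpM2l ?exprn_ge0 ?(ltW l20)//.
  rewrite big_ord_recr/=; set e := err _; set F := E _.
  have e0 : 0 <= e by exact: err_ge0.
  have e1 : e <= 1 / 2 by exact: err_le.
  have F0 : 0 <= F by exact: E_ge0.
  have F1 : 0 < 1 - F by exact: E0.
  have Fe : 0 < 1 - (F + e) by have := E0 (n - q).+1; rewrite big_ord_recr.
  have e2 : 0 < 1 - e by lra.
  rewrite -mulrA -invfM ler_pdivrMr ?mulr_gt0 ?exprn_gt0// [leRHS]mulrC.
  rewrite ler_pdivlMr ?exprn_gt0//.
  have h : 1 - (F + e) <= (1 - F) * (1 - e).
    by have := mulr_ge0 F0 e0; lra.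
  have h2 : (1 - (F + e)) ^+ 2 <= ((1 - F) * (1 - e)) ^+ 2.
    by rewrite ler_pXn2r// nnegrE ?mulr_ge0 ?ltW.
  apply: le_trans (_ : ((1 - F) * (1 - e)) ^+ 2 * (1 + e) <= _).
    by rewrite mulrC ler_wpM2r// addr_ge0.
  have -> : ((1 - F) * (1 - e)) ^+ 2 * (1 + e) = (1 - e) * (1 - F) ^+ 2 * (1 - e ^+ 2).
    by ring.
  rewrite ler_piMr ?mulr_ge0 ?exprn_ge0 ?(ltW F1) ?(ltW e2)//.
  by rewrite gerBl sqr_ge0.
have PB_le n : PB n <= 4 * (2 / l0) ^+ q.
  rewrite /PB mulrC; apply: ler_pM; rewrite ?invr_ge0 ?exprn_ge0 ?(ltW (E0 _)) ?(ltW l20)//.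
    rewrite -[leRHS]invrK lef_pV2 ?posrE ?exprn_gt0//.
    have -> : 4^-1 = (1 / 2) ^+ 2 :> R by field.
    by rewrite ler_pXn2r ?nnegrE ?(ltW (E0 _)).
  by rewrite ler_weXn2l ?geq_minr//; lra.
have PB_gt0 n : 0 < PB n by rewrite divr_gt0 ?exprn_gt0.
have main b v v' : K v -> K v' -> orbit_ratio b v' <= PB (size b) * orbit_ratio b v /\
    enorm (comp_rev phi b v' - comp_rev phi b v) <= D * PB (size b) * orbit_ratio b v.
  move=> Kv Kv'; elim/last_ind: b => [|b i [IH1 IH2]].
    rewrite /= /PB sub0n min0n big_ord0 subr0 expr1n divr1 !mulr1; split => //.
    exact: KD.
  rewrite size_rcons !ratio_rcons !comp_rev_rcons.
  set n := size b in IH1 IH2 *; set z := comp_rev phi b v in IH2 *.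
  set z' := comp_rev phi b v' in IH2 *.
  have Kz : K z by exact: comp_revK.
  have Kz' : K z' by exact: comp_revK.
  have lz := lam_ge i Kz; have lz' := lam_gt0 i Kz'.
  have rv := ratio_gt0 b Kv; have rv' := ratio_gt0 b Kv'.
  suff [u [u0 u1 u2 u3]] : exists u, [/\ 0 <= u, u * PB n <= PB n.+1,
      lam i z' <= u * lam i z & enorm (phi i z' - phi i z) <= u * lam i z * enorm (z' - z)].
    have lz0 := lam_gt0 i Kz; split.
      apply: le_trans (_ : PB n * orbit_ratio b v * (u * lam i z) <= _).
        by apply: ler_pM => //; exact: ltW.
      have -> : PB n * orbit_ratio b v * (u * lam i z) = u * PB n * (orbit_ratio b v * lam i z) by ring.
      by rewrite ler_wpM2r// mulr_ge0 ?(ltW rv) ?(ltW lz0).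
    apply: le_trans u3 _.
    apply: le_trans (_ : u * lam i z * (D * PB n * orbit_ratio b v) <= _).
      by rewrite ler_wpM2l// mulr_ge0 ?(ltW rv) ?(ltW lz0).
    have -> : u * lam i z * (D * PB n * orbit_ratio b v) = u * PB n * (D * (orbit_ratio b v * lam i z)) by ring.
    rewrite [leRHS](_ : _ = PB n.+1 * (D * (orbit_ratio b v * lam i z))); last by ring.
    by rewrite ler_wpM2r// !mulr_ge0 ?(ltW rv) ?(ltW lz0).
  have [nq|qn] := ltnP n q.
    exists (2 / l0); rewrite PBS//; split; [exact: ltW|by []| |].
      apply: le_trans (lam_le2 i Kz') _; rewrite mulrAC ler_pdivlMr//.
      by rewrite ler_wpM2l.
    apply: le_trans (phiC i Kz (or_introl Kz')) _.
    rewrite ler_wpM2r ?enorm_ge0//; apply: le_trans (ltW c1) _.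
    rewrite mulrAC ler_pdivlMr// mul1r; have := l00; lra.
  exists ((1 + err (n - q)) / (1 - err (n - q))).
  have e0 := err_ge0 (n - q); have e1 := err_le (n - q).
  have e2 : 0 < 1 - err (n - q) by lra.
  have e3 : 0 <= (1 + err (n - q)) / (1 - err (n - q)) by rewrite divr_ge0//; lra.
  have zz : enorm (z' - z) <= s * c ^+ (n - q).
    apply: le_trans (comp_rev_contract b Kv Kv') _.
    rewrite -/n -(subnK qn) exprD addnK -mulrA [leRHS]mulrC.
    rewrite ler_wpM2l ?exprn_ge0 ?(ltW c0)//.
    by apply: le_trans Dq; rewrite ler_wpM2l ?exprn_ge0 ?(ltW c0)//; exact: KD.
  have [_ s2] := step_bounds i Kz zz.
  have zz2 : enorm (z - z') <= s * c ^+ (n - q) by rewrite enormC.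
  have [s3 _] := step_bounds i Kz' zz2.
  rewrite (enormC z z') (enormC (phi i z) (phi i z')) in s3.
  split=> //; first exact: PBq.
    (* The approximations centred at [z] and at [z'] both estimate the distance of [phi i z] and
       [phi i z'], once from above and once from below; this compares the two ratios. *)
    have [->|zz'] := eqVneq z z'.
      by rewrite ler_peMl ?(ltW lz')// ler_pdivlMr//; lra.
    have z0 : 0 < enorm (z' - z).
      rewrite lt_neqAle enorm_ge0 andbT eq_sym; apply/eqP => /enorm_eq0/eqP.
      by rewrite subr_eq0 eq_sym (negbTE zz').
    rewrite mulrAC ler_pdivlMr// mulrC -(ler_pM2r z0); exact: le_trans s3 s2.
  apply: le_trans s2 _; rewrite ler_wpM2r ?enorm_ge0// ler_wpM2r// ?(ltW (lam_gt0 i Kz))//.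
  by rewrite ler_peMr// ?addr_ge0// -[leLHS]invr1 lef_pV2 ?posrE//; lra.
pose M := 4 * (2 / l0) ^+ q.
have M1 : 1 <= M.
  have : 1 <= (2 / l0) ^+ q by apply: exprn_ege1; lra.
  by rewrite /M; lra.
exists (M * (D + 1)).
  by rewrite -[leLHS]mulr1; apply: ler_pM => //; lra.
move=> b v v' Kv Kv'; have [h1 h2] := main b v v' Kv Kv'.
have rv := ratio_gt0 b Kv; have PM := PB_le (size b); have MD := mulr_ge0 (le_trans ler01 M1) D0.
split.
  apply: le_trans h1 _; rewrite ler_wpM2r ?(ltW rv)//; rewrite -/M in PM; lra.
apply: le_trans h2 _; rewrite ler_wpM2r ?(ltW rv)//.
have : D * PB (size b) <= D * M by rewrite ler_wpM2l.
lra.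
Qed.

End distortion.

(** Send each point to its box in a grid of mesh [r / d.+1%:R]: two points in one box are at
    distance at most [r], so the map is injective, and the number of boxes depends on [d] and [Q]
    only. The shift by [M] makes the coordinates nonnegative before truncation. *)
Lemma separated_card (R : realType) (d : nat) (Q : R) :
  exists N : nat, forall (T : finType) (A : {set T}) (p : T -> 'rV[R]_d) x (r : R),
    0 < r -> (forall t, t \in A -> enorm (p t - x) <= Q * r) ->
    (forall t t', t \in A -> t' \in A -> t != t' -> r < enorm (p t - p t')) ->
    (#|A| <= N)%N.
Proof.
pose M := (Num.truncn (`|Q| * d.+1%:R)).+1.
have QM : `|Q| * d.+1%:R < M%:R by rewrite /M truncnS_gt.
exists #|{ffun 'I_d -> 'I_(2 * M).+1}| => T A p x r r0 Hx Hsep.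
pose h := r / d.+1%:R; have h0 : 0 < h by rewrite divr_gt0.
pose u t (i : 'I_d) : R := (p t ord0 i - x ord0 i) / h + M%:R.
have ub t i : t \in A -> 0 <= u t i < (2 * M).+1%:R.
  move=> tA; have : `|(p t ord0 i - x ord0 i) / h| <= M%:R.
    rewrite normrM normfV (gtr0_norm h0) ler_pdivrMr//.
    have -> : p t ord0 i - x ord0 i = (p t - x) ord0 i by rewrite !mxE.
    apply: le_trans (enorm_coord _ _) _; apply: le_trans (Hx t tA) _.
    apply: le_trans (_ : `|Q| * d.+1%:R * h <= _).
      by rewrite -mulrA [d.+1%:R * _]mulrC /h divfK ?pnatr_eq0// ler_wpM2r ?(ltW r0)// ler_norm.
    by rewrite ler_wpM2r ?(ltW h0)// ltW.
  rewrite ler_norml /u => /andP[a b]; rewrite -natr1 natrM; apply/andP; split; lra.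
pose F t : {ffun 'I_d -> 'I_(2 * M).+1} := [ffun i => inord (Num.truncn (u t i))].
rewrite -(card_in_imset (f := F)); first exact: max_card.
move=> t t' tA t'A /ffunP FE; apply/eqP; apply/negPn/negP => tt'.
have := Hsep t t' tA t'A tt'; apply/negP; rewrite -leNgt.
apply: le_trans (_ : d%:R * h <= _); last first.
  by rewrite /h mulrCA ler_piMr ?(ltW r0)// ler_pdivrMr// mul1r ler_nat.
apply: enorm_le_coord => i.
have := FE i; rewrite !ffunE => /(congr1 val)/=.
have inE' z : z \in A -> (inord (Num.truncn (u z i)) : 'I_(2 * M).+1) = Num.truncn (u z i) :> nat.
  by move=> /(ub _ i)/andP[u0 u1]; rewrite inordK// -(ltr_nat R); apply: le_lt_trans u1; rewrite truncn_le.
rewrite !inE'// => E.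
have /andP[u0 _] := ub t i tA; have /andP[u0' _] := ub t' i t'A.
have /andP[a1 a2] := truncn_itv u0; have /andP[b1 b2] := truncn_itv u0'.
rewrite E in a1 a2.
have -> : (p t - p t') ord0 i = (u t i - u t' i) * h.
  by rewrite /u !mxE; field; rewrite gt_eqF.
rewrite normrM (gtr0_norm h0) ler_piMl ?(ltW h0)// ler_norml.
by rewrite -natr1 in a2 b2; apply/andP; split; lra.
Qed.

(* [r b] is the ratio of [comp_rev phi b] at a base point [v] of the open set
   [V].  Codings of [x] of a given length are prolonged inwards until all their
   ratios are comparable to a common [rho]; as images of [V] under the original
   words are disjoint and contain balls of radius comparable to [rho] centred
   close to [x], a packing argument bounds their number. *)
Section codings.
Context (R : realType) (d m : nat).
Variables (phi : 'I_m.+1 -> 'rV[R]_d -> 'rV[R]_d) (L V : set 'rV[R]_d).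
Variables (J : pred 'I_m.+1) (r : seq 'I_m.+1 -> R) (v : 'rV[R]_d).
Variables (l0 C c s k : R).
Hypothesis c01 : 0 <= c < 1.
Hypothesis l0_gt0 : 0 < l0.
Hypothesis s_gt0 : 0 < s.
Hypothesis k_gt0 : 0 < k.
Hypothesis r_ge : forall b, l0 ^+ size b <= r b.
Hypothesis r_le : forall b, r b <= 2 * c ^+ size b.
Hypothesis r_cons : forall i b, k * r b <= r (i :: b).
Hypothesis r_dist : forall b y, L y -> enorm (comp_rev phi b y - comp_rev phi b v) <= C * r b.
Hypothesis r_ball : forall b w, enorm (w - comp_rev phi b v) <= r b * s ->
  exists2 y, V y & comp_rev phi b y = w.
Hypothesis Vv : V v.
Hypothesis L_sub : forall x, L x -> exists2 i, J i & exists2 y, L y & phi i y = x.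
Hypothesis V_inv : forall i x, J i -> V x -> V (phi i x).
Hypothesis V_disj : forall i j x y, J i -> J j -> V x -> V y -> phi i x = phi j y -> i = j.
Hypothesis V_inj : forall i x y, V x -> V y -> phi i x = phi i y -> x = y.

Lemma comp_revV b x : all J b -> V x -> V (comp_rev phi b x).
Proof.
elim: b x => //= i b IH x /andP[Ji Jb] Vx; apply: IH => //; exact: V_inv.
Qed.

(** Disjointness of the images of [V] identifies the letter applied last, injectivity on [V] cancels
    it, and the rest follows by induction. *)
Lemma comp_rev_inj b b' x y : all J b -> all J b' -> size b = size b' -> V x -> V y ->
  comp_rev phi b x = comp_rev phi b' y -> b = b'.
Proof.
elim/last_ind: b b' => [|b i IH] b'; first by case: b'.
elim/last_ind: b' => [|b' i' _]; first by rewrite size_rcons.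
rewrite !size_rcons !all_rcons !comp_rev_rcons => /andP[Ji Jb] /andP[Ji' Jb'] [bb'] Vx Vy E.
have ii' : i = i' by apply: V_disj E => //; exact: comp_revV.
by subst i'; rewrite (IH b')//; apply: V_inj E; exact: comp_revV.
Qed.

(** Letters are added in front, where they act first, so the coded point stays [x]. Each of them
    multiplies the ratio by at least [k], so the ratio cannot jump over the range from [k * rho] to
    [rho]; it reaches it because long words have small ratios. *)
Lemma extend_coding (rho : R) b x : 0 < rho -> all J b -> k * rho <= r b ->
  (exists2 y, L y & comp_rev phi b y = x) ->
  exists a, [/\ all J a, exists2 y, L y & comp_rev phi (a ++ b) y = x,
    k * rho <= r (a ++ b) & r (a ++ b) <= rho].
Proof.
move=> rho0; have [N HN] := exists_expr_le c01 (divr_gt0 rho0 (ltr0n R 2)).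
have [n] := ubnP (N - size b).
elim: n b => // n IH b Nb Jb kb [y Ly by_].
have [rb|rb] := leP (r b) rho; first by exists [::]; split => //; exists y.
have bN : (size b < N)%N.
  rewrite ltnNge; apply/negP => /HN h; have := r_le b; lra.
have [i Ji [y' Ly' iy]] := L_sub Ly.
have [||||a [Ja Ha a1 a2]] := IH (i :: b).
- by rewrite /=; move: Nb bN; clear; lia.
- by rewrite /= Ji.
- by apply: le_trans (r_cons i b); rewrite ler_wpM2l ?ltW.
- by exists y' => //=; rewrite iy.
- exists (rcons a i); rewrite cat_rcons; split=> //.
  by rewrite all_rcons Ji.
Qed.

Lemma codings_le : exists N : nat, forall n x,
  (#|[pred b : n.-tuple 'I_m.+1 | all J b && `[< exists2 y, L y & comp_rev phi b y = x >]]| <= N)%N.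
Proof.
have [N HN] := separated_card d (C / (k * s)).
(* This makes [k * rho <= l0 ^+ n], a lower bound for the ratios of all words of length [n], so each
   of them can be prolonged to the common scale [rho]. *)
exists N => n x; pose rho := l0 ^+ n / Num.max 1 k.
have mk0 : 0 < Num.max 1 k by rewrite lt_max ltr01.
have rho0 : 0 < rho by rewrite divr_gt0 ?exprn_gt0.
pose A := [set b : n.-tuple 'I_m.+1 | all J b && `[< exists2 y, L y & comp_rev phi b y = x >]]%SET.
have : forall b : n.-tuple 'I_m.+1, exists a, b \in A ->
   [/\ all J a, exists2 y, L y & comp_rev phi (a ++ b) y = x,
    k * rho <= r (a ++ b) & r (a ++ b) <= rho].
  move=> b; have [|bA] := boolP (b \in A); last by exists [::].
  rewrite inE => /andP[Jb /asboolP bx].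
  have kb : k * rho <= r b.
    apply: le_trans (r_ge b); rewrite size_tuple /rho mulrA ler_pdivrMr// mulrC.
    by rewrite ler_wpM2l ?exprn_ge0 ?(ltW l0_gt0)// le_max lexx orbT.
  by have [a Ha] := extend_coding rho0 Jb kb bx; exists a.
move=> /choice[a Ha].
suff : (#|A| <= N)%N by rewrite /A cardsE.
apply: (HN _ A (fun b => comp_rev phi (a b ++ b) v) x (k * rho * s)).
- by rewrite mulr_gt0// mulr_gt0.
- move=> b /Ha[_ [y Ly <-] _ a2]; rewrite enormC.
  apply: le_trans (r_dist _ Ly) _.
  have C0 : 0 <= C.
    have := le_trans (enorm_ge0 _) (r_dist [::] Ly).
    by rewrite pmulr_lge0//; apply: lt_le_trans (r_ge [::]); rewrite expr0.
  have -> : C / (k * s) * (k * rho * s) = C * rho by field; rewrite !gt_eqF.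
  by rewrite ler_wpM2l.
(* If two centres were close, one would lie in the image of [V] under the other prolonged word. The
   prolongations may differ in length; they are moved into the points of [V], so that [comp_rev_inj]
   compares the original words only. *)
- move=> b b' bA b'A bb'; rewrite ltNge; apply/negP => H.
  have [Ja _ a1 _] := Ha b bA; have [Ja' _ _ _] := Ha b' b'A.
  have [] := @r_ball (a b ++ b) (comp_rev phi (a b' ++ b') v).
    by rewrite enormC; apply: le_trans H _; rewrite ler_wpM2r ?(ltW s_gt0).
  move=> y Vy; rewrite !comp_rev_cat => E.
  move: bA b'A; rewrite !inE => /andP[Jb _] /andP[Jb' _].
  case/eqP: bb'; apply: val_inj => /=.
  by apply: comp_rev_inj E => //; rewrite ?size_tuple//; exact: comp_revV.
Qed.

End codings.

Lemma uniform_contraction (R : realType) (d : nat) (I : finType) (U : set 'rV[R]_d)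
    (phi : I -> 'rV[R]_d -> 'rV[R]_d) : (forall i, contraction_on U (phi i)) ->
  exists2 c : R, 0 < c < 1 & forall i x y, U x -> U y ->
    enorm (phi i x - phi i y) <= c * enorm (x - y).
Proof.
move=> H; have /choice[f Hf] : forall i, exists c : R, c < 1 /\
    forall x y, U x -> U y -> enorm (phi i x - phi i y) <= c * enorm (x - y).
  by move=> i; have [c c1 Hc] := H i; exists c.
(* Starting the maximum at [2^-1] makes the common constant positive. *)
exists (\big[Num.max/2^-1]_i f i).
  apply/andP; split.
    by apply: lt_le_trans (bigmax_ge_id _ _ _ _); rewrite invr_gt0.
  apply/bigmax_ltP; split; first by rewrite invf_lt1// ltr1n.
  by move=> i _; case: (Hf i).
move=> i x y Ux Uy; have [_ Hi] := Hf i; apply: le_trans (Hi _ _ Ux Uy) _.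
by rewrite ler_wpM2r ?enorm_ge0// le_bigmax.
Qed.

Section neighborhood.
Context (R : realType) (d : nat).
Implicit Types (U L K : set 'rV[R]_d).

Definition thicken L (e : R) : set 'rV[R]_d := [set z | exists2 y, L y & enorm (z - y) <= e].

Lemma thicken_subset U L : open U -> compact L -> L `<=` U ->
  exists2 e : R, 0 < e & thicken L e `<=` U.
Proof.
move=> oU cL LU.
have : \forall e \near (0 : R)^'+, L `<=` [set y | forall z, enorm (z - y) <= e -> U z].
  apply: (proj1 (compact_near_coveringP L) cL _ (0 : R)^'+
     (fun e y => forall z, enorm (z - y) <= e -> U z)) => x Lx.
  have /nbhs_enorm[e0 e00 H] : nbhs x U by apply: open_nbhs_nbhs; split => //; exact: LU.
  have e02 : 0 < e0 / 2 by rewrite divr_gt0.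
  exists ([set z | enorm (z - x) <= e0 / 2], [set e | 0 < e <= e0 / 2]).
    split=> /=.
      by apply: (proj2 (nbhs_enorm _ _)); exists (e0 / 2).
    by near=> e; apply/andP; split => //; near: e; exact: nbhs_right_le.
  move=> [y e] /= [yx /andP[_ e_]] z zy; apply: H.
  by apply: le_trans (ler_enorm_dist _ y _) _; lra.
move=> H; have /filter_ex[e [e0 He]] : \forall e \near (0 : R)^'+,
    0 < e /\ L `<=` [set y | forall z, enorm (z - y) <= e -> U z].
  by apply: filterI => //; exact: nbhs_right_gt.
by exists e => // z [y /He] /[apply].
Unshelve. all: by end_near.
Qed.

Lemma compact_thicken L e : compact L -> compact (thicken L e).
Proof.
move=> cL.
have -> : thicken L e = (fun p : 'rV[R]_d * 'rV[R]_d => p.1 + p.2) @`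
    (L `*` [set y | enorm (y - 0) <= e]).
  apply/seteqP; split=> [z [y Ly zy]|_ [[y h] /= [Ly hh] <-]].
    by exists (y, z - y) => /=; [rewrite subr0|rewrite addrC subrK].
  by exists y => //; rewrite addrC addKr -[h]subr0.
apply: continuous_compact; last exact: compact_setX cL (@compact_eball R d 0 e).
by apply: continuous_subspaceT; exact: add_continuous.
Qed.

Lemma compact_diameter K : compact K ->
  exists D : R, forall x y, K x -> K y -> enorm (x - y) <= D.
Proof.
move=> /compact_bounded[M [_ HM]]; exists (d%:R * (2 * (M + 1))).
move=> x y Kx Ky; apply: le_trans (enorm_le_norm _) _; rewrite ler_wpM2l//.
apply: le_trans (ler_normB _ _) _; rewrite mulr_natl mulr2n.
by apply: lerD; apply: HM => //; rewrite ltrDl.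
Qed.

End neighborhood.

Lemma bounded_codings (R : realType) (d m : nat) (U L : set 'rV[R]_d)
    (phi : 'I_m.+1 -> 'rV[R]_d -> 'rV[R]_d) (J : pred 'I_m.+1) :
  (0 < d)%N -> open U -> (forall i, contraction_on U (phi i)) ->
  (forall i, conformal_on U (phi i)) ->
  (forall i x y, U x -> U y -> phi i x = phi i y -> x = y) ->
  L !=set0 -> compact L -> L `<=` U -> (forall i x, L x -> L (phi i x)) ->
  (forall x, L x -> exists2 i, J i & exists2 y, L y & phi i y = x) ->
  open_set_condition U phi [set i | J i] ->
  exists N : nat, forall n x,
    (#|[pred b : n.-tuple 'I_m.+1 | all J b &&
        `[< exists2 y, L y & comp_rev phi b y = x >]]| <= N)%N.
Proof.
move=> d0 oU ctr cnf inj [y0 Ly0] cL LU Linv Lsub [V [oV [v1 Vv1] VU Vinv Vdisj]].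
have [c c01 Hc] := uniform_contraction ctr.
have /andP[c0 c1] := c01.
have [de de0 KU] := thicken_subset oU cL LU.
pose K := thicken L de.
have cK : compact K by exact: compact_thicken.
have LK x : L x -> K x by move=> Lx; exists x => //; rewrite subrr enorm0 ltW.
have phiK i x : K x -> K (phi i x).
  move=> [y Ly xy]; exists (phi i y); first exact: Linv.
  have Ux : U x by apply: KU; exists y.
  apply: le_trans (Hc i x y Ux (LU _ Ly)) _.
  by rewrite -[leRHS]mul1r; apply: ler_pM; rewrite ?enorm_ge0 ?(ltW c0) ?(ltW c1).
have [e e0 He] := uniform_conformal d0 oU cnf cK KU.
have [D KD] := compact_diameter cK.
have [i0 Ji0 _] := Lsub _ Ly0.
(* The orbit of [v1] under a single representative stays in [V] and approaches the parallel orbit of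
   [y0] in [L], so it enters the thickening [K]. *)
have [v Kv Vv] : exists2 v, K v & V v.
  have D1 : 0 < enorm (v1 - y0) + 1 by rewrite ltr_wpDl ?enorm_ge0.
  have cc : 0 <= c < 1 by rewrite ltW.
  have [n /(_ n (leqnn n)) Hn] := exists_expr_le cc (divr_gt0 de0 D1).
  have main k : [/\ V (iter k (phi i0) v1), L (iter k (phi i0) y0) &
      enorm (iter k (phi i0) v1 - iter k (phi i0) y0) <= c ^+ k * enorm (v1 - y0)].
    elim: k => [|k [IH1 IH2 IH3]]; first by rewrite mul1r.
    split=> /=.
    - by apply: (Vinv i0 Ji0); exists (iter k (phi i0) v1).
    - exact: Linv.
    - apply: le_trans (Hc _ _ _ (VU _ IH1) (LU _ IH2)) _.
      by rewrite exprS -mulrA ler_wpM2l// ltW.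
  have [m1 m2 m3] := main n.
  exists (iter n (phi i0) v1) => //.
  exists (iter n (phi i0) y0) => //.
  apply: le_trans m3 _; apply: le_trans (_ : c ^+ n * (enorm (v1 - y0) + 1) <= _).
    by rewrite ler_wpM2l ?exprn_ge0 ?(ltW c0)// lerDl.
  by rewrite -ler_pdivlMr.
have /nbhs_enorm[sV sV0 HsV] : nbhs v V by exact: open_nbhs_nbhs.
pose th := c `^ e.
have th0 : 0 < th by exact: powR_gt0.
have th1 : th < 1.
  have <- : 1 `^ e = 1 :> R by rewrite powR1.
  by apply: gt0_ltr_powR => //; rewrite nnegrE ?(ltW c0).
(* The errors form a geometric series of ratio [th] with sum at most e^-1 * s^e / (1 - th); [q] is
   the value of s^e for which this equals 1 / 2. The other bounds on [s] keep the approximations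
   valid and the ball about [v] inside [V]. *)
pose q := e * (1 - th) / 2.
have q0 : 0 < q by rewrite divr_gt0// mulr_gt0// subr_gt0.
pose s := Num.min (Num.min e sV) (q `^ e^-1).
have s0 : 0 < s by rewrite !lt_min e0 sV0 powR_gt0.
have [se ssV sq] : [/\ s <= e, s <= sV & s <= q `^ e^-1].
  by rewrite /s !ge_min !lexx ?orbT.
pose err k := e^-1 * (s * c ^+ k) `^ e.
have err_ge0 k : 0 <= err k by rewrite mulr_ge0 ?powR_ge0// invr_ge0 ltW.
have err_sum n : \sum_(k < n) err k <= 1 / 2.
  have se' : s `^ e <= q.
    have -> : q = (q `^ e^-1) `^ e by rewrite -powRrM mulVf ?powRr1 ?gt_eqF// ltW.
    by apply: ler_powR_base => //; exact: ltW.
  have -> : \sum_(k < n) err k = e^-1 * s `^ e * \sum_(k < n) th ^+ k.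
    rewrite mulr_sumr; apply: eq_bigr => k _.
    rewrite /err powRM ?exprn_ge0 ?(ltW s0) ?(ltW c0)// mulrA; congr (_ * _).
    by rewrite -powR_mulrn ?(ltW c0)// -powRrM mulrC powRrM powR_mulrn// ltW.
  have S1 : (1 - th) * \sum_(k < n) th ^+ k <= 1.
    have := subrX1 th n; have : 0 <= th ^+ n by rewrite exprn_ge0 ?ltW.
    by move=> *; lra.
  have S0 : 0 <= \sum_(k < n) th ^+ k by apply: sumr_ge0 => k _; rewrite exprn_ge0 ?ltW.
  apply: le_trans (_ : e^-1 * q * \sum_(k < n) th ^+ k <= _).
    by rewrite ler_wpM2r// ler_wpM2l ?invr_ge0 ?(ltW e0).
  have -> : e^-1 * q = (1 - th) / 2 by rewrite /q; field; rewrite gt_eqF.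
  lra.
pose l0 := Num.min e 1.
have l01 : 0 < l0 <= 1 by rewrite lt_min e0 ltr01 ge_min lexx orbT.
have [lam Hlam] : exists lam : 'I_m.+1 -> 'rV[R]_d -> R, forall i z, K z ->
    e <= lam i z /\ 
    exists2 A : {linear 'rV[R]_d -> 'rV[R]_d}, forall v, enorm (A v) = lam i z * enorm v &
    forall s, s <= e -> forall y y', enorm (y - z) <= s -> enorm (y' - z) <= s ->
      enorm (phi i y - phi i y' - A (y - y')) <= e^-1 * s `^ e * lam i z * enorm (y - y').
  have /choice[f Hf] : forall p : 'I_m.+1 * 'rV[R]_d, exists l : R, K p.2 -> e <= l /\
      exists2 A : {linear 'rV[R]_d -> 'rV[R]_d}, forall v, enorm (A v) = l * enorm v &
      forall s, s <= e -> forall y y', enorm (y - p.2) <= s -> enorm (y' - p.2) <= s ->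
      enorm (phi p.1 y - phi p.1 y' - A (y - y')) <= e^-1 * s `^ e * l * enorm (y - y').
    move=> [i z]; have [Kz|nKz] := pselect (K z); last by exists 0.
    by have [_ [l el HA]] := He i z Kz; exists l.
  by exists (fun i z => f (i, z)) => i z Kz; exact: (Hf (i, z)).
have lam_ge i z : K z -> l0 <= lam i z.
  by move=> /(Hlam i)[h _]; apply: le_trans h; rewrite ge_min lexx.
have phiC i z y : K z -> K y \/ enorm (y - z) <= s ->
    enorm (phi i y - phi i z) <= c * enorm (y - z).
  move=> Kz [Ky|yz]; apply: Hc; try exact: KU.
  by have [+ _] := He i z Kz; apply; exact: le_trans yz se.
have step i z k : K z ->
    exists2 A : {linear 'rV[R]_d -> 'rV[R]_d}, forall v, enorm (A v) = lam i z * enorm v &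
    forall y y', enorm (y - z) <= s * c ^+ k -> enorm (y' - z) <= s * c ^+ k ->
    enorm (phi i y - phi i y' - A (y - y')) <= err k * lam i z * enorm (y - y').
  move=> /(Hlam i)[_ [A Al HA]]; exists A => // y y'; apply: HA.
  apply: le_trans se; by rewrite ler_piMr ?(ltW s0)// exprn_ile1// ltW.
have [C C1 dist] := bounded_distortion d0 phiK c01 s0 l01 lam_ge phiC KD err_ge0 err_sum step.
have C0 : 0 < C by exact: lt_le_trans C1.
have /andP[l00 l0le] := l01.
have rgt b : 0 < orbit_ratio phi lam b v by exact: (ratio_gt0 phiK l01 lam_ge).
(* The radius is halved since the factor [1 - E] of [comp_rev_ball] is at least 1 / 2. A letter put
   in front contributes at least [l0] and moves the base point from [v] to its image, at the price
   of the distortion constant; hence [l0 / C]. *)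
apply: (@codings_le R d m phi L V J (fun b => orbit_ratio phi lam b v) v l0 C c (s / 2) (l0 / C)) => //.
- by rewrite (ltW c0).
- by rewrite divr_gt0.
- by rewrite divr_gt0.
- by move=> b; exact: (ratio_ge phiK l01 lam_ge).
- by move=> b; exact: (ratio_le d0 phiK c01 s0 l01 lam_ge phiC err_ge0 err_sum step).
- move=> i b /=; have [h _] := dist b _ _ (phiK i _ Kv) Kv.
  have Kv' := phiK i _ Kv.
  rewrite mulrAC -mulrA; apply: ler_pM; rewrite ?(ltW l00) ?divr_ge0 ?(ltW C0) ?(ltW (rgt b))//.
    exact: lam_ge.
  by rewrite ler_pdivrMr// mulrC.
- by move=> b y /LK Ky; case: (dist b _ _ Kv Ky).
- move=> b w wb; have [|y yv <-] := comp_rev_ball d0 phiK c01 s0 l01 lam_ge phiC err_ge0 err_sum step (b := b) (w := w) Kv.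
    apply: le_trans wb _; rewrite mulrA mulrAC ler_wpM2r ?(ltW s0)//.
    have := err_sum (size b); have := rgt b => r0 h.
    have : 0 <= (1 / 2 - \sum_(k < size b) err k) * orbit_ratio phi lam b v.
      by rewrite mulr_ge0 ?subr_ge0 ?(ltW r0).
    lra.
  exists y => //; apply: HsV; exact: le_trans yv ssV.
- by move=> i x Ji Vx; apply: (Vinv i Ji); exists x.
- move=> i j x y Ji Jj Vx Vy E; apply: contrapT => ij.
  have : (phi i @` V `&` phi j @` V) (phi i x) by split; [exists x|exists y].
  by rewrite Vdisj.
- by move=> i x y Vx Vy; apply: inj; exact: VU.
Qed.

Lemma ln_prod (R : realType) (I : Type) (s : seq I) (f : I -> R) :
  (forall i, 0 < f i) -> ln (\prod_(i <- s) f i) = \sum_(i <- s) ln (f i).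
Proof.
move=> f0; elim: s => [|i s IH]; first by rewrite !big_nil ln1.
by rewrite !big_cons lnM ?posrE ?prodr_gt0// IH.
Qed.

(** * Events and entropy bounds on a domain of full measure *)

(* The dynamics is meaningful on [D] only, so events are the sets with
   measurable trace on [D]. *)
Section events.
Context (R : realType) (dT : measure_display) (T : measurableType dT).
Variables (mu : probability T R) (D : set T).
Hypothesis mD : measurable D.
Hypothesis muD : mu D = 1%E.

Definition event (A : set T) : Prop := measurable (D `&` A).
Definition Pr (A : set T) : R := fine (mu (D `&` A)).

Lemma measurable_event A : measurable A -> event A.
Proof. by move=> mA; exact: measurableI. Qed.

Lemma eventT : event setT.
Proof. exact: measurable_event. Qed.

Lemma event0 : event set0.
Proof. exact: measurable_event. Qed.

Lemma eventI A B : event A -> event B -> event (A `&` B).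
Proof. by move=> mA mB; rewrite /event -[D]setIid setIACA; exact: measurableI. Qed.

Lemma eventU A B : event A -> event B -> event (A `|` B).
Proof. by move=> mA mB; rewrite /event setIUr; exact: measurableU. Qed.

Lemma eventC A : event A -> event (~` A).
Proof.
move=> mA; rewrite /event (_ : D `&` _ = D `\` (D `&` A)); first exact: measurableD.
by apply/seteqP; split=> x /= [Dx h]; split => //; [case|move=> Ax; exact: h].
Qed.

Lemma event_ext A B : (forall x, D x -> A x <-> B x) -> event A -> event B.
Proof.
move=> AB; rewrite /event (_ : D `&` A = D `&` B)//.
by apply/seteqP; split=> x [Dx h]; split => //; apply/(AB x Dx).
Qed.

Lemma Pr_ext A B : (forall x, D x -> A x <-> B x) -> Pr A = Pr B.
Proof.
move=> AB; rewrite /Pr (_ : D `&` A = D `&` B)//.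
by apply/seteqP; split=> x [Dx h]; split => //; apply/(AB x Dx).
Qed.

Lemma event_bigcup (F : nat -> set T) : (forall n, event (F n)) -> event (\bigcup_n F n).
Proof. by move=> mF; rewrite /event setI_bigcupr; exact: bigcupT_measurable. Qed.

Lemma Pr_fin A : event A -> mu (D `&` A) \is a fin_num.
Proof. by move=> mA; exact: fin_num_measure. Qed.

Lemma PrE A : event A -> mu (D `&` A) = (Pr A)%:E.
Proof. by move=> mA; rewrite fineK// Pr_fin. Qed.

Lemma Pr_ge0 A : 0 <= Pr A. Proof. by rewrite fine_ge0. Qed.

Lemma PrT : Pr setT = 1.
Proof. by rewrite /Pr setIT muD. Qed.

Lemma Pr0 : Pr set0 = 0.
Proof. by rewrite /Pr setI0 measure0. Qed.

Lemma le_Pr A B : event A -> event B -> (forall x, D x -> A x -> B x) -> Pr A <= Pr B.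
Proof.
move=> mA mB AB; rewrite -lee_fin -!PrE//; apply: le_measure; rewrite ?inE//.
by move=> x [Dx Ax]; split => //; exact: AB.
Qed.

Lemma Pr_le1 A : event A -> Pr A <= 1.
Proof. by move=> mA; rewrite -PrT; apply: le_Pr => //; exact: eventT. Qed.

Lemma PrU A B : event A -> event B -> (forall x, D x -> A x -> ~ B x) ->
  Pr (A `|` B) = Pr A + Pr B.
Proof.
move=> mA mB AB; apply: EFin_inj; rewrite EFinD -!PrE//; last exact: eventU.
rewrite setIUr measureU//; apply/seteqP; split=> // x [[Dx Ax] [_ Bx]].
exact: (AB x Dx Ax).
Qed.

Lemma Pr_setD A B : event A -> event B -> Pr A = Pr (A `&` B) + Pr (A `&` ~` B).
Proof.
move=> mA mB; rewrite -PrU.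
- by apply: Pr_ext => x _; split=> [Ax|[[]|[]]//]; have [Bx|nBx] := pselect (B x); [left|right].
- exact: eventI.
- by apply: eventI => //; exact: eventC.
- by move=> x _ [_ Bx] [].
Qed.

Lemma Pr_leU A B : event A -> event B -> Pr (A `|` B) <= Pr A + Pr B.
Proof.
move=> mA mB; have mB' : event (B `&` ~` A) by apply: eventI => //; exact: eventC.
apply: le_trans (_ : Pr (A `|` (B `&` ~` A)) <= _).
  apply: le_Pr; [exact: eventU|exact: eventU|].
  by move=> x _ [Ax|Bx]; [left|have [Ax|nAx] := pselect (A x); [left|right]].
rewrite PrU//; last by move=> x _ Ax [].
by rewrite lerD2l; apply: le_Pr => // x _ [].
Qed.

Section finite_variable.
Context (J : finType) (X : T -> J).
Hypothesis mX : forall j, event (X @^-1` [set j]).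

Lemma event_mem (s : seq J) : event [set z | X z \in s].
Proof.
elim: s => [|j s IH]; first by apply: (event_ext _ event0).
apply: (event_ext _ (eventU (mX j) IH)) => z _ /=; rewrite in_cons; split.
  by case=> [->|->]; rewrite ?eqxx ?orbT.
by case/orP => [/eqP|]; [left|right].
Qed.

Lemma Pr_mem (s : seq J) : uniq s ->
  Pr [set z | X z \in s] = \sum_(j <- s) Pr (X @^-1` [set j]).
Proof.
elim: s => [_|j s IH /= /andP[js us]].
  by rewrite big_nil -Pr0; apply: Pr_ext.
rewrite big_cons -IH// -PrU//; last 2 first.
- exact: event_mem.
- by move=> z _ /= -> ; apply/negP.
apply: Pr_ext => z _ /=; rewrite in_cons; split.
  by case/orP => [/eqP|]; [left|right].
by case=> [->|->]; rewrite ?eqxx ?orbT.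
Qed.

Lemma event_pred (P : pred J) : event [set z | P (X z)].
Proof.
by apply: (event_ext _ (event_mem (enum P))) => z _ /=; rewrite mem_enum.
Qed.

Lemma Pr_pred (P : pred J) : Pr [set z | P (X z)] = \sum_(j | P j) Pr (X @^-1` [set j]).
Proof.
rewrite -big_enum -Pr_mem ?enum_uniq//.
by apply: Pr_ext => z _ /=; rewrite mem_enum.
Qed.

Lemma sum_Pr : \sum_j Pr (X @^-1` [set j]) = 1.
Proof. by rewrite -(Pr_pred xpredT) -PrT; apply: Pr_ext. Qed.

Definition expect (g : J -> R) : R := \sum_j Pr (X @^-1` [set j]) * g j.

Lemma expectD g h : expect (fun j => g j + h j) = expect g + expect h.
Proof. by rewrite -big_split; apply: eq_bigr => j _ /=; rewrite mulrDr. Qed.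

Lemma expect_sum (I : Type) (s : seq I) (g : I -> J -> R) :
  expect (fun j => \sum_(i <- s) g i j) = \sum_(i <- s) expect (g i).
Proof.
by rewrite exchange_big/=; apply: eq_bigr => j _; rewrite mulr_sumr.
Qed.

Lemma le_expect g h : (forall j, g j <= h j) -> expect g <= expect h.
Proof. by move=> gh; apply: ler_sum => j _; rewrite ler_wpM2l ?Pr_ge0. Qed.

Lemma expect_comp (J' : finType) (f : J -> J') (g : J' -> R) :
  expect (g \o f) = \sum_j Pr [set z | f (X z) = j] * g j.
Proof.
rewrite /expect (partition_big f xpredT)//=; apply: eq_bigr => j _.
rewrite (eq_bigr (fun i => Pr (X @^-1` [set i]) * g j)); last by move=> i /eqP <-.
rewrite -mulr_suml -Pr_pred; congr (_ * _).
by apply: Pr_ext => z _ /=; split => [/eqP|->].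
Qed.

End finite_variable.

Section finite_families.
Variables (I : finType) (A : I -> set T).
Hypothesis mA : forall i, event (A i).

Lemma event_forall : event [set z | forall i, A i z].
Proof.
have H (s : seq I) : event [set z | forall i, i \in s -> A i z].
  elim: s => [|j s IH]; first by apply: (event_ext _ eventT).
  apply: (event_ext _ (eventI (mA j) IH)) => z _ /=; split.
    by move=> [Aj As] i; rewrite in_cons => /orP[/eqP ->//|/As].
  by move=> h; split=> [|i si]; apply: h; rewrite in_cons ?eqxx// si orbT.
apply: (event_ext _ (H (enum I))) => z _ /=.
by split=> h i //; apply: h; rewrite mem_enum.
Qed.

Lemma event_exists : event [set z | exists i, A i z].
Proof.
have H (s : seq I) : event [set z | exists2 i, i \in s & A i z].
  elim: s => [|j s IH]; first by apply: (event_ext _ event0) => z _ /=; split=> [//|[]].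
  apply: (event_ext _ (eventU (mA j) IH)) => z _ /=; split.
    by move=> [Aj|[i si Ai]]; [exists j|exists i] => //; rewrite in_cons ?eqxx// si orbT.
  by move=> [i]; rewrite in_cons => /orP[/eqP ->|si] Ai; [left|right; exists i].
apply: (event_ext _ (H (enum I))) => z _ /=.
by split=> [[i _ Ai]|[i Ai]]; exists i => //; rewrite mem_enum.
Qed.

Lemma Pr_exists_le : Pr [set z | exists i, A i z] <= \sum_i Pr (A i).
Proof.
have H (s : seq I) : event [set z | exists2 i, i \in s & A i z] /\
    Pr [set z | exists2 i, i \in s & A i z] <= \sum_(i <- s) Pr (A i).
  elim: s => [|j s [IH1 IH2]].
    have E z : D z -> set0 z <-> [set z | exists2 i, i \in [::] & A i z] z.
      by move=> _ /=; split=> [//|[]].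
    by split; [exact: (event_ext E event0)|rewrite big_nil -(Pr_ext E) Pr0].
  have E z : D z -> (A j `|` [set z | exists2 i, i \in s & A i z]) z <->
      [set z | exists2 i, i \in j :: s & A i z] z.
    move=> _ /=; split.
      by move=> [Aj|[i si Ai]]; [exists j|exists i] => //; rewrite in_cons ?eqxx// si orbT.
    by move=> [i]; rewrite in_cons => /orP[/eqP ->|si] Ai; [left|right; exists i].
  split; first by apply: (event_ext E); exact: eventU.
  rewrite big_cons -(Pr_ext E); apply: le_trans (Pr_leU _ _) _ => //.
  by rewrite lerD2l.
rewrite -big_enum; apply: le_trans (H (enum I)).2.
rewrite le_eqVlt; apply/orP; left; apply/eqP; apply: Pr_ext => z _ /=.
by split=> [[i Ai]|[i _ Ai]]; exists i => //; rewrite mem_enum.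
Qed.

End finite_families.

Lemma event_pair (J1 J2 : finType) (X : T -> J1) (Y : T -> J2) :
  (forall j, event (X @^-1` [set j])) -> (forall j, event (Y @^-1` [set j])) ->
  forall j, event ((fun z => (X z, Y z)) @^-1` [set j]).
Proof.
move=> mX mY [a b]; apply: (event_ext _ (eventI (mX a) (mY b))) => z _ /=.
by split=> [[-> ->]|[-> ->]].
Qed.

Lemma event_finset (I : finType) (Q : I -> T -> bool) :
  (forall i, event [set z | Q i z]) ->
  forall S : {set I}, event ((fun z => [set i | Q i z]%SET) @^-1` [set S]).
Proof.
move=> mQ S; have H i : event [set z | Q i z = (i \in S)].
  have [iS|iS] := boolP (i \in S); first exact: mQ.
  apply: (event_ext _ (eventC (mQ i))) => z _ /=.
  by split=> [/negP/negbTE//|->].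
apply: (event_ext _ (event_forall H)) => z _ /=; split=> [h|<- i].
  by apply/setP => i; rewrite inE h.
by rewrite inE.
Qed.

Lemma event_tuple (n : nat) (J : finType) (X : 'I_n -> T -> J) :
  (forall i j, event (X i @^-1` [set j])) ->
  forall t : n.-tuple J, event ((fun z => [tuple X i z | i < n]) @^-1` [set t]).
Proof.
move=> mX t; apply: (event_ext _ (event_forall (fun i => mX i (tnth t i)))) => z _ /=.
split=> [h|<- i /=]; last by rewrite tnth_mktuple.
by apply: eq_from_tnth => i; rewrite tnth_mktuple h.
Qed.

Definition bigcup_tail (G : nat -> set T) n : set T :=
  [set z | exists k, G k z] `&` ~` [set z | exists2 k, (k < n)%N & G k z].

Lemma event_exists_nat (G : nat -> set T) : (forall n, event (G n)) ->
  event [set z | exists k, G k z].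
Proof.
move=> mG; apply: (event_ext _ (event_bigcup mG)) => z _ /=.
by split=> [[k _ Gk]|[k Gk]]; exists k.
Qed.

Lemma event_exists_lt (G : nat -> set T) n : (forall n, event (G n)) ->
  event [set z | exists2 k, (k < n)%N & G k z].
Proof.
move=> mG; apply: (event_ext _ (event_exists (fun k : 'I_n => mG k))) => z _ /=.
by split=> [[k Gk]|[k kn Gk]]; [exists k|exists (Ordinal kn)].
Qed.

Lemma event_bigcup_tail (G : nat -> set T) n : (forall n, event (G n)) ->
  event (bigcup_tail G n).
Proof.
move=> mG; apply: eventI; first exact: event_exists_nat.
by apply: eventC; exact: event_exists_lt.
Qed.

(** Continuity of the measure along the partial unions; this allows a countable union to be replaced
    by a finite one up to small probability. *)
Lemma Pr_bigcup_tail (G : nat -> set T) (e : R) : (forall n, event (G n)) -> 0 < e ->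
  exists n, Pr (bigcup_tail G n) <= e.
Proof.
move=> mG e0; pose H n := [set z | exists2 k, (k < n)%N & G k z].
have mH n : event (H n) by exact: event_exists_lt.
have mU : event [set z | exists k, G k z] by exact: event_exists_nat.
have UH : \bigcup_n (D `&` H n) = D `&` [set z | exists k, G k z].
  apply/seteqP; split=> z.
    by move=> [n _ [Dz [k _ Gk]]]; split => //; exists k.
  by move=> [Dz [k Gk]]; exists k.+1 => //; split => //; exists k.
have cvgH : mu \o (fun n => D `&` H n) @ \oo --> mu (\bigcup_n (D `&` H n)).
  apply: nondecreasing_cvg_mu => //.
    by rewrite UH; exact: mU.
  move=> a b ab; apply/subsetPset => z [Dz [k ka Gk]]; split => //.
  by exists k => //; exact: leq_trans ka ab.
rewrite UH (PrE mU) in cvgH.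
have /fine_cvgP[_ /cvgrPdist_le/(_ e e0)[n _ /(_ n (leqnn n)) Hn]] := cvgH.
exists n; have := Pr_setD mU (mH n).
rewrite (Pr_ext (A := [set z | exists k, G k z] `&` H n) (B := H n)); last first.
  by move=> z _; split=> [[]//|[k kn Gk]]; split; [exists k|exists k].
move: Hn; rewrite /= -/(Pr (H n)) ler_norml => /andP[_ Hn] E.
rewrite -/(bigcup_tail G n) in E.
by move: Hn; rewrite E addrAC subrr add0r.
Qed.

Section expectation_integral.
Context (J : finType) (X : T -> J) (h : J -> R).
Hypothesis mX : forall j, event (X @^-1` [set j]).
Hypothesis h0 : forall j, 0 <= h j.

Lemma Rintegral_expect : Rintegral mu D (h \o X) = expect X h.
Proof.
rewrite /Rintegral.
(* The indicators are those of traces on [D], the sets that are known to be measurable. *)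
pose f j x := ((h j)%:E * (\1_(D `&` X @^-1` [set j]) x)%:E)%E.
have -> : (\int[mu]_(x in D) ((h \o X) x)%:E =
    \int[mu]_(x in D) (\sum_(j <- enum J) f j x))%E.
  apply: eq_integral => x /set_mem Dx.
  rewrite big_enum (bigD1 (X x))//= big1 ?adde0.
    by rewrite /f indicE mem_set// mule1.
  by move=> j jX; rewrite /f indicE memNset ?mule0// => -[_ /= E]; rewrite E eqxx in jX.
have mI j : measurable_fun D (EFin \o (\1_(D `&` X @^-1` [set j]) : T -> R)).
  by apply/measurable_EFinP; apply: measurable_indic; exact: mX.
rewrite ge0_integral_sum//; last 2 first.
- by move=> j; exact: (measurable_funeM (h j)%:E (mI j)).

- by move=> j x Dx; rewrite mule_ge0// lee_fin.
have I j : (\int[mu]_(x in D) f j x = (h j * Pr (X @^-1` [set j]))%:E)%E.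
  have -> : (\int[mu]_(x in D) f j x =
      (h j)%:E * \int[mu]_(x in D) (\1_(D `&` X @^-1` [set j]) x)%:E)%E.
    by apply: ge0_integralZl_EFin; [exact: mD|move=> x _; rewrite lee_fin|exact: mI|exact: h0].
  rewrite integral_indic//; last exact: mX.
  rewrite setIAC setIid EFinM; congr (_ * _)%E; exact: PrE.
rewrite (eq_bigr _ (fun j _ => I j)) big_enum sumEFin/=.
by apply: eq_bigr => j _; exact: mulrC.
Qed.

End expectation_integral.

Section dynamics.
Variable F : T -> T.
Hypothesis mF : measurable_fun D F.
Hypothesis FD : forall x, D x -> D (F x).
Hypothesis Finv : forall A, measurable A -> mu (D `&` F @^-1` A) = mu A.

Lemma event_preimage A : event A -> event (F @^-1` A).
Proof.
move=> mA; apply: (event_ext _ (mF mD mA)) => x Dx; split=> [[]//|Ax].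
by split => //; exact: FD.
Qed.

(** Invariance is applied to the trace of [A] on [D], which is measurable even where [A] is not;
    [FD] discharges the extra membership in [D]. *)
Lemma Pr_preimage A : event A -> Pr (F @^-1` A) = Pr A.
Proof.
move=> mA; have h := Finv mA; rewrite [RHS]/Pr -h /Pr; congr (fine (mu _)).
apply/seteqP; split=> x [Dx Ax]; split => //; first by split => //; exact: FD.
by have [] := Ax.
Qed.

Lemma event_iter k A : event A -> event [set z | A (iter k F z)].
Proof.
elim: k A => // k IH A mA.
by have := IH _ (event_preimage mA).
Qed.

Lemma Pr_iter k A : event A -> Pr [set z | A (iter k F z)] = Pr A.
Proof.
elim: k A => // k IH A mA.
by rewrite -[RHS](Pr_preimage mA) -(IH _ (event_preimage mA)).
Qed.

End dynamics.
End events.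

(** * Measurability of the lift *)

Section lift_measurable.
Context (R : realType) (m d : nat).
Variables (phi : 'I_m.+1 -> 'rV[R]_d -> 'rV[R]_d) (U L : set 'rV[R]_d).
Hypothesis oU : open U.
Hypothesis phi_cont : forall i x, U x -> {for x, continuous (phi i)}.
Hypothesis cL : compact L.
Hypothesis LU : L `<=` U.

Local Notation T := (lift_space R m d).

Lemma measurable_open_borel (A : set 'rV[R]_d) : open A -> measurable (A : set (borel_space R d)).
Proof. by move=> oA; exact: sub_sigma_algebra. Qed.

Lemma measurable_closed_borel (A : set 'rV[R]_d) : closed A -> measurable (A : set (borel_space R d)).
Proof.
move=> cA; rewrite -[A]setCK; apply: measurableC; apply: measurable_open_borel.
exact: closed_openC.
Qed.

Lemma closed_limit_set : closed L.
Proof. by apply: compact_closed => //; exact: norm_hausdorff. Qed.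

Lemma measurable_point (A : set (borel_space R d)) : measurable A ->
  measurable [set z : T | A z.2].
Proof.
by move=> mA; have := @measurable_snd _ _ (symbol_space m) (borel_space R d) measurableT A mA; rewrite setTI.
Qed.

Lemma measurable_symbols (A : set (symbol_space m)) : measurable A ->
  measurable [set z : T | A z.1].
Proof.
by move=> mA; have := @measurable_fst _ _ (symbol_space m) (borel_space R d) measurableT A mA; rewrite setTI.
Qed.

Lemma measurable_cylinder n i : measurable ([set w | w n = i] : set (symbol_space m)).
Proof. by apply: sub_sigma_algebra; exists n, i. Qed.

Lemma measurable_letter n i : measurable [set z : T | z.1 n = i].
Proof. exact: (measurable_symbols (measurable_cylinder n i)). Qed.

Lemma measurable_lift_domain : measurable (@lift_domain R m d L).
Proof.
rewrite /lift_domain (_ : _ `*` _ = [set z : T | L z.2]); last first.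
  by apply/seteqP; split=> [z []|z Lz].
by apply: measurable_point; apply: measurable_closed_borel; exact: closed_limit_set.
Qed.

Lemma measurable_shift : measurable_fun setT
  ((fun w n => w n.+1) : symbol_space m -> symbol_space m).
Proof.
apply: (@measurability _ _ (symbol_space m) (symbol_space m) setT _ (@cylinders m)) => //.
by move=> _ [_ [n [i ->]] <-]; rewrite setTI; exact: (measurable_cylinder n.+1 i).
Qed.

Lemma measurable_lift_map : measurable_fun (@lift_domain R m d L) (lift_map phi).
Proof.
have mD := measurable_lift_domain.
apply: (@measurability _ _ T T _ _ (preimage_set_system setT (@fst (symbol_space m) (borel_space R d)) measurable
   `|` preimage_set_system setT (@snd (symbol_space m) (borel_space R d)) measurable)) => //.
move=> _ [_ [[B mB <-]|[B mB <-]] <-]; rewrite setTI.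
  apply: measurableI => //.
  have := measurable_shift measurableT mB; rewrite setTI => /measurable_symbols.
  by [].
have : measurable_fun (@lift_domain R m d L) (fun z : T => (phi (z.1 0%N) z.2 : borel_space R d)).
  apply: (@measurability _ _ T (borel_space R d) _ _ [set A : set 'rV[R]_d | open A]) => //.
  move=> _ [A oA <-].
  (* Continuity is available on [U] only. Splitting by the first letter leaves sets in which [U]
     intersected with the preimage of [A] is open. *)
  rewrite (_ : _ `&` _ = \bigcup_(i in [set: 'I_m.+1]) ([set z : T | z.1 0%N = i] `&`
     [set z : T | (L `&` (U `&` phi i @^-1` A)) z.2])); last first.
    apply/seteqP; split=> [z [[_ Lz] Az]|z [i _ [/= zi [Lz [Uz Az]]]]].
      by exists (z.1 0%N) => //; split => //=; split => //; split => //; exact: LU.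
    by split => //=; rewrite zi.
  apply: fin_bigcup_measurable => // i _; apply: measurableI; first exact: measurable_letter.
  apply: measurable_point; apply: measurableI.
    by apply: measurable_closed_borel; exact: closed_limit_set.
  apply: measurable_open_borel.
  rewrite openE => x [Ux Ax]; apply: filterI; first exact: open_nbhs_nbhs.
  by apply: phi_cont => //; exact: open_nbhs_nbhs.
by move=> h; exact: h.
Qed.

End lift_measurable.

Lemma card_blocks (J : finType) (r : J -> J) (n : nat) (w : 'I_n -> J) :
  #|[pred t : n.-tuple J | [forall k, r (tnth t k) == r (w k)]]| =
  (\prod_(k < n) #|[pred j | r j == r (w k)]|)%N.
Proof.
pose F k := [pred j | r j == r (w k)].
transitivity #|family F|; last by rewrite card_family foldrE big_map big_enum.
pose h (f : {ffun 'I_n -> J}) := [tuple f k | k < n].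
have hI : injective h.
  move=> f g /(congr1 (fun t => tnth t)) E; apply/ffunP => k.
  by have := congr1 (fun u => u k) E; rewrite /= !tnth_mktuple.
rewrite -(fintype.card_image hI); apply: eq_card => t; rewrite inE; apply/idP/fintype.imageP.
  move=> /forallP tw; exists [ffun k => tnth t k].
    by apply/familyP => k; rewrite ffunE inE.
  by apply: eq_from_tnth => k; rewrite tnth_mktuple ffunE.
by move=> [f /familyP fF ->]; apply/forallP => k; rewrite tnth_mktuple; exact: fF.
Qed.

(** * The overlap rate of an invariant measure *)

Section overlap.
Context (R : realType) (m d : nat).
Variables (phi : 'I_m.+1 -> 'rV[R]_d -> 'rV[R]_d) (U L : set 'rV[R]_d).
Variable mu : probability (lift_space R m d) R.
Hypothesis oU : open U.
Hypothesis phi_cont : forall i x, U x -> {for x, continuous (phi i)}.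
Hypothesis phi_inj : forall i x y, U x -> U y -> phi i x = phi i y -> x = y.
Hypothesis cL : compact L.
Hypothesis LU : L `<=` U.
Hypothesis Linv : forall i x, L x -> L (phi i x).
Hypothesis Lsurj : forall x, L x -> exists i, exists2 y, L y & phi i y = x.
Variable rep : 'I_m.+1 -> 'I_m.+1.
Hypothesis rep_idem : forall i, rep (rep i) = rep i.
Hypothesis phi_rep : forall i x, U x -> phi (rep i) x = phi i x.
Hypothesis mu_inv : lift_invariant phi L mu.

Local Notation T := (lift_space R m d).
Local Notation D := (@lift_domain R m d L).
Local Notation F := (@lift_map R m d phi).
Local Notation Prob := (Pr mu D).
Local Notation ev := (@event _ _ D).

Let J := [pred i | rep i == i].

Definition codes n x := [set b : n.-tuple 'I_m.+1 | all J b &&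
  `[< exists2 y, L y & comp_rev phi b y = x >]]%SET.

Variable N : nat.
Hypothesis codes_le : forall n x, (#|codes n x| <= N)%N.

Let mD : measurable D. Proof. exact: measurable_lift_domain. Qed.
Let muD : mu D = 1%E. Proof. by case: mu_inv. Qed.
Let mF : measurable_fun D F. Proof. exact: measurable_lift_map LU. Qed.
Let FD z : D z -> D (F z). Proof. by case: z => w x [_ Lx]; split => //; exact: Linv. Qed.
Let Finv A : measurable A -> mu (D `&` F @^-1` A) = mu A. Proof. by case: mu_inv => _; apply. Qed.

Lemma comp_revL b x : L x -> L (comp_rev phi b x).
Proof. by elim: b x => //= i b IH x Lx; apply: IH; exact: Linv. Qed.

Lemma iter_lift_map n z : iter n F z =
  ((fun k => z.1 (n + k)%N), comp_rev phi (mkseq z.1 n) z.2).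
Proof.
elim: n => [|n IH]; first by case: z.
rewrite mkseqS comp_rev_rcons iterS IH; congr pair; last by rewrite /= addn0.
by apply/funext => k; rewrite /= addnS.
Qed.

Lemma closed_image b : closed [set x | exists2 y, L y & comp_rev phi b y = x].
Proof.
have : compact [set x | exists2 y, L y & comp_rev phi b y = x].
  elim/last_ind: b => [|b i IH].
    by rewrite (_ : [set x | _] = L)//; apply/seteqP; split=> x; [case=> y Ly <-|exists x].
  rewrite (_ : [set x | _] = phi i @` [set x | exists2 y, L y & comp_rev phi b y = x]).
    apply: continuous_compact => //; apply: continuous_in_subspaceT => x /set_mem[y Ly <-].
    by apply: phi_cont; apply: LU; exact: comp_revL.
  apply/seteqP; split=> x.
    by move=> [y Ly]; rewrite comp_rev_rcons => <-; exists (comp_rev phi b y) => //; exists y.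
  by move=> [_ [y Ly <-] <-]; exists y; rewrite ?comp_rev_rcons.
by apply: compact_closed; exact: norm_hausdorff.
Qed.

Lemma event_image b : ev [set z | exists2 y, L y & comp_rev phi b y = z.2].
Proof.
apply: measurable_event => //.
exact: (@measurable_point R m d _ (measurable_closed_borel (@closed_image b))).
Qed.

Lemma event_codes n : forall S, ev ((fun z : T => codes n z.2) @^-1` [set S]).
Proof.
apply: event_finset => // b; have [Jb|Jb] := boolP (all J b); last by apply: (event_ext _ (event0 mD)).
apply: (event_ext _ (event_image b)) => z _ /=.
by split=> [h|/asboolP]//; exact/asboolP.
Qed.

Lemma code_exists n x : L x -> exists b, b \in codes n x.
Proof.
elim: n x => [|n IH] x Lx.
  by exists [tuple]; rewrite inE/=; apply/asboolP; exists x.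
have [i [y Ly <-]] := Lsurj Lx; have [b] := IH y Ly.
rewrite inE => /andP[Jb /asboolP[y' Ly' E]].
exists [tuple of rcons b (rep i)]; rewrite inE all_rcons Jb /= rep_idem eqxx/=.
by apply/asboolP; exists y' => //; rewrite comp_rev_rcons E phi_rep//; exact: LU.
Qed.

Lemma codes_rcons n i x (b : n.-tuple _) : L x ->
  b \in codes n x -> [tuple of rcons b (rep i)] \in codes n.+1 (phi i x).
Proof.
move=> Lx; rewrite !inE => /andP[Jb /asboolP[y Ly E]].
rewrite all_rcons Jb /= rep_idem eqxx/=.
by apply/asboolP; exists y => //; rewrite comp_rev_rcons E phi_rep//; exact: LU.
Qed.

Let add_last n i (b : n.-tuple 'I_m.+1) : n.+1.-tuple 'I_m.+1 := [tuple of rcons b (rep i)].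

Lemma add_last_inj n i : injective (@add_last n i).
Proof. by move=> b b' /(congr1 val)/= /rcons_inj[E]; exact: val_inj. Qed.

(* By [rich_step] the dynamics maps [rich t] into itself, so by invariance almost
   no point enters [rich t] from outside. *)
Definition rich t := [set z : T | exists n, (t <= #|codes n z.2|)%N].

Lemma event_rich t : ev (rich t).
Proof.
have := @event_bigcup _ _ D (fun n => [set z : T | (t <= #|codes n z.2|)%N]).
move=> /(_ (fun n => event_pred mD (@event_codes n) (fun S : {set n.-tuple _} => t <= #|S|)%N)).
by apply: event_ext => // z _; split=> [[n _ h]|[n h]]; exists n.
Qed.

Lemma rich_step t z : D z -> rich t z -> rich t (F z).
Proof.
case: z => w x [_ /= Lx] [n tn]; exists n.+1 => /=.
apply: leq_trans tn _; rewrite -(card_imset _ (@add_last_inj n (w 0%N))).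
by apply: subset_leq_card; apply/fintype.subsetP => _ /imsetP[b bx ->]; exact: codes_rcons.
Qed.

(** Thresholds above [N] are never reached, so finitely many of these events suffice. *)
Let enriched (t : 'I_N.+1) := F @^-1` rich t `&` ~` rich t.

Definition exceptional := [set z : T | exists t, enriched t z].

Let event_enriched t : ev (enriched t).
Proof.
apply: eventI => //; last by apply: eventC => //; exact: event_rich.
exact: (event_preimage mD mF FD (event_rich t)).
Qed.

Lemma event_exceptional : ev exceptional.
Proof. exact: event_exists event_enriched. Qed.

Lemma Pr_exceptional : Prob exceptional = 0.
Proof.
apply/eqP; rewrite eq_le Pr_ge0 andbT.
apply: le_trans (Pr_exists_le mu mD event_enriched) _.
rewrite big1// => t _.
have mA := event_preimage mD mF FD (event_rich t).
have := Pr_setD mu mD mA (event_rich t).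
rewrite (Pr_preimage FD Finv (event_rich t)).
rewrite (Pr_ext mu (A := F @^-1` rich t `&` rich t) (B := rich t)); last first.
  by move=> z Dz; split=> [[]//|h]; split => //; exact: rich_step.
by move=> /eqP; rewrite -subr_eq0 opprD addNKr oppr_eq0 => /eqP.
Qed.

(** Let [t] be the largest number of codings of the image point over all lengths. Off the
    exceptional set [x] already has [t] codings of some length, and appending the representative of
    [j] to them yields [t] codings of the image, hence all of that length. A coding that arrives
    through [i] is among them, so its last letter is that representative too. *)
Lemma unique_last_block z i y : D z -> ~ exceptional z -> L y ->
  phi i y = phi (z.1 0%N) z.2 -> rep i = rep (z.1 0%N).
Proof.
case: z => w x [_ /= Lx] nex Ly E; set j := w 0%N in E *.
pose P t := `[< exists n, (t <= #|codes n (phi j x)|)%N >].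
have P0 : exists t, P t by exists 0%N; apply/asboolP; exists 0%N.
have PN t : P t -> (t <= N)%N.
  by move=> /asboolP[n h]; exact: leq_trans h (codes_le _ _).
case: (ex_maxnP P0 PN) => t Pt tmax.
have tN : (t < N.+1)%N by exact: PN.
have [n tn] : exists n, (t <= #|codes n x|)%N.
  apply: contrapT => h; apply: nex; exists (Ordinal tN).
  by split; [move/asboolP: Pt|].
have EE : add_last j @: codes n x = codes n.+1 (phi j x).
  apply/eqP; rewrite eqEcard (card_imset _ (@add_last_inj n j)); apply/andP; split.
    by apply/fintype.subsetP => _ /imsetP[b bx ->]; exact: codes_rcons.
  by apply: leq_trans tn; apply: tmax; apply/asboolP; exists n.+1.
have [b bC] := code_exists n Ly.
have := codes_rcons i Ly bC; rewrite E -EE => /imsetP[b' _ /(congr1 val)/= /rcons_inj[_]].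
by [].
Qed.

Lemma codings_of_orbit n (z : T) (eta : n.-tuple 'I_m.+1) y : D z ->
  (forall k : 'I_n, ~ exceptional (iter k F z)) -> L y ->
  comp_rev phi (mkseq z.1 n) z.2 = comp_rev phi eta y ->
  forall k, rep (tnth eta k) = rep (z.1 k).
Proof.
move=> Dz nex Ly E k0.
(* The induction runs over words [e] acting on the fixed [y]: at time [size e] the block of the last
   letter is determined by [unique_last_block], and injectivity then cancels that letter. *)
suff H (e : seq 'I_m.+1) : (size e <= n)%N ->
    comp_rev phi (mkseq z.1 (size e)) z.2 = comp_rev phi e y ->
    forall k, (k < size e)%N -> rep (nth ord0 e k) = rep (z.1 k).
  by rewrite (tnth_nth ord0); apply: H; rewrite ?size_tuple.
elim/last_ind: e => [//|e i IH]; rewrite size_rcons => en.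
rewrite mkseqS !comp_rev_rcons => E1.
have [_ Lz] := Dz.
have ri : rep i = rep (z.1 (size e)).
  have := @unique_last_block (iter (size e) F z) i (comp_rev phi e y).
  rewrite iter_lift_map /= addn0; apply => //.
  - by split => //=; exact: comp_revL.
  - by have := nex (Ordinal en); rewrite /= iter_lift_map.
  - exact: comp_revL.
have E2 : comp_rev phi (mkseq z.1 (size e)) z.2 = comp_rev phi e y.
  have U1 : U (comp_rev phi (mkseq z.1 (size e)) z.2) by apply: LU; exact: comp_revL.
  have U2 : U (comp_rev phi e y) by apply: LU; exact: comp_revL.
  apply: (phi_inj (i := rep i)) => //.
  by rewrite [RHS]phi_rep// -E1 ri phi_rep.
move=> k; rewrite ltnS leq_eqVlt => /orP[/eqP ->|ke].
  by rewrite nth_rcons ltnn eqxx.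
by rewrite nth_rcons ke; apply: IH => //; exact: ltnW.
Qed.

Lemma orbit_codings n (z : T) (eta : n.-tuple 'I_m.+1) : D z ->
  (forall k, rep (tnth eta k) = rep (z.1 k)) ->
  comp_rev phi (mkseq z.1 n) z.2 = comp_rev phi eta z.2.
Proof.
move=> [_ /= Lz] E.
suff H (e : seq 'I_m.+1) : (forall k, (k < size e)%N -> rep (nth ord0 e k) = rep (z.1 k)) ->
    comp_rev phi (mkseq z.1 (size e)) z.2 = comp_rev phi e z.2.
  rewrite -[X in mkseq _ X](size_tuple eta); apply: H => k.
  rewrite size_tuple => kn; have := E (Ordinal kn).
  by rewrite (tnth_nth ord0).
elim/last_ind: e => [//|e i IH]; rewrite size_rcons => en.
rewrite mkseqS !comp_rev_rcons IH; last first.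
  by move=> k ke; have := en k (leqW ke); rewrite nth_rcons ke.
have := en (size e) (leqnn _); rewrite nth_rcons ltnn eqxx => ri.
have U2 : U (comp_rev phi e z.2) by apply: LU; exact: comp_revL.
by rewrite -(phi_rep i)// ri phi_rep.
Qed.

Definition block_size i : nat := #|[pred j | rep j == rep i]|.

Lemma overlap_countE n z : D z -> (forall k : 'I_n, ~ exceptional (iter k F z)) ->
  overlap_count phi L n z = (\prod_(k < n) block_size (z.1 k))%N.
Proof.
move=> Dz nex; rewrite -(card_blocks rep (fun k : 'I_n => z.1 k)).
apply: eq_card => eta; rewrite !inE; apply/asboolP/forallP.
  by move=> [y Ly E] k; apply/eqP; exact: (codings_of_orbit Dz nex Ly E).
move=> h; exists z.2; first by case: Dz.
by apply: orbit_codings => // k; exact/eqP.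
Qed.

Lemma block_size_gt0 i : (0 < block_size i)%N.
Proof. by apply/card_gt0P; exists i; rewrite inE. Qed.

Lemma event_letter (k : nat) i : ev [set z | z.1 k = i].
Proof. by apply: measurable_event => //; exact: measurable_letter. Qed.

Lemma Pr_letter (k : nat) i : Prob [set z | z.1 k = i] = Prob [set z | z.1 0%N = i].
Proof.
rewrite -(Pr_iter mD mF FD Finv k (@event_letter 0%N i)); apply: Pr_ext => z _ /=.
by rewrite iter_lift_map /= addn0.
Qed.

Lemma overlap_rateE n : (0 < n)%N -> overlap_rate phi L mu n =
  \sum_i Prob [set z | z.1 0%N = i] * ln (block_size i)%:R.
Proof.
move=> n0.
(* The count is read off the finite-valued [S]; its joint law with the letters [W] turns the
   integral into a finite sum that can be compared with block sizes value by value. *)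
pose S (z : T) := [set eta : n.-tuple 'I_m.+1 |
   `[< exists2 y, L y & comp_rev phi (mkseq z.1 n) z.2 = comp_rev phi eta y >]]%SET.
pose W (z : T) := [tuple z.1 k | k < n].
have mW : forall t, ev (W @^-1` [set t]).
  by apply: event_tuple => // k i; exact: event_letter.
have mS : forall s, ev (S @^-1` [set s]).
  apply: event_finset => // eta.
  have := event_iter mD mF FD n (event_image eta).
  apply: event_ext => // z _ /=; rewrite iter_lift_map /=.
  by split=> [[y Ly E]|/asboolP[y Ly E]]; [apply/asboolP|]; exists y.
have mX := event_pair mW mS.
pose h (p : n.-tuple 'I_m.+1 * {set n.-tuple 'I_m.+1}) : R := ln #|p.2|%:R.
have h0 p : 0 <= h p.
  rewrite /h; case: #|_| => [|k]; first by rewrite ln0.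
  by rewrite ln_ge0// ler1n.
rewrite /overlap_rate (_ : (fun z => _) = h \o (fun z => (W z, S z))); last first.
  apply/funext => z /=; rewrite /h /=; congr (ln _%:R).
  by apply: eq_card => eta; rewrite !inE.
rewrite (Rintegral_expect mu mD mX h0).
have -> : expect mu D (fun z => (W z, S z)) h =
    expect mu D (fun z => (W z, S z)) (fun p => \sum_(k < n) ln (block_size (tnth p.1 k))%:R).
  apply: eq_bigr => -[t s] _ /=.
  have [[z [Dz nex Ez]]|none] := pselect (exists z, [/\ D z,
      forall k : 'I_n, ~ exceptional (iter k F z) & (W z, S z) = (t, s)]).
    congr (_ * _); rewrite /h /=; case: Ez => <- <-.
    have -> : #|S z| = overlap_count phi L n z by apply: eq_card => eta; rewrite !inE.
    rewrite overlap_countE// natr_prod ln_prod => [|k]; last by rewrite ltr0n block_size_gt0.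
    by apply: eq_bigr => k _; rewrite tnth_mktuple.
  (* A pair of values attained only on orbits that meet the exceptional set has probability zero. *)
  suff -> : Prob ((fun z => (W z, S z)) @^-1` [set (t, s)]) = 0 by rewrite !mul0r.
  have mE (k : 'I_n) : ev [set z | exceptional (iter k F z)].
    exact: (event_iter mD mF FD k event_exceptional).
  apply/eqP; rewrite eq_le Pr_ge0 andbT.
  apply: le_trans (_ : Prob [set z | exists k : 'I_n, exceptional (iter k F z)] <= _).
    apply: le_Pr => //; first exact: event_exists.
    move=> z Dz /= E; apply: contrapT => ne; apply: none; exists z; split => //.
    by move=> k ek; apply: ne; exists k.
  apply: le_trans (Pr_exists_le mu mD mE) _; rewrite big1// => k _.
  by rewrite (Pr_iter mD mF FD Finv k event_exceptional) Pr_exceptional.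
rewrite expect_sum (eq_bigr (fun _ : 'I_n => \sum_i Prob [set z | z.1 0%N = i] * ln (block_size i)%:R)); last first.
  move=> k _.
  rewrite (expect_comp mu mD mX (fun p => tnth p.1 k) (fun i => ln (block_size i)%:R)).
  apply: eq_bigr => i _; congr (_ * _); rewrite -(@Pr_letter k i).
  by apply: Pr_ext => z _ /=; rewrite tnth_mktuple.
have E (x : R) : n%:R^-1 * (x *+ n) = x.
  by rewrite -[x *+ n]mulr_natl mulrA mulVf ?mul1r// pnatr_eq0 -lt0n.
by rewrite sumr_const card_ord E.
Qed.

End overlap.

(** * Gibbs' inequality *)

Section gibbs.
Context (R : realType).

Lemma ln_le_sub1 (x : R) : 0 < x -> ln x <= x - 1.
Proof.
move=> x0; have := @le_ln1Dx R (x - 1); rewrite (addrC 1) subrK; apply.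
by rewrite ltrBDr addNr.
Qed.

(** Termwise [a j * ln (b j / a j) <= b j - a j], from [ln x <= x - 1]; terms with [a j = 0] are
    treated apart. *)
Lemma gibbs (J : finType) (a b : J -> R) :
  (forall j, 0 <= a j) -> \sum_j a j = 1 -> (forall j, 0 < b j) -> \sum_j b j <= 1 ->
  - \sum_j a j * ln (a j) <= - \sum_j a j * ln (b j).
Proof.
move=> a0 a1 b0 b1; rewrite lerN2 -subr_le0 -sumrB.
apply: le_trans (_ : \sum_j (b j - a j) <= _); last by rewrite sumrB a1 subr_le0.
apply: ler_sum => j _; have := a0 j; rewrite le_eqVlt => /orP[/eqP <-|aj0].
  by rewrite !mul0r !subr0 ltW.
rewrite -mulrBr -ln_div ?posrE//.
apply: le_trans (_ : a j * (b j / a j - 1) <= _).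
  by rewrite ler_wpM2l// ln_le_sub1// divr_gt0.
by rewrite mulrBr mulr1 mulrCA divff ?gt_eqF// mulr1.
Qed.

End gibbs.

(** * Upper bound for the entropy *)

Section coding_bound.
Context (R : realType) (dT : measure_display) (T : measurableType dT).
Variables (mu : probability T R) (D : set T) (F : T -> T).
Hypothesis mD : measurable D.
Hypothesis muD : mu D = 1%E.
Hypothesis mF : measurable_fun D F.
Hypothesis FD : forall x, D x -> D (F x).
Hypothesis Finv : forall A, measurable A -> mu (D `&` F @^-1` A) = mu A.
Variables (A : finType) (a0 : A) (a : T -> A).
Hypothesis ma : forall i, event D (a @^-1` [set i]).
Variables (N : nat) (P : T -> 'I_N).
Hypothesis mP : forall i, event D (P @^-1` [set i]).
Variable Q : A -> R.
Hypothesis Q_gt0 : forall i, 0 < Q i.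
Hypothesis Q_sum : \sum_i Q i = 1.

Local Notation Prob := (Pr mu D).

Definition word n z := mkseq (fun k => a (iter k F z)) n.

Lemma event_word n (B : pred (seq A)) : event D [set z | B (word n z)].
Proof.
have mW : forall t, event D ((fun z => [tuple a (iter k F z) | k < n]) @^-1` [set t]).
  by apply: event_tuple => // k i; exact: (event_iter mD mF FD k (ma i)).
apply: (event_ext _ (event_pred mD mW (fun t : n.-tuple A => B t))) => z _.
by rewrite /= /word /mkseq -val_enum_ord -map_comp.
Qed.

Lemma event_word_eq n q (est : seq A -> 'I_N) :
  event D [set z | P (iter q F z) != est (word n z)].
Proof.
have mX : forall j, event D ((fun z => (P (iter q F z), est (word n z))) @^-1` [set j]).
  apply: event_pair => // j; first exact: (event_iter mD mF FD q (mP j)).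
  apply: (event_ext _ (event_word n (fun s => est s == j))) => z _ /=.
  by split=> /eqP.
exact: (event_pred mD mX (fun p => p.1 != p.2)).
Qed.

(** The cross-entropy of the law of the letter [a z] relative to [Q]. *)
Definition letter_cost : R := \sum_i Prob [set z | a z = i] * - ln (Q i).

Let Q_le1 i : Q i <= 1.
Proof. by rewrite -Q_sum (bigD1 i)//= lerDl sumr_ge0// => j _; exact: ltW. Qed.

Lemma letter_cost_ge0 : 0 <= letter_cost.
Proof.
by apply: sumr_ge0 => i _; rewrite mulr_ge0 ?Pr_ge0// oppr_ge0 ln_le0.
Qed.

Section fixed_estimator.
Variables (q : nat) (est : seq A -> 'I_N) (delta e : R).
Hypothesis delta01 : 0 < delta < 1.
Hypothesis est_e : Prob [set z | P (iter q F z) != est (word (2 * q) z)] <= e.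

Let N_gt0 : (0 < N)%N. Proof. by apply: leq_ltn_trans (ltn_ord (P point)). Qed.

Let t (i j : 'I_N) : R := (1 - delta) * (i == j)%:R + delta / N%:R.

Let K : R := - ln (delta / N%:R).

Let d0 : 0 < delta. Proof. by case/andP: delta01. Qed.
Let d1 : 0 < 1 - delta. Proof. by rewrite subr_gt0; case/andP: delta01. Qed.
Let dN : 0 < delta / N%:R. Proof. by rewrite divr_gt0// ltr0n. Qed.

Let t_gt0 i j : 0 < t i j.
Proof. by rewrite ltr_wpDl// mulr_ge0// ltW. Qed.

Let t_sum j : \sum_i t i j = 1.
Proof.
rewrite big_split/= sumr_const card_ord -mulr_sumr (bigD1 j)//= eqxx big1 => [|i /negbTE ->//].
by rewrite addr0 mulr1 -[delta / N%:R *+ N]mulr_natr divfK ?subrK// pnatr_eq0 -lt0n.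
Qed.

Let K_ge0 : 0 <= K.
Proof.
rewrite oppr_ge0 ln_le0// ler_pdivrMr ?ltr0n// mul1r.
by apply: le_trans (_ : 1 <= _); [case/andP: delta01 => _ /ltW|rewrite ler1n].
Qed.

Let t_cost i j : - ln (t i j) <= - ln (1 - delta) + (i != j)%:R * K.
Proof.
have [->|ij] := eqVneq i j.
  rewrite mul0r addr0 lerN2 ler_ln ?posrE// /t eqxx mulr1 lerDl.
  exact: ltW.
rewrite /t (negbTE ij) mulr0 add0r mul1r lerDr oppr_ge0 ln_le0//.
by rewrite gerBl ltW.
Qed.

Variable n : nat.

Let W z : {ffun 'I_(n + q) -> A} := [ffun k : 'I_(n + q) => a (iter k F z)].
Let S := itinerary F P n.

Let extend (w : {ffun 'I_(n + q) -> A}) (k : nat) : A :=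
  if insub k is Some j then w j else a0.
(** The window of the label at time [k] consists of the letters from [k - q] to [k + q - 1], whence
    the [n + q] letters of [W]. For [k < q] the truncated subtraction shifts the window; such labels
    are simply counted as wrong. *)
Let guess (w : {ffun 'I_(n + q) -> A}) (k : nat) : 'I_N :=
  est (mkseq (fun i => extend w (k - q + i)) (2 * q)).

Let guess_W k z : (q <= k < n)%N -> guess (W z) k = est (word (2 * q) (iter (k - q) F z)).
Proof.
move=> /andP[qk kn]; congr est; apply/eq_in_map => i; rewrite mem_iota add0n => /andP[_ i2q].
rewrite /extend insubT => [|lt_]; first by move: qk kn i2q; clear; lia.
by rewrite ffunE/= addnC iterD.
Qed.

(* The law that draws independent letters from [Q] and then, independently,
   each label: the guess of the estimator, redrawn uniformly with probability
   [delta]. *)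
Let weight (p : {ffun 'I_n -> 'I_N} * {ffun 'I_(n + q) -> A}) : R :=
  (\prod_j Q (p.2 j)) * \prod_k t (p.1 k) (guess p.2 k).

Let weight_gt0 p : 0 < weight p.
Proof. by rewrite mulr_gt0// prodr_gt0. Qed.

Let marginal s := \sum_w weight (s, w).

Let marginal_sum : \sum_s marginal s = 1.
Proof.
have H1 w : \sum_(s : {ffun 'I_n -> 'I_N}) \prod_k t (s k) (guess w k) = 1.
  by rewrite -(bigA_distr_bigA (fun (k : 'I_n) i => t i (guess w k))) big1.
have H2 : \sum_(w : {ffun 'I_(n + q) -> A}) \prod_j Q (w j) = 1.
  by rewrite -(bigA_distr_bigA (fun (_ : 'I_(n + q)) i => Q i)) big1.
rewrite exchange_big/= -[RHS]H2; apply: eq_bigr => w _.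
by rewrite /weight/= -mulr_sumr H1 mulr1.
Qed.

Let X z := (S z, W z).

Let mS : forall s, event D (S @^-1` [set s]).
Proof.
move=> s; apply: (event_ext _ (event_forall mD (fun k => event_iter mD mF FD (nat_of_ord k) (mP (s k))))) => z _ /=.
split=> [h|<- k]; last by rewrite ffunE.
by apply/ffunP => k; rewrite ffunE; exact: h.
Qed.

Let mW : forall w, event D (W @^-1` [set w]).
Proof.
move=> w; apply: (event_ext _ (event_forall mD (fun k => event_iter mD mF FD (nat_of_ord k) (ma (w k))))) => z _ /=.
split=> [h|<- k]; last by rewrite ffunE.
by apply/ffunP => k; rewrite ffunE; exact: h.
Qed.

Let mX : forall p, event D (X @^-1` [set p]).
Proof. exact: event_pair. Qed.

(** Gibbs' inequality against the marginal of [weight], which is bounded below by its single term at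
    the actual word. Each letter then costs [letter_cost], each label [- ln (1 - delta)], and each
    wrong guess at most [K] more; up to [q] labels lack a full window, the others are wrong with
    probability at most [e]. *)
Lemma partition_entropy_le : partition_entropy mu D S <=
  (n + q)%:R * letter_cost + n%:R * - ln (1 - delta) + (q%:R + n%:R * e) * K.
Proof.
apply: le_trans (_ : - \sum_s Prob (S @^-1` [set s]) * ln (marginal s) <= _).
  apply: gibbs => [s||s|].
  - exact: Pr_ge0.
  - exact: sum_Pr.
  - rewrite /marginal (bigD1 (W point))//=; apply: ltr_wpDr => //.
    by apply: sumr_ge0 => w _; exact: ltW.
  - by rewrite marginal_sum.
have -> : - \sum_s Prob (S @^-1` [set s]) * ln (marginal s) =
    expect mu D X (fun p => - ln (marginal p.1)).
  rewrite (expect_comp mu mD mX fst (fun s => - ln (marginal s))) -sumrN.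
  by apply: eq_bigr => s _; rewrite mulrN.
apply: le_trans (_ : expect mu D X (fun p => \sum_j - ln (Q (p.2 j)) +
    \sum_(k < n) (- ln (1 - delta) + (p.1 k != guess p.2 k)%:R * K)) <= _).
  apply: le_expect => -[s w] /=.
  apply: le_trans (_ : - ln (weight (s, w)) <= _).
    rewrite lerN2 ler_ln ?posrE//.
      by rewrite /marginal (bigD1 w)//= lerDl sumr_ge0// => w' _; exact: ltW.
    rewrite /marginal (bigD1 w)//=; apply: ltr_wpDr => //.
    by apply: sumr_ge0 => w' _; exact: ltW.
  rewrite /weight lnM ?posrE ?prodr_gt0//= !ln_prod// opprD -!sumrN lerD2l.
  by apply: ler_sum.
rewrite expectD -addrA lerD//.
  rewrite expect_sum (eq_bigr (fun _ => letter_cost)).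
    by rewrite sumr_const card_ord mulr_natl.
  move=> j _; rewrite (expect_comp mu mD mX (fun p => p.2 j) (fun i => - ln (Q i))).
  apply: eq_bigr => i _; congr (_ * _).
  rewrite -(Pr_iter mD mF FD Finv j (ma i)); apply: Pr_ext => z _ /=.
  by rewrite ffunE.
rewrite expect_sum.
have cost k : expect mu D X (fun p => - ln (1 - delta) + (p.1 k != guess p.2 k)%:R * K) =
    - ln (1 - delta) + Prob [set z | S z k != guess (W z) k] * K.
  rewrite expectD; congr (_ + _).
    rewrite /expect -mulr_suml (sum_Pr mD muD mX) mul1r//.
  rewrite (expect_comp mu mD mX (fun p => p.1 k != guess p.2 k) (fun b : bool => b%:R * K)).
  rewrite big_bool/= mul1r mul0r mulr0 addr0; congr (_ * _).
rewrite (eq_bigr _ (fun k _ => cost k)) big_split/= sumr_const card_ord mulr_natl lerD2l.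
rewrite -mulr_suml ler_wpM2r//.
have bound (k : 'I_n) : Prob [set z | S z k != guess (W z) k] <= (k < q)%N%:R + e.
  have e0 : 0 <= e by apply: le_trans est_e; exact: Pr_ge0.
  have mE : event D [set z | S z k != guess (W z) k].
    exact: (event_pred mD mX (fun p => p.1 k != guess p.2 k)).
  have [kq|qk] := ltnP k q.
    by apply: le_trans (Pr_le1 mD muD mE) _; rewrite lerDl.
  rewrite add0r; apply: le_trans est_e.
  rewrite -(Pr_iter mD mF FD Finv (k - q) (event_word_eq (2 * q) q est)).
  rewrite le_eqVlt; apply/orP; left; apply/eqP; apply: Pr_ext => z _ /=.
  by rewrite guess_W ?qk ?ltn_ord// ffunE -iterD subnKC.
apply: le_trans (ler_sum _ (fun k _ => bound k)) _.
rewrite big_split/= sumr_const card_ord mulr_natl lerD2r -natr_sum ler_nat.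
suff -> : (\sum_(k < n) (k < q) = minn n q)%N by exact: geq_minr.
elim: (n) => [|k IH]; first by rewrite big_ord0 min0n.
by rewrite big_ord_recr/= IH; lia.
Qed.

End fixed_estimator.

Hypothesis guessable : forall e : R, 0 < e -> exists q est,
  Prob [set z | P (iter q F z) != est (word (2 * q) z)] <= e.

Lemma entropy_wrt_le : entropy_wrt mu D F P <= letter_cost.
Proof.
have N_gt0 : (0 < N)%N by apply: leq_ltn_trans (ltn_ord (P point)).
rewrite /entropy_wrt; set u := fun n => _.
(* For a divergent sequence [limn] is the default value [0]. *)
have [cu|/dvgP ->] := pselect (cvgn u); last exact: letter_cost_ge0.
apply/ler_addgt0Pr => eta eta0.
apply: limr_le => //.
pose delta := Num.min (1 / 2) (eta / 8).
have d0 : 0 < delta by rewrite lt_min !divr_gt0.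
have [dh de] : delta <= 1 / 2 /\ delta <= eta / 8.
  by split; rewrite /delta ge_min lexx ?orbT.
have d01 : 0 < delta < 1 by rewrite d0/=; lra.
have lnd : - ln (1 - delta) <= eta / 4.
  have d1 : 0 < 1 - delta by lra.
  rewrite -lnV ?posrE//; apply: le_trans (ln_le_sub1 _) _; first by rewrite invr_gt0.
  have : (1 - delta)^-1 <= 1 + 2 * delta; last by lra.
  rewrite -[leLHS]mul1r ler_pdivrMr//; have : 0 <= delta * (1 / 2 - delta) by rewrite mulr_ge0 ?subr_ge0// ltW.
  lra.
pose K : R := - ln (delta / N%:R).
have K0 : 0 <= K.
  rewrite oppr_ge0 ln_le0// ler_pdivrMr ?ltr0n// mul1r.
  by apply: le_trans (_ : 1 <= _); [lra|rewrite ler1n].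
have K1 : 0 < K + 1 by lra.
(* The order of choices matters: [K] grows as [delta] shrinks, so the admissible error is fixed
   after [delta], and [n] after [q]. Noise, wrong guesses and the boundary term [C] take a quarter
   of [eta] each. *)
have [q [est Hest]] := guessable (divr_gt0 eta0 (mulr_gt0 (ltr0n R 4) K1)).
pose C := q%:R * (letter_cost + K).
have C0 : 0 <= C by rewrite mulr_ge0// addr_ge0// letter_cost_ge0.
near=> n.
have n0 : (0 < n)%N by near: n; exists 1%N.
have nR : 0 < n%:R :> R by rewrite ltr0n.
have nC : C <= n%:R * (eta / 4).
  by rewrite -ler_pdivrMr ?divr_gt0//; near: n; exact: nbhs_infty_ger.
have := partition_entropy_le d01 Hest n; rewrite -/K => H.
rewrite /u mulrC ler_pdivrMr//; apply: le_trans H _.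
set e := eta / (4 * (K + 1)).
have eK : e * K <= eta / 4.
  rewrite /e mulrAC ler_pdivrMr ?mulr_gt0//.
  have : eta / 4 * (4 * (K + 1)) = eta * K + eta by field.
  move=> ->; rewrite lerDl; exact: ltW.
have h1 : n%:R * (e * K) <= n%:R * (eta / 4) by rewrite ler_wpM2l// ltW.
have h2 : n%:R * - ln (1 - delta) <= n%:R * (eta / 4) by rewrite ler_wpM2l// ltW.
have h3 : 0 <= n%:R * (eta / 4) by rewrite mulr_ge0 ?ltW ?divr_gt0.
rewrite natrD; rewrite /C in nC; lra.
Unshelve. all: by end_near.
Qed.

End coding_bound.

(** * Guessing the state from a window of letters *)

Section guessing.
Context (R : realType) (m d : nat).
Variables (phi : 'I_m.+1 -> 'rV[R]_d -> 'rV[R]_d) (U L : set 'rV[R]_d).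
Variable mu : probability (lift_space R m d) R.
Hypothesis oU : open U.
Hypothesis phi_cont : forall i x, U x -> {for x, continuous (phi i)}.
Hypothesis cL : compact L.
Hypothesis LU : L `<=` U.
Hypothesis Linv : forall i x, L x -> L (phi i x).
Variable c : R.
Hypothesis c01 : 0 < c < 1.
Hypothesis phi_contract : forall i x y, L x -> L y ->
  enorm (phi i x - phi i y) <= c * enorm (x - y).
Hypothesis mu_inv : lift_invariant phi L mu.

Local Notation T := (lift_space R m d).
Local Notation D := (@lift_domain R m d L).
Local Notation F := (@lift_map R m d phi).
Local Notation Prob := (Pr mu D).
Local Notation ev := (@event _ _ D).

Let mD : measurable D. Proof. exact: measurable_lift_domain. Qed.
Let mF : measurable_fun D F. Proof. exact: measurable_lift_map LU. Qed.
Let FD z : D z -> D (F z). Proof. by case: z => w x [_ Lx]; split => //; exact: Linv. Qed.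
Let Finv A : measurable A -> mu (D `&` F @^-1` A) = mu A. Proof. by case: mu_inv => _; apply. Qed.

Let first (z : T) := z.1 0%N.

Lemma word_lift n z : word F first n z = mkseq z.1 n.
Proof. by apply: eq_map => k; rewrite iter_lift_map /first /= addn0. Qed.

Definition bad_guess (A : set T) q (B : pred (seq 'I_m.+1)) : set T :=
  [set z | ~ (A (iter q F z) <-> B (mkseq z.1 (2 * q)))].

(* Of the [2 * q] letters the first [q], already applied at time [q], locate the
   second coordinate; the others are the initial letters of the first one. *)
Definition guessable (A : set T) := measurable A /\
  forall e : R, 0 < e -> exists q0, forall q, (q0 <= q)%N ->
    exists B, Prob (bad_guess A q B) <= e.

Lemma event_first i : ev (first @^-1` [set i]).
Proof. by apply: measurable_event => //; exact: measurable_letter. Qed.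

Lemma event_guess n (B : pred (seq 'I_m.+1)) : ev [set z | B (mkseq z.1 n)].
Proof.
apply: (event_ext _ (event_word mD mF FD event_first n B)) => z _ /=.
by rewrite word_lift.
Qed.

Lemma event_bad_guess A q B : measurable A -> ev (bad_guess A q B).
Proof.
move=> mA; have mAq := event_iter mD mF FD q (measurable_event mD mA).
have mB := event_guess (2 * q) B.
apply: (event_ext _ (eventU (eventI mAq (eventC mD mB)) (eventI (eventC mD mAq) mB))) => z _.
rewrite /bad_guess /=; split; first by tauto.
have [a|na] := pselect (A (iter q F z)); have [b|nb] := pselect (B (mkseq z.1 (2 * q))); tauto.
Qed.

Lemma guessable0 : guessable set0.
Proof.
split=> // e e0; exists 0%N => q _; exists xpred0.
rewrite (_ : bad_guess _ _ _ = set0) ?Pr0 ?ltW//.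
by apply/seteqP; split=> // z /= h; apply: h; split.
Qed.

Lemma guessableC A : guessable A -> guessable (~` A).
Proof.
move=> [mA gA]; split; first exact: measurableC.
move=> e /gA[q0 H]; exists q0 => q /H[B HB]; exists (predC B).
rewrite (_ : bad_guess _ _ _ = bad_guess A q B)//.
apply/seteqP; split=> z; rewrite /bad_guess /=; case: (B _) => /=;
  have [a|na] := pselect (A (iter q F z)); intuition.
Qed.

(** Up to the tail the union is finite, and its guess is the disjunction of the guesses. The tail is
    evaluated at time [q], where by invariance it has the same probability as at time [0]. *)
Lemma guessable_bigcup (G : nat -> set T) :
  (forall n, guessable (G n)) -> guessable (\bigcup_n G n).
Proof.
move=> gG; have mG n : measurable (G n) by case: (gG n).
split; first exact: bigcupT_measurable.
move=> e e0.
have [n Hn] := Pr_bigcup_tail mu mD (fun n => measurable_event mD (mG n)) (divr_gt0 e0 (ltr0n R 2)).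
pose tail := bigcup_tail G n.
have mtail : ev tail by exact: (event_bigcup_tail mD n (fun n => measurable_event mD (mG n))).
pose e' := e / (2 * n.+1%:R).
have e'0 : 0 < e' by rewrite divr_gt0// mulr_gt0.
have /choice[q0 Hq0] : forall k, exists q0, forall q, (q0 <= q)%N ->
    exists B, Prob (bad_guess (G k) q B) <= e'.
  by move=> k; have [_ /(_ e' e'0)] := gG k.
exists (\max_(k < n) q0 k) => q qn.
have /choice[B HB] : forall k : 'I_n, exists B, Prob (bad_guess (G k) q B) <= e'.
  by move=> k; apply: Hq0; apply: leq_trans qn; exact: (leq_bigmax k).
exists (fun s => [exists k, B k s]).
have mtq := event_iter mD mF FD q mtail.
have mbad k : ev (bad_guess (G (nat_of_ord k)) q (B k)) by exact: event_bad_guess.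
apply: le_trans (_ : Prob ([set z | tail (iter q F z)] `|`
    [set z | exists k : 'I_n, bad_guess (G k) q (B k) z]) <= _).
  apply: le_Pr.
  - by apply: event_bad_guess; exact: bigcupT_measurable.
  - by apply: eventU => //; exact: event_exists.
  move=> z _; apply: contra_notP => /not_orP[ntail nbad]; split.
    move=> [k _ Gk]; apply: contrapT => nB; apply: ntail; split; first by exists k.
    move=> [j jn Gj]; apply: nB; apply/existsP; exists (Ordinal jn).
    apply: contrapT => nBj; apply: nbad; exists (Ordinal jn) => -[+ _].
    by move=> /(_ Gj).
  move=> /existsP[k Bk]; exists k => //.
  by apply: contrapT => nG; apply: nbad; exists k => -[_ +]; move=> /(_ Bk).
apply: le_trans (Pr_leU mu mD mtq _) _; first exact: event_exists.
rewrite (Pr_iter mD mF FD Finv q mtail).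
apply: le_trans (lerD Hn (Pr_exists_le mu mD mbad)) _.
apply: le_trans (lerD (lexx _) (ler_sum _ (fun k _ => HB k))) _.
rewrite sumr_const card_ord -[e' *+ n]mulr_natl.
have : n%:R * e' <= e / 2.
  rewrite /e' mulrA ler_pdivrMr ?mulr_gt0//.
  have -> : e / 2 * (2 * n.+1%:R) = n.+1%:R * e by field.
  by rewrite ler_wpM2r ?(ltW e0)// ler_nat.
lra.
Qed.

Lemma guessable_letter j i : guessable [set z : T | z.1 j = i].
Proof.
split; first exact: measurable_letter.
move=> e e0; exists j.+1 => q jq; exists (fun s => nth ord0 s (q + j) == i).
rewrite (_ : bad_guess _ _ _ = set0) ?Pr0 ?ltW//.
apply/seteqP; split=> // z h; apply: h => /=.
rewrite iter_lift_map /= nth_mkseq; first by split=> /eqP.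
by move: jq; clear; lia.
Qed.

(** The guess is that the image of [L] under the [q] applied letters meets [E]. It can err only by
    accepting, at points outside [E] but within the small diameter of that image from the compact
    set of points of [E] in [L]; shrinking thickenings decrease to this set, so such points have
    small probability. *)
Lemma guessable_closed E : closed E -> guessable [set z : T | E z.2].
Proof.
move=> cE; split.
  exact: (@measurable_point R m d _ (measurable_closed_borel cE)).
move=> e e0.
have cEL : compact (E `&` L).
  by apply: (subclosed_compact _ cL) => //; apply: closedI => //; exact: closed_limit_set.
pose G n := ~` thicken (E `&` L) (n.+1%:R^-1 : R).
have mG n : measurable [set z : T | G n z.2].
  apply: (@measurable_point R m d (G n)); apply: measurableC.
  apply: measurable_closed_borel; apply: compact_closed; first exact: norm_hausdorff.
  exact: compact_thicken.
have [n Hn] := Pr_bigcup_tail mu mD (fun n => measurable_event mD (mG n)) e0.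
have [dia Hdia] := compact_diameter cL.
have dia1 : 0 < `|dia| + 1 by rewrite ltr_wpDl.
have cc : 0 <= c < 1 by case/andP: c01 => /ltW -> ->.
have n1 : 0 < n.+1%:R^-1 :> R by rewrite invr_gt0.
have [q0 Hq0] := exists_expr_le cc (divr_gt0 n1 dia1).
exists q0 => q /Hq0 cq.
pose B s := `[< exists2 y, L y & E (comp_rev phi (take q s) y) >].
exists B.
pose tail := bigcup_tail (fun n => [set z : T | G n z.2]) n.
have mtail : ev tail by exact: (event_bigcup_tail mD n (fun n => measurable_event mD (mG n))).
rewrite -(Pr_iter mD mF FD Finv q mtail) in Hn.
apply: le_trans Hn; apply: le_Pr.
- by apply: event_bad_guess; exact: (@measurable_point R m d _ (measurable_closed_borel cE)).
- exact: (event_iter mD mF FD q mtail).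
move=> z [_ /= Lz] /= bad.
have tk : take q (mkseq z.1 (2 * q)) = mkseq z.1 q.
  by rewrite /mkseq -map_take take_iota (minn_idPl _)//; lia.
move: bad; rewrite /bad_guess /= iter_lift_map /= /B tk.
set x := comp_rev phi (mkseq z.1 q) z.2.
have Lx : L x by exact: comp_revL.
have [Ex|nEx] := pselect (E x).
  by move=> h; exfalso; apply: h; split=> // _; apply/asboolP; exists z.2.
have [Bx|nBx] := pselect (exists2 y, L y & E (comp_rev phi (mkseq z.1 q) y)); last first.
  by move=> h; exfalso; apply: h; split=> // /asboolP.
move=> _; have [y Ly Ey] := Bx.
have xy : enorm (x - comp_rev phi (mkseq z.1 q) y) <= n.+1%:R^-1.
  have H (b : seq 'I_m.+1) : enorm (comp_rev phi b z.2 - comp_rev phi b y) <= c ^+ size b * enorm (z.2 - y).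
    elim/last_ind: b => [|b i IH]; first by rewrite mul1r.
    rewrite !comp_rev_rcons size_rcons exprS -mulrA.
    apply: le_trans (phi_contract _ _ _) _; try exact: comp_revL.
    by rewrite ler_wpM2l//; case/andP: cc.
  apply: le_trans (H _) _; rewrite size_mkseq.
  apply: le_trans (_ : n.+1%:R^-1 / (`|dia| + 1) * (`|dia| + 1) <= _); last first.
    by rewrite divfK ?gt_eqF.
  apply: ler_pM => //; first by rewrite exprn_ge0//; case/andP: cc.
    exact: enorm_ge0.
  by apply: le_trans (Hdia _ _ Lz Ly) _; apply: le_trans (ler_norm _) _; rewrite lerDl.
split.
  apply: contrapT => all; apply: nEx.
  have xt k : thicken (E `&` L) (k.+1%:R^-1) x.
    by apply: contrapT => h; apply: all; exists k.
  have : closure (E `&` L) x.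
    move=> V /nbhs_enorm[r r0 HV].
    have [k kr] : exists k : nat, k.+1%:R^-1 <= r.
      exists (Num.truncn r^-1); rewrite -[leRHS]invrK lef_pV2 ?posrE ?invr_gt0//.
      by rewrite ltW// truncnS_gt.
    have [w ELw xw] := xt k; exists w; split => //; apply: HV.
    by rewrite enormC; exact: le_trans xw kr.
  by move=> /(compact_closed (@norm_hausdorff _ _) cEL)[].
move=> [k kn]; apply; exists (comp_rev phi (mkseq z.1 q) y).
  by split => //; exact: comp_revL.
apply: le_trans xy _; rewrite lef_pV2 ?posrE// ler_nat; exact: ltnW.
Qed.

(** Guessable sets form a sigma-algebra. The product sigma-algebra is generated through the two
    projections, and [subst] reduces each of them to its generators: cylinders, and open sets, the
    complements of closed ones. *)
Lemma guessable_measurable A : measurable A -> guessable A.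
Proof.
have sg : sigma_algebra setT guessable.
  split=> [|B gB|G gG]; first exact: guessable0.
    by rewrite setTD; exact: guessableC.
  exact: guessable_bigcup.
have subst (T' : Type) (G : set (set T')) (f : T -> T') :
    (forall B, G B -> guessable (f @^-1` B)) -> <<s G >> `<=` [set B | guessable (f @^-1` B)].
  move=> GB; apply: smallest_sub => //; split=> /=.
  - exact: guessable0.
  - by move=> B; rewrite setTD => /guessableC.
  - by move=> H gH; rewrite preimage_bigcup; exact: guessable_bigcup.
move=> mA; apply: (smallest_sub sg _ mA) => _ [[B mB <-]|[B mB <-]]; rewrite setTI.
  apply: (@subst _ (@cylinders m) (fun z : T => z.1) _ _ mB).
  by move=> _ [n [i ->]]; exact: guessable_letter.
apply: (@subst _ [set V : set 'rV[R]_d | open V] (fun z : T => z.2) _ _ mB).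
move=> V oV; rewrite -[V]setCK; apply: guessableC; apply: guessable_closed.
exact: open_closedC.
Qed.

Lemma lift_entropy_le (Q : 'I_m.+1 -> R) : (forall i, 0 < Q i) -> \sum_i Q i = 1 ->
  (lift_entropy phi L mu <= (\sum_i Prob [set z | z.1 0%N = i] * - ln (Q i))%:E)%E.
Proof.
move=> Q0 Q1; apply: ge_ereal_sup => _ [N [P [mP ->]]]; rewrite lee_fin.
have muD : mu D = 1%E by case: mu_inv.
apply: (entropy_wrt_le mD muD mF FD Finv ord0 event_first _ Q0 Q1).
  by move=> i; apply: measurable_event.
move=> e e0.
have e'0 : 0 < e / N.+1%:R by rewrite divr_gt0.
have /choice[q0 Hq0] : forall i, exists q0, forall q, (q0 <= q)%N ->
    exists B, Prob (bad_guess (P @^-1` [set i]) q B) <= e / N.+1%:R.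
  by move=> i; have [_ /(_ _ e'0)] := guessable_measurable (mP i).
pose q := \max_i q0 i; exists q.
have /choice[B HB] : forall i, exists B, Prob (bad_guess (P @^-1` [set i]) q B) <= e / N.+1%:R.
  by move=> i; apply: Hq0; exact: leq_bigmax.
(* If none of the tests errs, the true label is the only one accepted, so any accepted label is
   correct; the default serves words that no test accepts. *)
pose est s := odflt (P point) [pick i | B i s]; exists est.
have mP' i : ev (P @^-1` [set i]) by exact: (measurable_event mD (mP i)).
have mE := event_word_eq mD mF FD event_first mP' (2 * q) q est.
have mbad i : ev (bad_guess (P @^-1` [set i]) q (B i)) by exact: event_bad_guess.
apply: le_trans (_ : Prob [set z | exists i, bad_guess (P @^-1` [set i]) q (B i) z] <= _).
  apply: le_Pr; [exact: mE|exact: event_exists|].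
  move=> z _ /= err; apply: contrapT => ok; move: err; rewrite word_lift; apply/negP; rewrite negbK /est.
  have H i : (P (iter q F z) = i) <-> B i (mkseq z.1 (2 * q)).
    by apply: contrapT => h; apply: ok; exists i.
  case: pickP => [i /H <- //|none /=].
  by have := none (P (iter q F z)); rewrite (proj1 (H _)).
apply: le_trans (Pr_exists_le mu mD mbad) _.
apply: le_trans (ler_sum _ (fun i _ => HB i)) _.
rewrite sumr_const card_ord -[(e / _) *+ N]mulr_natl mulrCA ler_piMr ?(ltW e0)//.
by rewrite ler_pdivrMr// mul1r ler_nat.
Qed.

End guessing.

(** * The lift of the Bernoulli shift *)

Section digits.
Context (R : realType) (m : nat).
Local Notation M := m.+1.
Local Notation TR := (measurableTypeR R).

(* The Bernoulli measure is the law of the base [M] digits of a uniform point of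
   the unit interval. *)
Definition digit (n : nat) (t : R) : 'I_M := inord (Num.truncn (t * (M ^ n.+1)%:R) %% M)%N.

Definition digits (t : R) : symbol_space m := fun n => digit n t.

Lemma truncn_divn (x : R) : 0 <= x -> (Num.truncn (x * M%:R) %/ M = Num.truncn x)%N.
Proof.
move=> x0; have /andP[a1 a2] := truncn_itv x0.
have xM0 : 0 <= x * M%:R by rewrite mulr_ge0.
have /andP[b1 b2] := truncn_itv xM0.
apply/eqP; rewrite eqn_leq; apply/andP; split.
  rewrite -ltnS ltn_divLR// -(ltr_nat R); apply: le_lt_trans b1 _.
  by rewrite natrM ltr_pM2r// ltr0n.
rewrite leq_divRL// -ltnS -(ltr_nat R); apply: le_lt_trans b2.
by rewrite natrM ler_wpM2r.
Qed.

Lemma measurable_truncn_eq (a : R) (k : nat) : 0 < a ->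
  measurable ([set t : R | Num.truncn (t * a) = k] : set TR).
Proof.
move=> a0.
have ge (j : nat) : measurable ([set t : R | (j <= Num.truncn (t * a))%N] : set TR).
  case: j => [|j]; first by rewrite (_ : [set _ | _] = setT)//; apply/seteqP; split.
  rewrite (_ : [set _ | _] = `[j.+1%:R / a, +oo[%classic); first exact: measurable_itv.
  apply/seteqP; split=> t /=; rewrite in_itv/= andbT ler_pdivrMr//.
    rewrite ltnNge truncn_le_nat -leNgt //.
  by move=> h; rewrite ltnNge truncn_le_nat -leNgt.
rewrite (_ : [set _ | _] = [set t | (k <= Num.truncn (t * a))%N] `\` [set t | (k.+1 <= Num.truncn (t * a))%N]).
  exact: measurableD.
apply/seteqP; split=> t /=; first by move=> ->; rewrite ltnn.
by move=> [h /negP]; rewrite -leqNgt => h'; apply/eqP; rewrite eqn_leq h h'.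
Qed.

Lemma measurable_digit n i : measurable ([set t : R | digit n t = i] : set TR).
Proof.
pose a : R := (M ^ n.+1)%:R.
have a0 : 0 < a by rewrite ltr0n expn_gt0.
rewrite (_ : [set _ | _] = \bigcup_(k in [set k | (inord (k %% M) : 'I_M) = i])
   [set t : R | Num.truncn (t * a) = k]).
  by apply: bigcup_measurable => k _; exact: measurable_truncn_eq.
apply/seteqP; split=> t /=; first by move=> h; exists (Num.truncn (t * a)).
by move=> [k /= ki tk]; rewrite /digit tk.
Qed.

Lemma measurable_digits : @measurable_fun _ _ TR (symbol_space m) setT digits.
Proof.
apply: (@measurability _ _ (measurableTypeR R) (symbol_space m) setT _ (@cylinders m)) => //.
move=> _ [_ [n [i ->]] <-]; rewrite setTI; exact: measurable_digit.
Qed.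

(** The integer with base [M] digits [w 0], ..., [w (n - 1)], most significant first. *)
Fixpoint code (w : nat -> 'I_M) n : nat := if n is k.+1 then (M * code w k + w k)%N else 0%N.

Lemma code_lt w n : (code w n < M ^ n)%N.
Proof.
elim: n => //= n IH; rewrite expnS; have := ltn_ord (w n) => h.
apply: (@leq_trans (M * (code w n).+1)%N); last by rewrite leq_mul2l IH orbT.
by rewrite mulnS addnC ltn_add2r.
Qed.

Lemma digits_code (w : nat -> 'I_M) n (t : R) : 0 <= t < 1 ->
  (forall k, (k < n)%N -> digit k t = w k) <-> Num.truncn (t * (M ^ n)%:R) = code w n.
Proof.
move=> /andP[t0 t1]; elim: n => [|n IH].
  rewrite expn0 mulr1 /=; split=> // _; apply/eqP.
  by rewrite -leqn0 truncn_le_nat.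
have E : Num.truncn (t * (M ^ n.+1)%:R) =
    (M * Num.truncn (t * (M ^ n)%:R) + digit n t)%N.
  rewrite /digit inordK ?ltn_pmod// {1}(divn_eq (Num.truncn (t * (M ^ n.+1)%:R)) M) mulnC.
  by rewrite expnSr natrM mulrA truncn_divn// mulr_ge0.
split=> [h|].
  rewrite E (proj1 IH) => [|k kn]; last by apply: h; exact: leqW.
  by rewrite h.
rewrite E /= => h k; rewrite ltnS.
have hd : Num.truncn (t * (M ^ n)%:R) = code w n.
  have := congr1 (divn^~ M) h.
  by rewrite mulnC divnMDl// mulnC divnMDl// !divn_small ?addn0.
rewrite leq_eqVlt => /orP[/eqP ->|kn]; last exact: (proj2 IH hd).
by move: h; rewrite hd => /addnI h; exact: val_inj.
Qed.

Definition bernoulli_symbols : probability (symbol_space m) R :=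
  distribution (uniform_prob (@ltr01 R)) (@mfun_Sub _ _ TR (symbol_space m) _ (mem_set measurable_digits)).

Definition prefix_cylinder n (w : nat -> 'I_M) : set (symbol_space m) :=
  [set s | forall k, (k < n)%N -> s k = w k].

Lemma bernoulli_prefix n w : bernoulli_symbols (prefix_cylinder n w) = ((M%:R ^- n)%R)%:E.
Proof.
set A : set TR := digits @^-1` prefix_cylinder n w.
have mA : measurable A.
  rewrite (_ : A = \bigcap_(k in [set k | (k < n)%N]) [set t | digit k t = w k]).
    by apply: bigcap_measurableType => k _; exact: measurable_digit.
  by apply/seteqP; split=> t h k kn; exact: h.
pose q : R := (M ^ n)%:R; have q0 : 0 < q by rewrite ltr0n expn_gt0.
pose v : R := (code w n)%:R.
have vq : v + 1 <= q by rewrite /v natr1 ler_nat code_lt.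
pose I : set TR := `[v / q, (v + 1) / q[%classic.
have mI : measurable I by exact: measurable_itv.
have AI t : 0 <= t < 1 -> A t <-> I t.
  move=> t01; have [t0 t1] := andP t01.
  have -> : A t <-> Num.truncn (t * q) = code w n by exact: digits_code.
  rewrite /I /= in_itv/= ler_pdivrMr// ltr_pdivlMr//; split=> [E|/andP[a b]].
    by have := truncn_itv (mulr_ge0 t0 (ltW q0)); rewrite E -natr1.
  by apply/eqP; rewrite truncn_eq ?mulr_ge0 ?(ltW q0)// a -natr1.
have I01 t : I t -> 0 <= t < 1.
  rewrite /I /= in_itv/= => /andP[a b]; apply/andP; split.
    by apply: le_trans a; rewrite divr_ge0// ltW.
  by apply: lt_le_trans b _; rewrite ler_pdivrMr// mul1r.
have -> : bernoulli_symbols (prefix_cylinder n w) = lebesgue_measure (A `&` `[0%R, 1%R]%classic).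
  rewrite /bernoulli_symbols /distribution /pushforward -/A /= /uniform_prob.
  rewrite integral_uniform_pdf (eq_integral (fun=> 1%E)).
    by rewrite integral_cst ?mul1e//; apply: measurableI => //; exact: measurable_itv.
  by move=> t /set_mem[_]; rewrite /uniform_pdf /= in_itv/= => ->; rewrite subr0 invr1.
have LI : lebesgue_measure I = (M%:R ^- n)%:E.
  rewrite /I lebesgue_measure_itv/= lte_fin ltr_pM2r ?invr_gt0// ltrDl ltr01 -EFinB.
  by rewrite -mulrBl addrAC subrr add0r mul1r /q natrX.
apply/eqP; rewrite eq_le -LI; apply/andP; split.
  (* The uniform law is carried by the closed unit interval; the digits of its right endpoint are
     not described by [I], and a null point is added to cover it. *)
  apply: (@le_trans _ _ (lebesgue_measure (I `|` [set 1%R]))).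
    apply: le_measure; rewrite ?inE.
    - by apply: measurableI => //; exact: measurable_itv.
    - by apply: measurableU => //; exact: measurable_set1.
    move=> t [At]; rewrite /= in_itv/= => /andP[t0]; rewrite le_eqVlt => /orP[/eqP ->|t1].
      by right.
    by left; apply/(AI t) => //; rewrite t0.
  have m1 : measurable ([set 1%R] : set TR) by exact: measurable_set1.
  apply: le_trans (measureU2 lebesgue_measure mI m1) _.
  by rewrite /= lebesgue_measure_set1 adde0.
apply: le_measure; rewrite ?inE//.
  by apply: measurableI => //; exact: measurable_itv.
move=> t It; have t01 := I01 t It; split; first exact/(AI t).
by rewrite /= in_itv/=; case/andP: t01 => -> /ltW.
Qed.

End digits.

Lemma measure_exists_ord (R : realType) (dT : measure_display) (T : measurableType dT)
    (mu : {measure set T -> \bar R}) n (F : 'I_n -> set T) :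
  (forall i, measurable (F i)) -> (forall i j s, F i s -> F j s -> i = j) ->
  mu [set s | exists i, F i s] = (\sum_(i < n) mu (F i))%E.
Proof.
move=> mF dF; rewrite -measure_bigsetU_ord//; last first.
  by move=> i j _ _ [s [Fi Fj]]; exact: dF Fi Fj.
congr (mu _); rewrite -big_enum -bigcup_seq; apply/seteqP; split=> s /=.
  by move=> [i Fi]; exists i => //=; rewrite mem_enum.
by move=> [i _ Fi]; exists i.
Qed.

(** * Bernoulli measures and the two-sided shift *)

Section symbol_measures.
Context (R : realType) (m : nat).
Local Notation M := m.+1.
Local Notation S := (symbol_space m).

Lemma measurable_prefix n w : measurable (@prefix_cylinder m n w).
Proof.
rewrite (_ : prefix_cylinder n w = \bigcap_(k in [set k | (k < n)%N]) [set s : S | s k = w k]).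
  by apply: bigcap_measurableType => k _; exact: measurable_cylinder.
by apply/seteqP; split=> s h k kn; exact: h.
Qed.

(** Unlike the one-coordinate [cylinders], prefix cylinders together with the empty set are stable
    under intersection, so they determine finite measures. *)
Definition prefix_sets : set (set S) :=
  [set C | C = set0 \/ exists n w, C = prefix_cylinder n w].

Definition extend_word n (u : {ffun 'I_n -> 'I_M}) : nat -> 'I_M :=
  fun k => if insub k is Some j then u j else ord0.

Lemma extend_wordE n (u : {ffun 'I_n -> 'I_M}) (k : 'I_n) : extend_word u k = u k.
Proof. by rewrite /extend_word valK. Qed.

Lemma cylinder_prefix n (i : 'I_M) : [set s : S | s n = i] =
  \bigcup_(u in [set u : {ffun 'I_n.+1 -> 'I_M} | u ord_max = i]) prefix_cylinder n.+1 (extend_word u).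
Proof.
apply/seteqP; split=> s /=.
  move=> sn; exists [ffun k : 'I_n.+1 => s k] => /=; first by rewrite ffunE.
  by move=> k kn; have := extend_wordE [ffun k : 'I_n.+1 => s k] (Ordinal kn); rewrite ffunE /= => ->.
move=> [u /= <- h]; have := extend_wordE u ord_max => /= <-.
exact: h.
Qed.

Lemma measurable_prefix_sets : @measurable _ S = <<s prefix_sets >>.
Proof.
apply/seteqP; split.
  apply: smallest_sub; first exact: (@sigma_algebra_measurable _ (g_sigma_algebraType prefix_sets)).
  move=> _ [n [i ->]]; rewrite cylinder_prefix.
  have : measurable (\bigcup_(u in [set u : {ffun 'I_n.+1 -> 'I_M} | u ord_max = i])
    (prefix_cylinder n.+1 (extend_word u) : set (g_sigma_algebraType prefix_sets))).
    apply: fin_bigcup_measurable => // u _; apply: sub_sigma_algebra.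
    by right; exists n.+1, (extend_word u).
  by [].
apply: smallest_sub; first exact: sigma_algebra_measurable.
by move=> _ [->|[n [w ->]]]; [exact: measurable0|exact: measurable_prefix].
Qed.

Lemma prefix_setsI : setI_closed prefix_sets.
Proof.
have H n n' w w' : (n <= n')%N -> prefix_sets (prefix_cylinder n w `&` prefix_cylinder n' w').
  move=> nn'; have [ww|nww] := pselect (forall k, (k < n)%N -> w k = w' k).
    right; exists n', w'; apply/seteqP; split=> [s []//|s h]; split=> // k kn.
    by rewrite ww// h// (leq_trans kn).
  left; apply/seteqP; split=> // s [h h']; apply: nww => k kn.
  by rewrite -h// h'// (leq_trans kn).
move=> A B [->|[n [w ->]]]; first by left; rewrite set0I.
move=> [->|[n' [w' ->]]]; first by left; rewrite setI0.
by case/orP: (leq_total n n') => [/H//|/H]; rewrite setIC.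
Qed.

Lemma symbol_measure_unique (m1 m2 : {measure set S -> \bar R}) :
  (forall n w, m1 (prefix_cylinder n w) = m2 (prefix_cylinder n w)) ->
  (m1 setT < +oo)%E -> forall A, measurable A -> m1 A = m2 A.
Proof.
move=> m12 fin; apply: (@measure_unique _ _ _ prefix_sets (fun=> setT)).
- exact: measurable_prefix_sets.
- exact: prefix_setsI.
- by move=> _; right; exists 0%N, (fun=> ord0); apply/seteqP; split.
- by rewrite bigcup_const//; exists 0%N.
- by move=> _ [->|[n [w ->]]]; rewrite ?measure0.
- by [].
Qed.

Definition cons_symbol (i : 'I_M) (u : S) : S := fun n => if n is k.+1 then u k else i.
Definition shift_symbol (w : S) : S := fun n => w n.+1.

Lemma measurable_cons_symbol i : measurable_fun setT (cons_symbol i).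
Proof.
apply: (@measurability _ _ S S setT _ (@cylinders m)) => //.
move=> _ [_ [[|n] [j ->]] <-]; rewrite setTI; last exact: (measurable_cylinder n j).
have [->|ij] := eqVneq i j.
  by rewrite (_ : _ @^-1` _ = setT)//; apply/seteqP; split.
by rewrite (_ : _ @^-1` _ = set0)//; apply/seteqP; split=> // u /= E; rewrite E eqxx in ij.
Qed.

Lemma preimage_cons_symbol i (A : set S) : measurable A -> measurable (cons_symbol i @^-1` A).
Proof. by move=> mA; rewrite -[X in measurable X]setTI; exact: measurable_cons_symbol. Qed.

Lemma preimage_shift_symbol (A : set S) : measurable A -> measurable (shift_symbol @^-1` A).
Proof. by move=> mA; rewrite -[X in measurable X]setTI; exact: measurable_shift. Qed.

Let B := bernoulli_symbols R m.

Let first_is (i : 'I_M) : set S := [set s | s 0%N = i].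
Let mfirst i : measurable (first_is i). Proof. exact: measurable_cylinder. Qed.

(** Independence of the first letter from the others. As functions of [A] both sides are finite
    measures, a pushed-forward restriction and a multiple of [B], and they agree on prefix
    cylinders. *)
Lemma bernoulli_first (i : 'I_M) (A : set S) : measurable A ->
  B (first_is i `&` shift_symbol @^-1` A) = ((M%:R^-1)%:E * B A)%E.
Proof.
have M0 : 0 <= M%:R^-1 :> R by [].
have ms : measurable_fun setT (shift_symbol : S -> S) by exact: measurable_shift.
move=> mA; have E (C : set S) :
    measurable C -> B (first_is i `&` shift_symbol @^-1` C) = pushforward (mrestr B (mfirst i)) shift_symbol C.
  by move=> mC; rewrite /pushforward /mrestr setIC.
rewrite E//.
have -> : ((M%:R^-1)%:E * B A)%E = mscale (NngNum M0) B A by [].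
move: A mA; apply: symbol_measure_unique => [n w|].
  rewrite [LHS](_ : _ = B (first_is i `&` shift_symbol @^-1` prefix_cylinder n w)); last first.
    by symmetry; apply: E; exact: measurable_prefix.
  have -> : first_is i `&` shift_symbol @^-1` prefix_cylinder n w = prefix_cylinder n.+1 (cons_symbol i w).
    apply/seteqP; split=> s.
      by move=> [s0 sw] [|k] //=; rewrite ltnS => kn; exact: sw.
    by move=> h; split=> [|k kn]; [exact: (h 0%N)|exact: (h k.+1)].
  transitivity ((M%:R ^- n.+1)%R%:E : \bar R); first exact: bernoulli_prefix.
  transitivity ((M%:R^-1)%:E * (M%:R ^- n)%R%:E : \bar R)%E.
    by rewrite -EFinM exprS invfM.
  by congr (_ * _)%E; symmetry; exact: bernoulli_prefix.
rewrite /pushforward /mrestr; apply: le_lt_trans (ltry 1).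
by apply: probability_le1; apply: measurableI => //; exact: preimage_shift_symbol.
Qed.

(** Prepending an independent uniform letter does not change the law: split [A] by its first letter
    and apply [bernoulli_first]. *)
Lemma bernoulli_stationary (A : set S) : measurable A ->
  (\sum_(i < M) (M%:R^-1)%:E * B (cons_symbol i @^-1` A))%E = B A.
Proof.
move=> mA.
have mF i : measurable (first_is i `&` shift_symbol @^-1` (cons_symbol i @^-1` A)).
  apply: measurableI => //; apply: preimage_shift_symbol; exact: preimage_cons_symbol.
have eta s : cons_symbol (s 0%N) (shift_symbol s) = s by apply/funext => -[|k].
have {2}-> : A = [set s | exists i, (first_is i `&` shift_symbol @^-1` (cons_symbol i @^-1` A)) s].
  apply/seteqP; split=> s.
    by move=> As; exists (s 0%N); split => //=; rewrite eta.
  by move=> [i [/= <-]]; rewrite eta.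
rewrite measure_exists_ord//; last by move=> i j s [/= <- _] [].
by apply: eq_bigr => i _; symmetry; apply: bernoulli_first; exact: preimage_cons_symbol.
Qed.

(* The two-sided shift; the second component lists the past, most recent letter
   first. *)
Definition baker (p : S * S) : S * S := (shift_symbol p.1, cons_symbol (p.1 0%N) p.2).

Lemma measurable_baker : measurable_fun setT baker.
Proof.
have fst_cyl (n : nat) (j : 'I_M) : measurable [set p : S * S | p.1 n = j].
  have := @measurable_fst _ _ S S measurableT _ (measurable_cylinder n j).
  by rewrite setTI.
have snd_cyl (n : nat) (j : 'I_M) : measurable [set p : S * S | p.2 n = j].
  have := @measurable_snd _ _ S S measurableT _ (measurable_cylinder n j).
  by rewrite setTI.
apply: measurable_fun_pair; apply: (@measurability _ _ (S * S)%type S setT _ (@cylinders m)) => //.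
  by move=> _ [_ [n [j ->]] <-]; rewrite setTI; exact: (fst_cyl n.+1 j).
by move=> _ [_ [[|n] [j ->]] <-]; rewrite setTI; [exact: (fst_cyl 0%N j)|exact: (snd_cyl n j)].
Qed.

(** By uniqueness of the product measure, rectangles suffice. The letter moved from the future to
    the past carries its factor [M%:R^-1] from one component to the other. *)
Lemma baker_preserves (A : set (S * S)) : measurable A ->
  (B \x B)%E (baker @^-1` A) = (B \x B)%E A.
Proof.
move=> mA; symmetry.
have mb := measurable_baker.
apply: (@product_measure_unique _ _ _ _ _ B B (pushforward (B \x B)%E baker)) => // A1 A2 mA1 mA2.
pose G i : set (S * S) := (first_is i `&` shift_symbol @^-1` A1) `*` (cons_symbol i @^-1` A2).
transitivity ((B \x B)%E [set p | exists i, G i p]).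
  rewrite /pushforward; congr (product_measure1 B B _).
  apply/seteqP; split=> [[w u] /= [h1 h2]|[w u] /= [i [[<- h1] h2]]]; last by split.
  by exists (w 0%N).
have m1 i : measurable (first_is i `&` shift_symbol @^-1` A1).
  by apply: measurableI => //; exact: preimage_shift_symbol.
rewrite measure_exists_ord; last 2 first.
- by move=> i; apply: measurableX => //; exact: preimage_cons_symbol.
- by move=> i j p [[/= <- _] _] [[]].
transitivity (B A1 * \sum_(i < M) (M%:R^-1)%:E * B (cons_symbol i @^-1` A2))%E; last first.
  by congr (_ * _)%E; exact: bernoulli_stationary.
rewrite ge0_sume_distrr; last by move=> i _; rewrite mule_ge0.
apply: eq_bigr => i _.
transitivity (B (first_is i `&` shift_symbol @^-1` A1) * B (cons_symbol i @^-1` A2))%E.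
  by apply: product_measure1E => //; exact: preimage_cons_symbol.
transitivity ((M%:R^-1)%:E * B A1 * B (cons_symbol i @^-1` A2))%E.
  by congr (_ * _)%E; exact: bernoulli_first.
by rewrite muleCA muleA.
Qed.

End symbol_measures.

(** * The invariant measure carried by the two-sided Bernoulli shift *)

Section maximal_measure.
Context (R : realType) (m d : nat).
Variables (phi : 'I_m.+1 -> 'rV[R]_d -> 'rV[R]_d) (U L : set 'rV[R]_d).
Hypothesis oU : open U.
Hypothesis phi_cont : forall i x, U x -> {for x, continuous (phi i)}.
Hypothesis L0 : L !=set0.
Hypothesis cL : compact L.
Hypothesis LU : L `<=` U.
Hypothesis Linv : forall i x, L x -> L (phi i x).
Variable c : R.
Hypothesis c01 : 0 < c < 1.
Hypothesis phi_contract : forall i x y, L x -> L y ->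
  enorm (phi i x - phi i y) <= c * enorm (x - y).

Local Notation M := m.+1.
Local Notation S := (symbol_space m).
Local Notation T := (lift_space R m d).
Local Notation D := (@lift_domain R m d L).
Local Notation F := (@lift_map R m d phi).

Let cc : 0 <= c < 1. Proof. by case/andP: c01 => /ltW -> ->. Qed.

Lemma comp_rev_contractL b x y : L x -> L y ->
  enorm (comp_rev phi b x - comp_rev phi b y) <= c ^+ size b * enorm (x - y).
Proof.
move=> Lx Ly; elim/last_ind: b => [|b i IH]; first by rewrite mul1r.
rewrite !comp_rev_rcons size_rcons exprS -mulrA.
apply: le_trans (phi_contract _ _ _) _; try exact: comp_revL.
by rewrite ler_wpM2l//; case/andP: cc.
Qed.

(** Here [w] lists the past with the most recent letter first, so the word is reversed for
    [comp_rev] and [w 0] acts last. *)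
Definition piece (w : S) n : set 'rV[R]_d :=
  [set x | exists2 y, L y & comp_rev phi (rev (mkseq w n)) y = x].

(* The pieces are nested and shrink to a point, so the default value [0] is never
   taken. *)
Definition limit_point (w : S) : 'rV[R]_d := xget 0 [set x | forall n, piece w n x].

Lemma piece_shrink (e : R) : 0 < e -> exists n0, forall n, (n0 <= n)%N ->
  forall w x y, piece w n x -> piece w n y -> enorm (x - y) <= e.
Proof.
move=> e0; have [dia Hdia] := compact_diameter cL.
have dia1 : 0 < `|dia| + 1 by rewrite ltr_wpDl.
have [n0 Hn0] := exists_expr_le cc (divr_gt0 e0 dia1).
exists n0 => n /Hn0 cn w x y [x' Lx' <-] [y' Ly' <-].
apply: le_trans (comp_rev_contractL _ Lx' Ly') _; rewrite size_rev size_mkseq.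
apply: le_trans (_ : e / (`|dia| + 1) * (`|dia| + 1) <= _); last by rewrite divfK ?gt_eqF.
apply: ler_pM => //; first by rewrite exprn_ge0//; case/andP: cc.
  exact: enorm_ge0.
by apply: le_trans (Hdia _ _ Lx' Ly') _; apply: le_trans (ler_norm _) _; rewrite lerDl.
Qed.

Lemma piece_decr w n k : (n <= k)%N -> piece w k `<=` piece w n.
Proof.
move=> /subnK <- x [y Ly <-]; rewrite addnC /mkseq iotaD map_cat rev_cat comp_rev_cat.
by exists (comp_rev phi (rev [seq w i | i <- iota (0 + n) (k - n)]) y) => //; exact: comp_revL.
Qed.

(** The images of a fixed point of [L] under longer and longer pasts have a cluster point by
    compactness; it lies in every piece since the pieces are closed and decreasing. *)
Lemma limit_pointP w n : piece w n (limit_point w).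
Proof.
suff [x Hx] : exists x, forall n, piece w n x.
  by move: n; exact: (@xgetI _ 0 [set x | forall n, piece w n x] x Hx).
have [y0 Ly0] := L0.
pose u k := comp_rev phi (rev (mkseq w k)) y0.
have Lu k : L (u k) by exact: comp_revL.
have FL : (u @ \oo) L by exists 0%N => // k _; exact: Lu.
have [x [Lx xu]] := cL (fmap_proper_filter u eventually_filter) FL.
exists x => k; have cP : closed (piece w k) by exact: (closed_image phi_cont cL LU Linv).
apply: cP => V Vx; apply: xu => //.
exists k => // j /= kj; apply: (piece_decr kj); exists y0 => //.
Qed.

Lemma limit_point_unique w x : (forall n, piece w n x) -> x = limit_point w.
Proof.
move=> Hx; apply/eqP; rewrite -subr_eq0; apply/eqP/enorm_eq0/eqP.
rewrite eq_le enorm_ge0 andbT; apply/ler_addgt0Pr => e e0; rewrite add0r.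
have [n Hn] := piece_shrink e0.
exact: (Hn n (leqnn n) w _ _ (Hx n) (limit_pointP w n)).
Qed.

Lemma limit_point_L w : L (limit_point w).
Proof. by have [y Ly <-] := limit_pointP w 0. Qed.

Lemma limit_point_cons i w : limit_point (cons_symbol i w) = phi i (limit_point w).
Proof.
symmetry; apply: limit_point_unique => -[|n].
  by exists (phi i (limit_point w)) => //; apply: Linv; exact: limit_point_L.
have [y Ly <-] := limit_pointP w n.
exists y => //; rewrite -comp_rev_rcons -rev_cons; congr (comp_rev phi (rev _) y).
by rewrite /mkseq /= -(addn0 1%N) iotaDl -map_comp.
Qed.

Lemma measurable_word n (P : pred (seq 'I_M)) : measurable [set w : S | P (mkseq w n)].
Proof.
rewrite (_ : [set _ | _] = \bigcup_(u in [set u : {ffun 'I_n -> 'I_M} | P (mkseq (extend_word u) n)])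
    prefix_cylinder n (extend_word u)).
  by apply: fin_bigcup_measurable => // u _; exact: measurable_prefix.
apply/seteqP; split=> w /=.
  pose u := [ffun k : 'I_n => w k].
  have E k : (k < n)%N -> w k = extend_word u k.
    by move=> kn; rewrite (extend_wordE u (Ordinal kn)) ffunE.
  move=> Pw; exists u => //=; rewrite (_ : mkseq _ n = mkseq w n)//.
  by apply/eq_in_map => k; rewrite mem_iota add0n => /andP[_ kn]; rewrite E.
move=> [u /= Pu wu]; rewrite (_ : mkseq w n = mkseq (extend_word u) n)//.
by apply/eq_in_map => k; rewrite mem_iota add0n => /andP[_ kn]; rewrite wu.
Qed.

(** The limit point lies in a closed [E] exactly when every piece meets [E], as the pieces shrink to
    it; each of these conditions depends on finitely many letters. *)
Lemma measurable_limit_point : @measurable_fun _ _ S (borel_space R d) setT limit_point.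
Proof.
have closed_case (E : set 'rV[R]_d) : closed E -> measurable (limit_point @^-1` E).
  move=> cE; rewrite (_ : _ @^-1` _ = \bigcap_n [set w : S | `[< exists2 y, L y &
      E (comp_rev phi (rev (mkseq w n)) y) >]]).
    by apply: bigcapT_measurable => n; exact: (measurable_word n (fun s => `[< exists2 y, L y & E (comp_rev phi (rev s) y) >])).
  apply/seteqP; split=> w /=.
    move=> Ew n _ /=; apply/asboolP; have [y Ly E1] := limit_pointP w n.
    by exists y => //; rewrite E1.
  move=> Hw; apply: cE => V /nbhs_enorm[r r0 HV].
  have [n Hn] := piece_shrink r0.
  have /asboolP[y Ly Ey] := Hw n I.
  exists (comp_rev phi (rev (mkseq w n)) y); split => //; apply: HV.
  by apply: (Hn n (leqnn n) w) (limit_pointP w n); exists y.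
apply: (@measurability _ _ S (borel_space R d) setT _ [set A : set 'rV[R]_d | open A]) => //.
move=> _ [A oA <-]; rewrite setTI -[A]setCK preimage_setC.
exact: (measurableC (closed_case (~` A) (open_closedC oA))).
Qed.

Definition lift_coding (p : S * S) : T := (p.1, limit_point p.2).

Lemma measurable_lift_coding : @measurable_fun _ _ (S * S)%type T setT lift_coding.
Proof.
have m2 : @measurable_fun _ _ (S * S)%type (borel_space R d) setT (fun p => limit_point p.2).
  exact: (measurableT_comp measurable_limit_point (@measurable_snd _ _ S S)).
have m1 : @measurable_fun _ _ (S * S)%type S setT fst by exact: measurable_fst.
exact: (measurable_fun_pair m1 m2).
Qed.

Let B := bernoulli_symbols R m.

Definition uniform_lift : probability T R :=
  distribution (B \x B)%E (@mfun_Sub _ _ (S * S)%type T _ (mem_set measurable_lift_coding)).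

Lemma uniform_liftE A : uniform_lift A = (B \x B)%E (lift_coding @^-1` A).
Proof. by []. Qed.

Lemma lift_coding_domain p : D (lift_coding p).
Proof. by split => //; exact: limit_point_L. Qed.

Lemma lift_coding_baker p : F (lift_coding p) = lift_coding (baker p).
Proof. by rewrite /lift_coding /baker /= limit_point_cons. Qed.

Lemma uniform_lift_invariant : lift_invariant phi L uniform_lift.
Proof.
split.
  rewrite uniform_liftE (_ : _ @^-1` _ = setT); first exact: probability_setT.
  by apply/seteqP; split=> // p _; exact: lift_coding_domain.
move=> A mA.
have mZA : measurable (lift_coding @^-1` A).
  by rewrite -[X in measurable X]setTI; exact: measurable_lift_coding.
transitivity ((B \x B)%E (@baker m @^-1` (lift_coding @^-1` A))); last exact: baker_preserves.
rewrite uniform_liftE; congr (product_measure1 B B _).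
apply/seteqP; split=> p; first by move=> [_ /=]; rewrite lift_coding_baker.
by move=> Ap; split; [exact: lift_coding_domain|rewrite /= lift_coding_baker].
Qed.

(** For the partition by the first letter the itineraries of length [n] are the prefixes, all of the
    same mass, so the normalised entropy is [ln M%:R] for every [n >= 1]. *)
Lemma uniform_lift_entropy : ((ln M%:R)%:E <= lift_entropy phi L uniform_lift)%E.
Proof.
apply: ereal_sup_ubound; exists M, (fun z : T => z.1 0%N); split.
  by move=> i; exact: measurable_letter.
congr EFin; symmetry; apply: cvg_lim => //.
apply: cvg_near_cst; exists 1%N => // n /= n0.
have q (s : {ffun 'I_n -> 'I_M}) :
    uniform_lift (D `&` itinerary F (fun z : T => z.1 0%N) n @^-1` [set s]) = ((M%:R ^- n)%R)%:E.
  rewrite uniform_liftE.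
  transitivity ((B \x B)%E (prefix_cylinder n (extend_word s) `*` setT)).
    congr (product_measure1 B B _); apply/seteqP; split=> [[w u]|[w u] [/= ws _]].
      move=> [_ /= E]; split => // k kn.
      rewrite (extend_wordE s (Ordinal kn)) -E ffunE iter_lift_map/= addn0//.
    split; first exact: lift_coding_domain.
    by apply/ffunP => k; rewrite ffunE iter_lift_map /= addn0 ws// extend_wordE.
  transitivity (B (prefix_cylinder n (extend_word s)) * B setT)%E.
    by apply: product_measure1E => //; exact: measurable_prefix.
  by rewrite [X in (_ * X)%E](probability_setT B) mule1; exact: bernoulli_prefix.
rewrite /partition_entropy (eq_bigr (fun=> (M%:R ^- n)%R * - (n%:R * ln M%:R))); last first.
  move=> s _; rewrite q /=; congr (_ * _).
  by rewrite lnV ?posrE ?exprn_gt0// lnXn// mulr_natl.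
rewrite sumr_const card_ffun !card_ord -[X in - X]mulr_natl natrX mulrA divff ?expf_neq0// mul1r opprK.
by rewrite mulrA mulVf ?mul1r// pnatr_eq0 -lt0n.
Qed.

End maximal_measure.

(* With [u = M * q i] and [w = (1 + u) / 2], [u * ln w >= u * (1 - w^-1)], which
   is the sum of [(u - 1) / 2], of total zero, and of a multiple of a square. *)
Lemma uniform_of_entropy (R : realType) (I : finType) (q : I -> R) (M : R) : 0 < M ->
  \sum_(i : I) M^-1 = 1 -> (forall i, 0 <= q i) -> \sum_i q i = 1 ->
  ln M <= \sum_i q i * - ln ((M^-1 + q i) / 2) -> forall i, q i = M^-1.
Proof.
move=> M0 sM q0 sq le_ent.
have Mi0 : 0 < M^-1 by rewrite invr_gt0.
pose u i := M * q i; have u0 i : 0 <= u i by rewrite mulr_ge0// ltW.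
have qu i : q i = M^-1 * u i by rewrite mulrA mulVf ?gt_eqF// mul1r.
have w0 i : 0 < (1 + u i) / 2 by have := u0 i; lra.
have bound i : (u i - 1) / 2 + (u i - 1) ^+ 2 / (2 * (1 + u i)) <= u i * ln ((1 + u i) / 2).
  have un0 : 1 + u i != 0 by have := u0 i; lra.
  have -> : (u i - 1) / 2 + (u i - 1) ^+ 2 / (2 * (1 + u i)) = u i * (1 - ((1 + u i) / 2)^-1).
    by field.
  apply: ler_wpM2l => //; have wi0 : 0 < ((1 + u i) / 2)^-1 by rewrite invr_gt0.
  by have := ln_le_sub1 wi0; rewrite lnV ?posrE//; lra.
have le0 : \sum_i u i * ln ((1 + u i) / 2) <= 0.
  rewrite -(pmulr_rle0 _ Mi0) mulr_sumr.
  have E i : q i * - ln ((M^-1 + q i) / 2) = q i * ln M - M^-1 * (u i * ln ((1 + u i) / 2)).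
    rewrite (_ : (M^-1 + q i) / 2 = M^-1 * ((1 + u i) / 2)); last by rewrite qu; ring.
    by rewrite (lnM (x := M^-1)) ?posrE// lnV ?posrE// mulrA -qu; ring.
  move: le_ent; rewrite (eq_bigr _ (fun i _ => E i)) sumrB -mulr_suml sq mul1r.
  by rewrite lerDl oppr_ge0.
have sq0 i : 0 <= (u i - 1) ^+ 2 / (2 * (1 + u i)).
  by rewrite divr_ge0 ?sqr_ge0//; have := u0 i; lra.
have su : \sum_i (u i - 1) / 2 = 0.
  rewrite -mulr_suml sumrB -mulr_sumr sq mulr1 -(mulVKf (lt0r_neq0 M0) (\sum_i 1)).
  rewrite mulr_sumr; under eq_bigr do rewrite mulr1.
  by rewrite sM mulr1 subrr mul0r.
have sumz : \sum_i (u i - 1) ^+ 2 / (2 * (1 + u i)) = 0.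
  apply/eqP; rewrite eq_le sumr_ge0// andbT; apply: le_trans le0.
  by rewrite -[leLHS]add0r -[X in X + _]su -big_split; apply: ler_sum => i _; exact: bound.
move=> i; have /eqP := sumz; rewrite psumr_eq0// => /allP/(_ i (mem_index_enum i)).
rewrite /= mulf_eq0 invr_eq0 sqrf_eq0 subr_eq0 => /orP[/eqP ui|].
  by rewrite qu ui mulr1.
by have := u0 i; move=> ? /eqP; lra.
Qed.

(** * Blocks and conclusion *)

Section blocks.
Variables (m p : nat) (k : nat -> nat).
Hypothesis k_first : k 0%N = 0%N.
Hypothesis k_incr : forall j, (j < p)%N -> (k j < k j.+1)%N.
Hypothesis k_last : k p = m.+1.

Lemma block_mono i j : (i <= j <= p)%N -> (k i <= k j)%N.
Proof.
elim: j => [|j IH] /andP[]; first by rewrite leqn0 => /eqP->.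
rewrite leq_eqVlt => /orP[/eqP->//|ij] jp.
by apply: leq_trans (ltnW (k_incr jp)); apply: IH; rewrite (ltnW jp) andbT.
Qed.

Lemma block_unique (i j j' : nat) : (j < p)%N -> (j' < p)%N ->
  (k j <= i < k j.+1)%N -> (k j' <= i < k j'.+1)%N -> j = j'.
Proof.
move=> jp jp' h h'; apply/eqP; rewrite eqn_leq; apply/andP; split; rewrite leqNgt; apply/negP => l.
  by have := @block_mono j'.+1 j; rewrite l (ltnW jp); lia.
by have := @block_mono j.+1 j'; rewrite l (ltnW jp'); lia.
Qed.

Lemma block_exists (i : 'I_m.+1) : exists j : 'I_p, (k j <= i < k j.+1)%N.
Proof.
suff H q : (q <= p)%N -> (i < k q)%N -> exists j : 'I_p, (k j <= i < k j.+1)%N.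
  by apply: (H p) => //; rewrite k_last.
elim: q => [|q IH] qp; first by rewrite k_first.
case: (ltnP i (k q)) => [h _|h1 h2]; first by apply: IH h; exact: ltnW.
by exists (Ordinal qp); rewrite /= h1 h2.
Qed.

Lemma card_interval (a b : nat) : (b <= m.+1)%N ->
  #|[pred i : 'I_m.+1 | (a <= i < b)%N]| = (b - a)%N.
Proof.
move=> bm; rewrite -sum1_card -(big_mkord (fun i => a <= i < b)%N (fun=> 1%N)).
transitivity (\sum_(a <= i < b) 1)%N; last by rewrite sum_nat_const_nat muln1.
by rewrite (big_nat_widen a b m.+1)// (big_nat_widenl a 0)//; apply: eq_bigl => i /=; rewrite andbC.
Qed.

Lemma block_representative : exists (blk : 'I_m.+1 -> 'I_p) (rep : 'I_m.+1 -> 'I_m.+1),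
  [/\ forall i, (k (blk i) <= i < k (blk i).+1)%N,
      forall i, blk (rep i) = blk i, forall i, (rep i).+1 = k (blk i).+1,
      forall i i', (rep i == rep i') = (blk i == blk i') &
      forall j, #|[pred i | blk i == j]| = (k j.+1 - k j)%N].
Proof.
have [blk blkP] := choice block_exists.
have blkE i (j : 'I_p) : (blk i == j) = (k j <= i < k j.+1)%N.
  apply/eqP/idP => [<-//|h]; exact/val_inj/(block_unique _ _ (blkP i) h).
have lastE (j : 'I_p) : (inord (k j.+1).-1 : 'I_m.+1).+1 = k j.+1.
  have /= l := k_incr (ltn_ord j).
  have : (k j.+1 <= k p)%N by apply: block_mono; rewrite ltn_ord leqnn.
  by rewrite k_last => h; rewrite inordK; lia.
(* The last letter of the block, with letters numbered from zero; this is the representative named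
   in the open set condition. *)
pose rep i : 'I_m.+1 := inord (k (blk i).+1).-1.
have blk_rep i : blk (rep i) = blk i.
  apply/eqP; rewrite blkE; have := lastE (blk i); have := k_incr (ltn_ord (blk i)).
  by rewrite -/(rep i); lia.
exists blk, rep; split=> //.
  by move=> i; exact: lastE.
  move=> i i'; apply/eqP/eqP => [E|E]; last by rewrite /rep E.
  by rewrite -blk_rep E blk_rep.
move=> j; rewrite (eq_card (B := [pred i : 'I_m.+1 | (k j <= i < k j.+1)%N])).
  by apply: card_interval; rewrite -k_last; apply: block_mono; rewrite ltn_ord leqnn.
by move=> i; rewrite !inE blkE.
Qed.

End blocks.

Lemma max_entropy_letter (R : realType) (d m : nat) (U L : set 'rV[R]_d)
    (phi : 'I_m.+1 -> 'rV[R]_d -> 'rV[R]_d) (mu : probability (lift_space R m d) R) :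
  open U -> (forall i, contraction_on U (phi i)) ->
  (forall i x, U x -> {for x, continuous (phi i)}) ->
  L !=set0 -> compact L -> L `<=` U -> (forall i x, L x -> L (phi i x)) ->
  max_entropy_measure phi L mu ->
  forall i, Pr mu (lift_domain L) [set z | z.1 0%N = i] = (m.+1)%:R^-1.
Proof.
move=> oU ctr phi_cont L0 cL LU Linv [mu_inv mu_max].
have [c c01 Hc] := uniform_contraction ctr.
have HcL i x y : L x -> L y -> enorm (phi i x - phi i y) <= c * enorm (x - y).
  by move=> Lx Ly; apply: Hc; exact: LU.
pose q i := Pr mu (lift_domain L) [set z : lift_space R m d | z.1 0%N = i].
have mL : measurable (@lift_domain R m d L) by exact: measurable_lift_domain.
have q0 i : 0 <= q i by exact: Pr_ge0.
have sq : \sum_i q i = 1.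
  apply: (sum_Pr mL mu_inv.1 (X := fun z : lift_space R m d => z.1 0%N)) => i.
  by apply: measurable_event => //; exact: measurable_letter.
have M0 : 0 < m.+1%:R :> R by rewrite ltr0n.
have sM : \sum_(i : 'I_m.+1) m.+1%:R^-1 = 1 :> R.
  by rewrite sumr_const card_ord -[X in X = _]mulr_natl divff// gt_eqF.
apply: (uniform_of_entropy M0) => //.
have Q0 i : 0 < (m.+1%:R^-1 + q i) / 2.
  by rewrite divr_gt0// ltr_pwDl// invr_gt0.
have sQ : \sum_i (m.+1%:R^-1 + q i) / 2 = 1.
  by rewrite -mulr_suml big_split /= sM sq; lra.
rewrite -lee_fin.
have := uniform_lift_entropy phi_cont L0 cL LU Linv c01 HcL.
move=> /le_trans; apply.
apply: le_trans (lift_entropy_le oU phi_cont cL LU Linv c01 HcL mu_inv Q0 sQ).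
exact: (mu_max _ (uniform_lift_invariant phi_cont L0 cL LU Linv c01 HcL)).
Qed.

Theorem proposition1 (R : realType) (d m p : nat)
    (U L : set 'rV[R]_d)
    (phi : 'I_m.+1 -> 'rV[R]_d -> 'rV[R]_d)
    (k : nat -> nat)
    (mu : probability (lift_space R m d) R)
    (d_gt0 : (0 < d)%N)
    (U_open : open U)
    (phi_contraction : forall i, contraction_on U (phi i))
    (phi_conformal : forall i, conformal_on U (phi i))
    (phi_inj : forall i x y, U x -> U y -> phi i x = phi i y -> x = y)
    (L_limit : is_limit_set phi L)
    (L_sub : L `<=` U)
    (k_first : k 0%N = 0%N)
    (k_incr : forall j, (j < p)%N -> (k j < k j.+1)%N)
    (k_last : k p = m.+1)
    (phi_blocks : forall (j : nat) (i i' : 'I_m.+1), (j < p)%N ->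
       (k j <= i < k j.+1)%N -> (k j <= i' < k j.+1)%N ->
       forall x, U x -> phi i x = phi i' x)
    (blocks_osc : open_set_condition U phi
       [set i : 'I_m.+1 | exists2 j, (j < p)%N & i.+1 = k j.+1])
    (mu_max : max_entropy_measure phi L mu) :
  cvgn (overlap_rate phi L mu) /\
  overlap_number phi L mu =
    expR ((\sum_(j < p) (k j.+1 - k j)%:R * ln (k j.+1 - k j)%:R) / m.+1%:R).
Proof.
have [L0 cL LE] := L_limit.
have Linv i x : L x -> L (phi i x).
  by move=> Lx; rewrite LE; exists i => //; exists x.
have Lsurj x : L x -> exists i, exists2 y, L y & phi i y = x.
  by rewrite {1}LE => -[i _ [y Ly yx]]; exists i, y.
have phi_cont i x : U x -> {for x, continuous (phi i)}.
  by case: (phi_conformal i) => dphi _ _ Ux; exact/differentiable_continuous/dphi.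
have [blk [rep [blkP blk_rep repS rep_eq card_blk]]] := block_representative k_first k_incr k_last.
have rep_idem i : rep (rep i) = rep i by apply/eqP; rewrite rep_eq blk_rep.
have phi_rep i x : U x -> phi (rep i) x = phi i x.
  move=> Ux; have := blkP (rep i); rewrite blk_rep => h.
  exact: (phi_blocks _ _ _ (ltn_ord (blk i)) h (blkP i) x Ux).
have osc : open_set_condition U phi [set i | [pred i | rep i == i] i].
  rewrite (_ : [set i | _] = [set i : 'I_m.+1 | exists2 j, (j < p)%N & i.+1 = k j.+1])//.
  apply/seteqP; split=> i /=.
    by move=> /eqP <-; exists (blk i) => //; rewrite repS.
  move=> [j jp ik]; rewrite -val_eqE /= -eqSS repS ik.
  have l := k_incr _ jp.
  suff -> : (blk i : nat) = j by [].
  apply: (block_unique k_first k_incr k_last (ltn_ord _) jp (blkP i)).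
  by rewrite -ik ltnSn andbT -ltnS ik.
have LsurjJ x : L x -> exists2 i, [pred i | rep i == i] i & exists2 y, L y & phi i y = x.
  move=> /Lsurj[i [y Ly yx]]; exists (rep i); first by rewrite /= rep_idem.
  by exists y => //; rewrite phi_rep//; exact: L_sub.
have [N HN] := bounded_codings d_gt0 U_open phi_contraction phi_conformal phi_inj
  L0 cL L_sub Linv LsurjJ osc.
have codes_le n x : (#|codes phi L rep n x| <= N)%N.
  by rewrite cardsE; exact: HN.
have [mu_inv _] := mu_max.
have letterE := max_entropy_letter U_open phi_contraction phi_cont L0 cL L_sub Linv mu_max.
set s := _ / _.
have rateE n : (0 < n)%N -> overlap_rate phi L mu n = s.
  move=> n0; rewrite (overlap_rateE U_open phi_cont phi_inj cL L_sub Linv Lsurj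
    rep_idem phi_rep mu_inv codes_le n0).
  under eq_bigr do rewrite letterE.
  rewrite -mulr_sumr mulrC; congr (_ / _).
  (* A block of size [b] contributes [ln b] once for each of its letters, whence [b * ln b]. *)
  rewrite (partition_big blk xpredT)//=; apply: eq_bigr => j _.
  rewrite (eq_bigr (fun=> ln (k j.+1 - k j)%:R)); last first.
    move=> i /eqP ij; congr (ln _%:R); rewrite -card_blk -ij.
    by apply: eq_card => i'; rewrite !inE rep_eq.
  by rewrite sumr_const card_blk mulr_natl.
have cvg_s : overlap_rate phi L mu n @[n --> \oo] --> s.
  (* The rate is constant from [n = 1] on; for [n = 0] the factor [n%:R^-1] is zero by
     convention. *)
  by apply: cvg_near_cst; exists 1%N => // n; exact: rateE.
split; first by apply/cvg_ex; exists s.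
by rewrite /overlap_number; congr expR; exact: cvg_lim.
Qed.
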